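(* Let $\lambda$ be a $b$-partition of $n$ and set $\alpha=|\lambda|\in\mathcal C(n,b)$. The $\mathcal H$-module $V^\lambda$ has the following properties. \begin{enumerate} \item $V^\lambda$ is a free $A$-module with a basis $\{v_\tau\mid\tau\in\mathrm{SYT}^\lambda\}$ indexed by $\mathrm{SYT}^\lambda$ (such that the following hold). \item Suppose $\tau\in\mathrm{SYT}^\lambda$ and $\tau=w\cdot\tau_0$ with $w\in W^\alpha$ and $\tau_0\in\mathrm{SYT}^\lambda_0$. Then $v_\tau=t_wv_{\tau_0}$. \item For $w\in W^\alpha$, the weight space $V^\lambda_{w\cdot\chi_\alpha}$ is the $A$-span of $\{t_wv_{\tau_0}\mid\tau_0\in\mathrm{SYT}^\lambda_0\}$. In particular, $V^\lambda_{\chi_\alpha}$ is the $A$-span of $\{v_{\tau_0}\mid\tau_0\in\mathrm{SYT}^\lambda_0\}$, and $V^\lambda_{\chi_\alpha}\cong P^\lambda_0$ as $\mathcal H_\alpha$-modules. \item $V^\lambda$ is in $\mathcal O_\alpha$. \item Suppose $\tau\in\mathrm{SYT}^\lambda$. Then for $d\in D$, $t_d\cdot v_\tau=\chi_\tau(d)v_\tau$, and for $i\in[n-1]$ \[ t_{s_i}v_\tau=\begin{cases} v_{s_i\cdot\tau}&\text{if }j<j'\\[2pt] \epsilon^j\Big(\dfrac{x-1}{y(1-x^k)}\Big)v_\tau+\epsilon^j\Big(\dfrac{x-x^k}{y(1-x^k)}\Big)v_{s_i\cdot\tau}&\text{if }j=j'\\[6pt] \mathbf q\,v_{s_i\cdot\tau}&\text{if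 }j>j', \end{cases} \] where $j=\tau_i$, $j'=\tau_{i+1}$, $k=\delta_{\tau^j}(i+1,i)$ (in the case $j=j'$), and $v_{s_i\cdot\tau}=0$ if $s_i\cdot\tau$ is not standard. \item Let $f\colon A\to k$ be a specialization. Then ${}_fV^\lambda$ is an irreducible ${}_f\mathcal H$-module if and only if ${}_fP^\lambda_0$ is an irreducible ${}_f\mathcal H_\alpha$-module. \end{enumerate}
   Context: **Algebra.** Let $n,b$ be positive integers, let $\mathbf q,\mathbf a$ be indeterminates, and write $[l]=\{1,\dots,l\}$ and $\Sigma_l$ for the symmetric group on $[l]$. Let $\mathcal H_{b,n}$ be the unital associative $\mathbb Z[\mathbf q,\mathbf a]$-algebra with generators $T_1,\dots,T_n,R_1,\dots,R_{n-1}$ and relations: $T_j^b=1$ ($j\in[n]$); $T_jT_{j'}=T_{j'}T_j$ ($j,j'\in[n]$); $T_jR_i=R_iT_{s_i(j)}$ ($j\in[n]$, $i\in[n-1]$); $R_iR_{i'}=R_{i'}R_i$ ($|i-i'|>1$); $R_iR_{i+1}R_i=R_{i+1}R_iR_{i+1}$ ($i\in[n-2]$); $R_i^2=\mathbf q+\mathbf a\,T_i^{(b^2-b)/2}E_iR_i$ ($i\in[n-1]$), where $s_i=(i\ i{+}1)$ and $E_i=\sum_{k=0}^{b-1}T_i^kT_{i+1}^{-k}$. Let $\zeta\in\mathbb C$ be a primitive $b$th root of unity. $A$ is the smallest subring of an algebraic closure of $\mathbb C(\mathbf q,\mathbf a)$ that contains $1,\mathbf q,\mathbf a,\zeta$ and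 a fixed square root $\sqrt{b^2\mathbf a^2+4\mathbf q}$, in which $2$, $b$, $\mathbf q$ are units, and in which $1+x+\dots+x^k$ is a unit for every $k\in[n-2]$, where $x=\dfrac{b^2\mathbf a^2+b\mathbf a\sqrt{b^2\mathbf a^2+4\mathbf q}+2\mathbf q}{2\mathbf q}$. Also $y=\dfrac{b\mathbf a+\sqrt{b^2\mathbf a^2+4\mathbf q}}{2\mathbf q}$, a unit of $A$ with $x=\mathbf qy^2$. Put $\mathcal H=A\otimes_{\mathbb Z[\mathbf q,\mathbf a]}\mathcal H_{b,n}$ and $\epsilon=\zeta^{(b^2-b)/2}$ (so $\epsilon=1$ if $b$ is odd, $\epsilon=-1$ if $b$ is even). $D$ is the group of diagonal matrices in $\mathrm{GL}_n(\mathbb C)$ with diagonal entries in $\langle\zeta\rangle$; for $d=\mathrm{diag}(\zeta^{p_1},\dots,\zeta^{p_n})\in D$ put $t_d=T_1^{p_1}\cdots T_n^{p_n}$. $W$ is the group of permutation matrices in $\mathrm{GL}_n(\mathbb C)$, identified with $\Sigma_n$ via $wv_i=v_{w(i)}$ on the standard basis; for $w\in W$ with reduced expression $s_{i_1}\cdots s_{i_r}$ put $t_w=R_{i_1}\cdots R_{i_r}$ (well defined). **Characters, weights, blocks.** $X(D)$ is the group of homomorphisms $D\to A^\times$, with $W$-action $(w\cdot\chi)(d)=\chi(w^{-1}dw)$. For $\chi\in X(D)$, $e_\chi=b^{-n}\sum_{d\in D}\chi(d^{-1})t_d$; for an $\mathcal H$-module $V$, the weight space is $V_\chi=e_\chi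 V$. For $(i_1,\dots,i_n)\in[b]^n$, $\chi_{(i_1,\dots,i_n)}(\mathrm{diag}(\zeta^{p_1},\dots,\zeta^{p_n}))=\zeta^{i_1p_1+\dots+i_np_n}$. $\mathcal C(n,b)$ is the set of $b$-tuples $(m_1,\dots,m_b)$ of non-negative integers with sum $n$. For $\alpha=(m_1,\dots,m_b)\in\mathcal C(n,b)$, $\chi_\alpha=\chi_{(1,\dots,1,\dots,b,\dots,b)}$ with $j$ repeated $m_j$ times; the $\chi_\alpha$ form a set of representatives of the $W$-orbits in $X(D)$, and $\alpha$ is identified with the orbit of $\chi_\alpha$. Put $e_\alpha=\sum_{\chi\in W\cdot\chi_\alpha}e_\chi$ and $\mathcal H_\alpha=e_{\chi_\alpha}\mathcal He_{\chi_\alpha}$. $\mathcal O_\alpha$ is the full subcategory of left $\mathcal H$-modules $V$ with $V=e_\alpha V$. Put $\bar m_0=0$, $\bar m_j=m_1+\dots+m_j$, $M_j=[\bar m_j]\setminus[\bar m_{j-1}]$, and let $W^\alpha$ be the set of $w\in W$ whose restriction to each $M_j$ is increasing. **Tableaux.** A $b$-partition of $n$ is a $b$-tuple $\lambda=(\lambda^1,\dots,\lambda^b)$ of (possibly empty) partitions with $|\lambda^1|+\dots+|\lambda^b|=n$; $|\lambda|=(|\lambda^1|,\dots,|\lambda^b|)$. A Young $b$-tableau $\tau=(\tau^1,\dots,\tau^b)$ of shape $\lambda$ is a bijective filling of the boxes of the Young diagrams of $\lambda^1,\dots,\lambda^b$ by $1,\dots,n$; it is standard if entries increase along rows and columns of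 each $\tau^j$. $\mathrm{SYT}^\lambda$ is the set of standard ones. $\tau_i=j$ means that $i$ appears in $\tau^j$; $\chi_\tau=\chi_{(\tau_1,\dots,\tau_n)}$. $\mathrm{SYT}^\lambda_0$ is the set of $\tau\in\mathrm{SYT}^\lambda$ with $\tau_1\le\dots\le\tau_n$. $W$ acts on Young $b$-tableaux by applying permutations to the entries. For a tableau $\hat\tau$ with entries $i,j$ in (row, column) positions $(r_i,c_i)$ and $(r_j,c_j)$, the axial distance is $\delta_{\hat\tau}(i,j)=(c_j-r_j)-(c_i-r_i)$. **Hoefsmit modules.** For $m>1$, $\mathcal I^m$ is the unital $A$-algebra with generators $S_1,\dots,S_{m-1}$ and relations $S_iS_j=S_jS_i$ ($|i-j|>1$), $S_iS_{i+1}S_i=S_{i+1}S_iS_{i+1}$, $S_i^2=\mathbf q+b\mathbf a S_i$; $\mathcal I^0=\mathcal I^1=A$. For a partition $\hat\lambda$ of $m$, $P^{\hat\lambda}$ is the free $A$-module with basis $\{p_{\hat\tau}\}$ indexed by the standard Young tableaux $\hat\tau$ of shape $\hat\lambda$ (entries $1,\dots,m$), which is an $\mathcal I^m$-module via $S_l\cdot p_{\hat\tau}=\frac{x-1}{y(1-x^k)}p_{\hat\tau}+\frac{x-x^k}{y(1-x^k)}p_{s_l\cdot\hat\tau}$, where $k=\delta_{\hat\tau}(l+1,l)$ and $p_{s_l\cdot\hat\tau}=0$ if $s_l\cdot\hat\tau$ is not standard (these coefficients, computed in the quotient field of $A$, lie in $A$). **The module $V^\lambda$.** Let $\alpha=|\lambda|=(m_1,\dots,m_b)$.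 There is an $A$-algebra isomorphism $\eta\colon\mathcal I^{m_1}\otimes_A\dots\otimes_A\mathcal I^{m_b}\to\mathcal H_\alpha$ sending the generator $S_l$ of the $j$th factor $\mathcal I^{m_j}$ to $\epsilon^jt_{s_{\bar m_{j-1}+l}}e_{\chi_\alpha}$. Put $P^\lambda_0=P^{\lambda^1}\otimes_A\dots\otimes_AP^{\lambda^b}$, regarded as an $\mathcal H_\alpha$-module via $\eta$, and $V^\lambda=\mathcal He_{\chi_\alpha}\otimes_{\mathcal H_\alpha}P^\lambda_0$. **Specialization.** A specialization is a ring homomorphism $f\colon A\to k$ with $k$ a commutative ring with identity and $f(1)=1$; ${}_f(-)$ denotes $k\otimes_A(-)$, for algebras and modules. *)

(* Defs.v *)
From HB Require Import structures.
From mathcomp Require Import all_boot all_order all_algebra all_fingroup.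
From mathcomp Require Import generic_quotient.
From mathcomp Require Import complex.
From mathcomp Require Import boolp classical_sets reals.

Set Implicit Arguments.
Unset Strict Implicit.
Unset Printing Implicit Defensive.

Import Order.TTheory GRing.Theory.

Local Open Scope ring_scope.
Local Open Scope quotient_scope.

(* MathComp's [algType] excludes the zero ring, whereas a specialization (or, a
   priori, a presented algebra) may be zero; hence this variant, where an
   algebra is a possibly zero ring with a central morphism from the base. *)
HB.mixin Record PzRing_isAlgOver (R : comPzRingType) B of GRing.PzRing B := {
  algc : R -> B;
  algc_nmod_subproof : nmod_morphism algc;
  algc_monoid_subproof : monoid_morphism algc;
  algc_central : forall c u, algc c * u = u * algc c
}.

#[short(type="pzAlgType")]
HB.structure Definition PzAlg (R : comPzRingType) :=
  {B of GRing.PzRing B & PzRing_isAlgOver R B}.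

HB.instance Definition _ (R : comPzRingType) (B : pzAlgType R) :=
  GRing.isNmodMorphism.Build R B (@algc R B) (@algc_nmod_subproof R B).
HB.instance Definition _ (R : comPzRingType) (B : pzAlgType R) :=
  GRing.isMonoidMorphism.Build R B (@algc R B) (@algc_monoid_subproof R B).

Definition ascale (R : comPzRingType) (B : pzAlgType R) (c : R) (u : B) : B :=
  algc c * u.
Definition mscale (R : comPzRingType) (B : pzAlgType R) (V : lmodType B)
  (c : R) (v : V) : V := (algc c : B) *: v.
Notation "c *:a u" := (ascale c u) (at level 40, left associativity).
Notation "c *:m v" := (mscale c v) (at level 40, left associativity).

Inductive aterm (R G : Type) : Type :=
| AGen of G
| AConst of R
| AAdd of aterm R G & aterm R G
| AOpp of aterm R G
| AMul of aterm R G & aterm R G.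
Arguments AGen {R G}.
Arguments AConst {R G}.

HB.instance Definition _ (R G : Type) := gen_eqMixin (aterm R G).
HB.instance Definition _ (R G : Type) := gen_choiceMixin (aterm R G).

Declare Scope aterm_scope.
Delimit Scope aterm_scope with AT.
Bind Scope aterm_scope with aterm.
Notation "s + t" := (AAdd s t) : aterm_scope.
Notation "- t" := (AOpp t) : aterm_scope.
Notation "s * t" := (AMul s t) : aterm_scope.
Definition apow (R : pzSemiRingType) G (t : aterm R G) (k : nat) : aterm R G :=
  iter k (AMul t) (AConst 1).
Notation "t ^+ k" := (apow t k) : aterm_scope.

Section PresentedAlgebra.
Variables (R : comPzRingType) (G : Type).
Local Notation tm := (aterm R G).
Variable rel : tm -> tm -> Prop.

Inductive acong : tm -> tm -> Prop :=
| ac_rel s t : rel s t -> acong s t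
| ac_refl t : acong t t
| ac_sym s t : acong s t -> acong t s
| ac_trans s t u : acong s t -> acong t u -> acong s u
| ac_add s s' t t' : acong s s' -> acong t t' -> acong (s + t)%AT (s' + t')%AT
| ac_opp s s' : acong s s' -> acong (- s)%AT (- s')%AT
| ac_mul s s' t t' : acong s s' -> acong t t' -> acong (s * t)%AT (s' * t')%AT
| ac_addA s t u : acong (s + (t + u))%AT ((s + t) + u)%AT
| ac_addC s t : acong (s + t)%AT (t + s)%AT
| ac_add0 t : acong (AConst 0 + t)%AT t
| ac_addN t : acong (- t + t)%AT (AConst 0)
| ac_mulA s t u : acong (s * (t * u))%AT ((s * t) * u)%AT
| ac_mul1l t : acong (AConst 1 * t)%AT t
| ac_mul1r t : acong (t * AConst 1)%AT t
| ac_mulDl s t u : acong ((s + t) * u)%AT (s * u + t * u)%AT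
| ac_mulDr s t u : acong (s * (t + u))%AT (s * t + s * u)%AT
| ac_constD c d : acong (AConst (c + d)) (AConst c + AConst d)%AT
| ac_constM c d : acong (AConst (c * d)) (AConst c * AConst d)%AT
| ac_constC c t : acong (AConst c * t)%AT (t * AConst c)%AT.

Definition acongb (s t : tm) : bool := `[< acong s t >].

Lemma acongb_refl : reflexive acongb.
Proof. by move=> t; apply/asboolP/ac_refl. Qed.
Lemma acongb_sym : symmetric acongb.
Proof. by move=> s t; apply/asboolP/asboolP => /ac_sym. Qed.
Lemma acongb_trans : transitive acongb.
Proof.
by move=> t s u /asboolP st /asboolP tu; apply/asboolP/(ac_trans st tu).
Qed.

Canonical acong_equiv := EquivRel acongb acongb_refl acongb_sym acongb_trans.

Definition palg := {eq_quot acong_equiv}.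

HB.instance Definition _ : EqQuotient tm acong_equiv palg :=
  EqQuotient.on palg.
HB.instance Definition _ := Choice.on palg.

Lemma palg_eqP (s t : tm) : \pi_palg s = \pi_palg t <-> acong s t.
Proof.
split; first by move/eqquotP/asboolP.
by move=> st; apply/eqquotP/asboolP.
Qed.

Lemma palg_reprP (t : tm) : acong (repr (\pi_palg t)) t.
Proof. by apply/palg_eqP; rewrite reprK. Qed.

Definition palg_add (u v : palg) : palg := \pi_palg (repr u + repr v)%AT.
Definition palg_opp (u : palg) : palg := \pi_palg (- repr u)%AT.
Definition palg_mul (u v : palg) : palg := \pi_palg (repr u * repr v)%AT.
Definition palg_const (c : R) : palg := \pi_palg (AConst c).
Definition palg_gen (g : G) : palg := \pi_palg (AGen g).

Lemma palg_addE s t : palg_add (\pi s) (\pi t) = \pi_palg (s + t)%AT.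
Proof. by apply/palg_eqP/ac_add; apply: palg_reprP. Qed.
Lemma palg_oppE s : palg_opp (\pi s) = \pi_palg (- s)%AT.
Proof. by apply/palg_eqP/ac_opp; apply: palg_reprP. Qed.
Lemma palg_mulE s t : palg_mul (\pi s) (\pi t) = \pi_palg (s * t)%AT.
Proof. by apply/palg_eqP/ac_mul; apply: palg_reprP. Qed.

Let palg_ind (P : palg -> Prop) : (forall t, P (\pi_palg t)) -> forall u, P u.
Proof. by move=> h u; rewrite -[u]reprK. Qed.

Fact palg_addA : associative palg_add.
Proof.
elim/palg_ind=> s; elim/palg_ind=> t; elim/palg_ind=> u.
rewrite (palg_addE t u) (palg_addE s t) [LHS]palg_addE [RHS]palg_addE.
exact/palg_eqP/ac_addA.
Qed.
Fact palg_addC : commutative palg_add.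
Proof.
elim/palg_ind=> s; elim/palg_ind=> t.
by rewrite [LHS]palg_addE [RHS]palg_addE; apply/palg_eqP/ac_addC.
Qed.
Fact palg_add0 : left_id (palg_const 0) palg_add.
Proof. by elim/palg_ind=> t; rewrite palg_addE; apply/palg_eqP/ac_add0. Qed.
Fact palg_addN : left_inverse (palg_const 0) palg_opp palg_add.
Proof.
by elim/palg_ind=> t; rewrite palg_oppE [LHS]palg_addE; apply/palg_eqP/ac_addN.
Qed.

HB.instance Definition _ :=
  GRing.isZmodule.Build palg palg_addA palg_addC palg_add0 palg_addN.

Fact palg_mulA : associative palg_mul.
Proof.
elim/palg_ind=> s; elim/palg_ind=> t; elim/palg_ind=> u.
rewrite (palg_mulE t u) (palg_mulE s t) [LHS]palg_mulE [RHS]palg_mulE.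
exact/palg_eqP/ac_mulA.
Qed.
Fact palg_mul1l : left_id (palg_const 1) palg_mul.
Proof. by elim/palg_ind=> t; rewrite palg_mulE; apply/palg_eqP/ac_mul1l. Qed.
Fact palg_mul1r : right_id (palg_const 1) palg_mul.
Proof. by elim/palg_ind=> t; rewrite palg_mulE; apply/palg_eqP/ac_mul1r. Qed.
Fact palg_mulDl : left_distributive palg_mul palg_add.
Proof.
elim/palg_ind=> s; elim/palg_ind=> t; elim/palg_ind=> u.
rewrite (palg_addE s t) (palg_mulE s u) (palg_mulE t u).
by rewrite [LHS]palg_mulE [RHS]palg_addE; apply/palg_eqP/ac_mulDl.
Qed.
Fact palg_mulDr : right_distributive palg_mul palg_add.
Proof.
elim/palg_ind=> s; elim/palg_ind=> t; elim/palg_ind=> u.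
rewrite (palg_addE t u) (palg_mulE s t) (palg_mulE s u).
by rewrite [LHS]palg_mulE [RHS]palg_addE; apply/palg_eqP/ac_mulDr.
Qed.

HB.instance Definition _ := GRing.Zmodule_isPzRing.Build palg
  palg_mulA palg_mul1l palg_mul1r palg_mulDl palg_mulDr.

Fact palg_const_nmod : nmod_morphism palg_const.
Proof.
split=> [//|c d].
by rewrite [RHS]palg_addE; apply/palg_eqP/ac_constD.
Qed.
Fact palg_const_monoid : monoid_morphism palg_const.
Proof.
split=> [//|c d].
by rewrite [RHS]palg_mulE; apply/palg_eqP/ac_constM.
Qed.
Fact palg_const_central c (u : palg) : palg_const c * u = u * palg_const c.
Proof.
elim/palg_ind: u => t.
by rewrite [LHS]palg_mulE [RHS]palg_mulE; apply/palg_eqP/ac_constC.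
Qed.

HB.instance Definition _ := PzRing_isAlgOver.Build R palg
  palg_const_nmod palg_const_monoid palg_const_central.

Fixpoint aeval (B : pzAlgType R) (g : G -> B) (t : tm) : B :=
  match t with
  | AGen x => g x
  | AConst c => algc c
  | AAdd s t => aeval g s + aeval g t
  | AOpp s => - aeval g s
  | AMul s t => aeval g s * aeval g t
  end.

Lemma acong_aeval (B : pzAlgType R) (g : G -> B) :
  (forall s t, rel s t -> aeval g s = aeval g t) ->
  forall s t, acong s t -> aeval g s = aeval g t.
Proof.
move=> hrel s t; elim=> //=.
- by move=> ? ? ? _ -> _ ->.
- by move=> ? ? ? ? _ -> _ ->.
- by move=> ? ? _ ->.
- by move=> ? ? ? ? _ -> _ ->.
- by move=> *; rewrite addrA.
- by move=> *; rewrite addrC.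
- by move=> *; rewrite rmorph0 add0r.
- by move=> *; rewrite addNr rmorph0.
- by move=> *; rewrite mulrA.
- by move=> *; rewrite rmorph1 mul1r.
- by move=> *; rewrite rmorph1 mulr1.
- by move=> *; rewrite mulrDl.
- by move=> *; rewrite mulrDr.
- by move=> *; rewrite rmorphD.
- by move=> *; rewrite rmorphM.
- by move=> *; rewrite algc_central.
Qed.

Lemma palg_universal (B : pzAlgType R) (g : G -> B) :
  (forall s t, rel s t -> aeval g s = aeval g t) ->
  exists phi : {rmorphism palg -> B},
    (forall c, phi (algc c) = algc c) /\ forall x, phi (palg_gen x) = g x.
Proof.
move=> /acong_aeval hev.
pose phi (u : palg) := aeval g (repr u).
have phiE t : phi (\pi_palg t) = aeval g t by apply/hev/palg_reprP.
have phi_const c : phi (palg_const c) = algc c by apply: phiE.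
have phiB : nmod_morphism phi.
  split; first by rewrite [0]/(palg_const 0) phi_const rmorph0.
  elim/palg_ind=> s; elim/palg_ind=> t.
  by rewrite [_ + _]palg_addE !phiE.
have phiM : monoid_morphism phi.
  split; first by rewrite [1]/(palg_const 1) phi_const rmorph1.
  elim/palg_ind=> s; elim/palg_ind=> t.
  by rewrite [_ * _]palg_mulE !phiE.
pose a := GRing.isNmodMorphism.Build _ _ phi phiB.
pose m := GRing.isMonoidMorphism.Build _ _ phi phiM.
pose F : {rmorphism palg -> B} := HB.pack phi a m.
exists F; split=> [c|x]; [exact: phi_const | exact: phiE].
Qed.

End PresentedAlgebra.

Inductive mterm (B G : Type) : Type :=
| MGen of G
| MZero
| MAdd of mterm B G & mterm B G
| MOpp of mterm B G
| MScale of B & mterm B G.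
Arguments MGen {B G}.
Arguments MZero {B G}.

HB.instance Definition _ (B G : Type) := gen_eqMixin (mterm B G).
HB.instance Definition _ (B G : Type) := gen_choiceMixin (mterm B G).

Declare Scope mterm_scope.
Delimit Scope mterm_scope with MT.
Bind Scope mterm_scope with mterm.
Notation "s + t" := (MAdd s t) : mterm_scope.
Notation "- t" := (MOpp t) : mterm_scope.
Notation "h *: t" := (MScale h t) : mterm_scope.

Section PresentedModule.
Variables (B : pzRingType) (G : Type).
Local Notation tm := (mterm B G).
Variable rel : tm -> tm -> Prop.

Inductive mcong : tm -> tm -> Prop :=
| mc_rel s t : rel s t -> mcong s t
| mc_refl t : mcong t t
| mc_sym s t : mcong s t -> mcong t s
| mc_trans s t u : mcong s t -> mcong t u -> mcong s u
| mc_add s s' t t' : mcong s s' -> mcong t t' -> mcong (s + t)%MT (s' + t')%MT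
| mc_opp s s' : mcong s s' -> mcong (- s)%MT (- s')%MT
| mc_scale h s s' : mcong s s' -> mcong (h *: s)%MT (h *: s')%MT
| mc_addA s t u : mcong (s + (t + u))%MT ((s + t) + u)%MT
| mc_addC s t : mcong (s + t)%MT (t + s)%MT
| mc_add0 t : mcong (MZero + t)%MT t
| mc_addN t : mcong (- t + t)%MT MZero
| mc_scaleA h h' t : mcong (h *: (h' *: t))%MT ((h * h')%R *: t)%MT
| mc_scale1 t : mcong (1%R *: t)%MT t
| mc_scaleDr h s t : mcong (h *: (s + t))%MT (h *: s + h *: t)%MT
| mc_scaleDl h h' t : mcong ((h + h')%R *: t)%MT (h *: t + h' *: t)%MT.

Definition mcongb (s t : tm) : bool := `[< mcong s t >].

Lemma mcongb_refl : reflexive mcongb.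
Proof. by move=> t; apply/asboolP/mc_refl. Qed.
Lemma mcongb_sym : symmetric mcongb.
Proof. by move=> s t; apply/asboolP/asboolP => /mc_sym. Qed.
Lemma mcongb_trans : transitive mcongb.
Proof.
by move=> t s u /asboolP st /asboolP tu; apply/asboolP/(mc_trans st tu).
Qed.

Canonical mcong_equiv := EquivRel mcongb mcongb_refl mcongb_sym mcongb_trans.

Definition pmod := {eq_quot mcong_equiv}.

HB.instance Definition _ : EqQuotient tm mcong_equiv pmod :=
  EqQuotient.on pmod.
HB.instance Definition _ := Choice.on pmod.

Lemma pmod_eqP (s t : tm) : \pi_pmod s = \pi_pmod t <-> mcong s t.
Proof.
split; first by move/eqquotP/asboolP.
by move=> st; apply/eqquotP/asboolP.
Qed.

Lemma pmod_reprP (t : tm) : mcong (repr (\pi_pmod t)) t.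
Proof. by apply/pmod_eqP; rewrite reprK. Qed.

Definition pmod_zero : pmod := \pi_pmod MZero.
Definition pmod_add (u v : pmod) : pmod := \pi_pmod (repr u + repr v)%MT.
Definition pmod_opp (u : pmod) : pmod := \pi_pmod (- repr u)%MT.
Definition pmod_scale (h : B) (u : pmod) : pmod := \pi_pmod (h *: repr u)%MT.
Definition pmod_gen (g : G) : pmod := \pi_pmod (MGen g).

Lemma pmod_addE s t : pmod_add (\pi s) (\pi t) = \pi_pmod (s + t)%MT.
Proof. by apply/pmod_eqP/mc_add; apply: pmod_reprP. Qed.
Lemma pmod_oppE s : pmod_opp (\pi s) = \pi_pmod (- s)%MT.
Proof. by apply/pmod_eqP/mc_opp; apply: pmod_reprP. Qed.
Lemma pmod_scaleE h s : pmod_scale h (\pi s) = \pi_pmod (h *: s)%MT.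
Proof. by apply/pmod_eqP/mc_scale; apply: pmod_reprP. Qed.

Let pmod_ind (P : pmod -> Prop) : (forall t, P (\pi_pmod t)) -> forall u, P u.
Proof. by move=> h u; rewrite -[u]reprK. Qed.

Fact pmod_addA : associative pmod_add.
Proof.
elim/pmod_ind=> s; elim/pmod_ind=> t; elim/pmod_ind=> u.
rewrite (pmod_addE t u) (pmod_addE s t) [LHS]pmod_addE [RHS]pmod_addE.
exact/pmod_eqP/mc_addA.
Qed.
Fact pmod_addC : commutative pmod_add.
Proof.
elim/pmod_ind=> s; elim/pmod_ind=> t.
by rewrite [LHS]pmod_addE [RHS]pmod_addE; apply/pmod_eqP/mc_addC.
Qed.
Fact pmod_add0 : left_id pmod_zero pmod_add.
Proof. by elim/pmod_ind=> t; rewrite [LHS]pmod_addE; apply/pmod_eqP/mc_add0. Qed.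
Fact pmod_addN : left_inverse pmod_zero pmod_opp pmod_add.
Proof.
by elim/pmod_ind=> t; rewrite pmod_oppE [LHS]pmod_addE; apply/pmod_eqP/mc_addN.
Qed.

HB.instance Definition _ :=
  GRing.isZmodule.Build pmod pmod_addA pmod_addC pmod_add0 pmod_addN.

Fact pmod_scaleA h h' (u : pmod) :
  pmod_scale h (pmod_scale h' u) = pmod_scale (h * h') u.
Proof.
elim/pmod_ind: u => t; rewrite (pmod_scaleE h' t) [LHS]pmod_scaleE.
by rewrite [RHS]pmod_scaleE; apply/pmod_eqP/mc_scaleA.
Qed.
Fact pmod_scale1 : left_id 1 pmod_scale.
Proof.
by elim/pmod_ind=> t; rewrite [LHS]pmod_scaleE; apply/pmod_eqP/mc_scale1.
Qed.
Fact pmod_scaleDr : right_distributive pmod_scale +%R.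
Proof.
move=> h; elim/pmod_ind=> s; elim/pmod_ind=> t; rewrite [_ + _]pmod_addE.
rewrite (pmod_scaleE h s) (pmod_scaleE h t) [LHS]pmod_scaleE [RHS]pmod_addE.
exact/pmod_eqP/mc_scaleDr.
Qed.
Fact pmod_scaleDl (u : pmod) : {morph pmod_scale^~ u : h h' / h + h'}.
Proof.
elim/pmod_ind: u => t h h'; rewrite (pmod_scaleE h t) (pmod_scaleE h' t).
by rewrite [LHS]pmod_scaleE [RHS]pmod_addE; apply/pmod_eqP/mc_scaleDl.
Qed.

HB.instance Definition _ := GRing.Zmodule_isLmodule.Build B pmod
  pmod_scaleA pmod_scale1 pmod_scaleDr pmod_scaleDl.

Fixpoint meval (M : lmodType B) (g : G -> M) (t : tm) : M :=
  match t with
  | MGen x => g x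
  | MZero => 0
  | MAdd s t => meval g s + meval g t
  | MOpp s => - meval g s
  | MScale h s => h *: meval g s
  end.

Lemma mcong_meval (M : lmodType B) (g : G -> M) :
  (forall s t, rel s t -> meval g s = meval g t) ->
  forall s t, mcong s t -> meval g s = meval g t.
Proof.
move=> hrel s t; elim=> //=.
- by move=> ? ? ? _ -> _ ->.
- by move=> ? ? ? ? _ -> _ ->.
- by move=> ? ? _ ->.
- by move=> ? ? ? _ ->.
- by move=> *; rewrite addrA.
- by move=> *; rewrite addrC.
- by move=> *; rewrite add0r.
- by move=> *; rewrite addNr.
- by move=> *; rewrite scalerA.
- by move=> *; rewrite scale1r.
- by move=> *; rewrite scalerDr.
- by move=> *; rewrite scalerDl.
Qed.

Lemma pmod_universal (M : lmodType B) (g : G -> M) :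
  (forall s t, rel s t -> meval g s = meval g t) ->
  exists phi : {linear pmod -> M}, forall x, phi (pmod_gen x) = g x.
Proof.
move=> /mcong_meval hev.
pose phi (u : pmod) := meval g (repr u).
have phiE t : phi (\pi_pmod t) = meval g t by apply/hev/pmod_reprP.
have phiL : linear phi.
  move=> h; elim/pmod_ind=> s; elim/pmod_ind=> t.
  have -> : h *: (\pi s : pmod) + \pi t = \pi_pmod (h *: s + t)%MT.
    rewrite -[h *: _]/(pmod_scale h (\pi s)) pmod_scaleE.
    by rewrite -[_ + _]/(pmod_add _ _) pmod_addE.
  by rewrite !phiE.
pose l := GRing.isLinear.Build B pmod M *:%R phi phiL.
pose F : {linear pmod -> M} := HB.pack phi l.
by exists F => x; apply: phiE.
Qed.

End PresentedModule.

Section ScalarExtension.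
Variables (R S : comPzRingType) (f : R -> S) (B : pzAlgType R).

(* S (x)_R B as an S-algebra: it is generated by the 1 (x) u, u in B. *)
Inductive bc_rel : aterm S B -> aterm S B -> Prop :=
| bc_add u v : bc_rel (AGen (u + v)) (AGen u + AGen v)
| bc_mul u v : bc_rel (AGen (u * v)) (AGen u * AGen v)
| bc_const c : bc_rel (AGen (algc c)) (AConst (f c)).

Definition bcalg : pzAlgType S := palg bc_rel.
Definition bcalg_in (u : B) : bcalg := palg_gen bc_rel u.

(* S (x)_R M as a module over S (x)_R B, with action
   (c (x) h) (d (x) m) = c d (x) h m: it is generated by the 1 (x) m, m in M,
   and the rule r m |-> f(r) (1 (x) m), r in R, is [bcm_scale] at algc r. *)
Variable M : lmodType B.

Inductive bcm_rel : mterm bcalg M -> mterm bcalg M -> Prop :=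
| bcm_add u v : bcm_rel (MGen (u + v)) (MGen u + MGen v)
| bcm_scale h u : bcm_rel (MGen (h *: u)) (bcalg_in h *: MGen u).

Definition bcmod : lmodType bcalg := pmod bcm_rel.

End ScalarExtension.

Section MultiTensor.
Variables (R : comPzRingType) (J : finType) (B : J -> pzAlgType R).

Definition tn_gen j (u : B j) : aterm R {j : J & B j} :=
  AGen (existT (fun j => B j : Type) j u).

(* The R-algebra (x)_j B j: [tn_gen u] stands for the pure tensor with u in
   position j and 1 elsewhere. *)
Inductive tn_rel : aterm R {j : J & B j} -> aterm R {j : J & B j} -> Prop :=
| tn_add j (u v : B j) : tn_rel (tn_gen (u + v)) (tn_gen u + tn_gen v)
| tn_mul j (u v : B j) : tn_rel (tn_gen (u * v)) (tn_gen u * tn_gen v)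
| tn_const j c : tn_rel (tn_gen (algc c : B j)) (AConst c)
| tn_comm j j' (u : B j) (v : B j') : j != j' ->
    tn_rel (tn_gen u * tn_gen v) (tn_gen v * tn_gen u).

Definition tnalg : pzAlgType R := palg tn_rel.
Definition tnalg_in j (u : B j) : tnalg :=
  palg_gen tn_rel (existT (fun j => B j : Type) j u).

(* The module (x)_j M j over (x)_j B j, generated by the pure tensors
   m : forall j, M j; [dfwith m u] is m with its j-th component set to u.
   Linearity over R in each component follows from [tm_scale] at algc c. *)
Variable M : forall j, lmodType (B j).

Inductive tm_rel :
    mterm tnalg (forall j, M j) -> mterm tnalg (forall j, M j) -> Prop :=
| tm_add (m : forall j, M j) j (u v : M j) :
    tm_rel (MGen (dfwith m (u + v))) (MGen (dfwith m u) + MGen (dfwith m v))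
| tm_scale (m : forall j, M j) j (h : B j) (u : M j) :
    tm_rel (MGen (dfwith m (h *: u))) (tnalg_in h *: MGen (dfwith m u)).

Definition tnmod : lmodType tnalg := pmod tm_rel.

End MultiTensor.

Section BalancedTensor.
Variables (H S : pzRingType) (M : lmodType H) (ract : M -> S -> M).
Variable N : lmodType S.

(* The left H-module M (x)_S N, for M an (H, S)-bimodule with right action
   [ract]: the generator (m, x) is m (x) x, and h (m (x) x) = h m (x) x. *)
Inductive bt_rel : mterm H (M * N) -> mterm H (M * N) -> Prop :=
| bt_addl m m' x : bt_rel (MGen (m + m', x)) (MGen (m, x) + MGen (m', x))
| bt_addr m x x' : bt_rel (MGen (m, x + x')) (MGen (m, x) + MGen (m, x'))
| bt_bal m s x : bt_rel (MGen (ract m s, x)) (MGen (m, s *: x))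
| bt_scale h m x : bt_rel (MGen (h *: m, x)) (h *: MGen (m, x)).

Definition btmod : lmodType H := pmod bt_rel.

End BalancedTensor.

Section Corner.
Variables (R : comPzRingType) (B : pzAlgType R) (e : B).

Definition in_corner : {pred B} := fun h => `[< exists g, h = e * g * e >].

Fact in_cornerP h : reflect (exists g, h = e * g * e) (h \in in_corner).
Proof. exact: asboolP. Qed.

Fact in_corner_zmod : zmod_closed in_corner.
Proof.
split; first by apply/in_cornerP; exists 0; rewrite mulr0 mul0r.
move=> _ _ /in_cornerP[g ->] /in_cornerP[g' ->]; apply/in_cornerP.
by exists (g - g'); rewrite mulrBr mulrBl.
Qed.
HB.instance Definition _ :=
  GRing.isZmodClosed.Build B in_corner in_corner_zmod.

Definition in_lideal : {pred B^o} := fun h => `[< exists g, h = g * e >].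

Fact in_lidealP h : reflect (exists g, h = g * e) (h \in in_lideal).
Proof. exact: asboolP. Qed.

Fact in_lideal_submod : submod_closed in_lideal.
Proof.
split; first by apply/in_lidealP; exists 0; rewrite mul0r.
move=> c _ _ /in_lidealP[g ->] /in_lidealP[g' ->]; apply/in_lidealP.
by exists (c * g + g'); rewrite mulrDl -[in RHS]mulrA.
Qed.
HB.instance Definition _ :=
  GRing.isSubmodClosed.Build B B^o in_lideal in_lideal_submod.

Definition lideal := {h : B^o | h \in in_lideal}.
HB.instance Definition _ := [isSub of lideal for sval].
HB.instance Definition _ := [Choice of lideal by <:].
HB.instance Definition _ := [SubChoice_isSubLmodule of lideal by <:].

Hypothesis idem : e * e = e.

Definition corner_of (_ : e * e = e) := {h : B | h \in in_corner}.
Definition corner := corner_of idem.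
HB.instance Definition _ := [isSub of corner for sval].
HB.instance Definition _ := [Choice of corner by <:].
HB.instance Definition _ := [SubChoice_isSubZmodule of corner by <:].

Fact corner_one_subproof : e \in in_corner.
Proof. by apply/in_cornerP; exists e; rewrite !idem. Qed.
Fact corner_mul_subproof (u v : corner) : \val u * \val v \in in_corner.
Proof.
case: u v => _ /= /in_cornerP[g ->] [_ /= /in_cornerP[g' ->]].
by apply/in_cornerP; exists (g * e * e * g'); rewrite !mulrA.
Qed.
Fact corner_const_subproof (c : R) : algc c * e \in in_corner.
Proof.
by apply/in_cornerP; exists (algc c); rewrite -(algc_central c e) -mulrA idem.
Qed.

Definition corner_one : corner := Sub e corner_one_subproof.
Definition corner_mul (u v : corner) : corner :=
  Sub (\val u * \val v) (corner_mul_subproof u v).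
Definition corner_const (c : R) : corner :=
  Sub (algc c * e) (corner_const_subproof c).

Fact corner_e_l (u : corner) : e * \val u = \val u.
Proof. by case: u => _ /= /in_cornerP[g ->]; rewrite !mulrA idem. Qed.
Fact corner_e_r (u : corner) : \val u * e = \val u.
Proof. by case: u => _ /= /in_cornerP[g ->]; rewrite -!mulrA idem. Qed.

Fact corner_mulA : associative corner_mul.
Proof. by move=> u v w; apply: val_inj; rewrite /= mulrA. Qed.
Fact corner_mul1l : left_id corner_one corner_mul.
Proof. by move=> u; apply: val_inj; apply: corner_e_l. Qed.
Fact corner_mul1r : right_id corner_one corner_mul.
Proof. by move=> u; apply: val_inj; apply: corner_e_r. Qed.
Fact corner_mulDl : left_distributive corner_mul +%R.
Proof. by move=> u v w; apply: val_inj; rewrite /= mulrDl. Qed.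
Fact corner_mulDr : right_distributive corner_mul +%R.
Proof. by move=> u v w; apply: val_inj; rewrite /= mulrDr. Qed.

HB.instance Definition _ := GRing.Zmodule_isPzRing.Build corner
  corner_mulA corner_mul1l corner_mul1r corner_mulDl corner_mulDr.

Fact corner_const_nmod : nmod_morphism corner_const.
Proof.
split=> [|c d]; apply: val_inj; first by rewrite /= rmorph0 mul0r.
by rewrite /= rmorphD mulrDl.
Qed.
Fact corner_const_monoid : monoid_morphism corner_const.
Proof.
split=> [|c d]; apply: val_inj; first by rewrite /= rmorph1 mul1r.
by rewrite /= rmorphM -!mulrA (mulrA e) -(algc_central d e) -mulrA idem.
Qed.
Fact corner_const_central c (u : corner) : corner_const c * u = u * corner_const c.
Proof.
apply: val_inj; rewrite /= -mulrA corner_e_l.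
by rewrite (algc_central c e) mulrA corner_e_r algc_central.
Qed.

HB.instance Definition _ := PzRing_isAlgOver.Build R corner
  corner_const_nmod corner_const_monoid corner_const_central.

Fact lideal_ract_subproof (m : lideal) (s : corner) :
  (\val m : B) * \val s \in in_lideal.
Proof.
case: s => _ /= /in_cornerP[g ->]; apply/in_lidealP.
by exists ((\val m : B) * (e * g)); rewrite !mulrA.
Qed.
Definition lideal_ract (m : lideal) (s : corner) : lideal :=
  Sub ((\val m : B) * \val s : B^o) (lideal_ract_subproof m s).

End Corner.

Section Restriction.
Variables (S B : pzRingType) (phi : {rmorphism S -> B}) (M : lmodType B).

Definition restr_of (_ : {rmorphism S -> B}) : Type := M.
Definition restr := restr_of phi.
HB.instance Definition _ := GRing.Zmodule.copy restr M.

Definition restr_scale (s : S) (m : restr) : restr := phi s *: (m : M).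

Fact restr_scaleA s s' (m : restr) :
  restr_scale s (restr_scale s' m) = restr_scale (s * s') m.
Proof. by rewrite /restr_scale rmorphM; apply: scalerA. Qed.
Fact restr_scale1 : left_id 1 restr_scale.
Proof. by move=> m; rewrite /restr_scale rmorph1; apply: scale1r. Qed.
Fact restr_scaleDr : right_distributive restr_scale +%R.
Proof. by move=> s m m'; apply: (scalerDr (phi s)). Qed.
Fact restr_scaleDl (m : restr) : {morph restr_scale^~ m : s s' / s + s'}.
Proof. by move=> s s'; rewrite /restr_scale rmorphD; apply: scalerDl. Qed.
HB.instance Definition _ := GRing.Zmodule_isLmodule.Build S restr
  restr_scaleA restr_scale1 restr_scaleDr restr_scaleDl.

End Restriction.

Definition irreducible_module (B : pzRingType) (M : lmodType B) : Prop :=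
  (exists u : M, u <> 0) /\
  forall N : M -> Prop,
    N 0 -> (forall u v, N u -> N v -> N (u + v)) ->
    (forall (h : B) u, N u -> N (h *: u)) ->
    (forall u, N u -> u = 0) \/ (forall u, N u).

Section FreeModules.
Variables (R : comPzRingType) (B : pzAlgType R) (V : lmodType B).

Definition in_span (I : finType) (P : pred I) (v : I -> V) (u : V) : Prop :=
  exists c : I -> R, u = \sum_(i | P i) c i *:m v i.

Definition is_basis (I : finType) (v : I -> V) : Prop :=
  (forall u, in_span predT v u) /\
  (forall c : I -> R, \sum_i c i *:m v i = 0 -> forall i, c i = 0).

End FreeModules.

Section SymmetricGroup.
Variable n : nat.

Fact lo_subproof (i : 'I_n.-1) : (i < n)%N.
Proof. exact: leq_trans (ltn_ord i) (leq_pred n). Qed.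
Fact hi_subproof (i : 'I_n.-1) : (i.+1 < n)%N.
Proof. by rewrite -ltn_predRL. Qed.

(* Positions are numbered from 0: [i : 'I_n.-1] stands for the index i.+1 of the
   generators s_1, ..., s_{n-1}, and [lo i], [hi i] for the letters i.+1, i.+2. *)
Definition lo (i : 'I_n.-1) : 'I_n := Ordinal (lo_subproof i).
Definition hi (i : 'I_n.-1) : 'I_n := Ordinal (hi_subproof i).
Definition simple (i : 'I_n.-1) : 'S_n := tperm (lo i) (hi i).

(* s_{i_1} o ... o s_{i_r}, composed as functions from right to left; the
   product of MathComp permutations composes from left to right. *)
Definition word_perm (ws : seq 'I_n.-1) : 'S_n :=
  foldr (fun i w => (w * simple i)%g) 1%g ws.

Definition reduced (w : 'S_n) (ws : seq 'I_n.-1) : Prop :=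
  word_perm ws = w /\
  forall ws', word_perm ws' = w -> (size ws <= size ws')%N.

Definition reduced_word (w : 'S_n) : seq 'I_n.-1 :=
  xget [::] [set ws | reduced w ws]%classic.

End SymmetricGroup.

Definition is_partition (s : seq nat) : bool := sorted geq s && (0%N \notin s).

Section Tableaux.
Variables (J : finType) (m : nat).

(* A filling by the m entries is given by the position (component, (row, column))
   of each entry. Young b-tableaux are the case J = 'I_b, and ordinary Young
   tableaux the case J = unit. Coordinates are < m since m is the number of
   boxes. *)
Definition tableau := {ffun 'I_m -> J * ('I_m * 'I_m)}.

Definition tcomp (t : tableau) (i : 'I_m) : J := (t i).1.
Definition trow (t : tableau) (i : 'I_m) : 'I_m := (t i).2.1.
Definition tcol (t : tableau) (i : 'I_m) : 'I_m := (t i).2.2.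

Definition in_shape (sh : J -> seq nat) (z : J * ('I_m * 'I_m)) : bool :=
  (z.2.2 < nth 0 (sh z.1) z.2.1)%N.

Definition is_tableau (sh : J -> seq nat) (t : tableau) : bool :=
  [&& injectiveb t,
      [forall i, in_shape sh (t i)] &
      [forall z, in_shape sh z ==> [exists i, t i == z]]].

Definition is_standard (sh : J -> seq nat) (t : tableau) : bool :=
  is_tableau sh t &&
  [forall i, forall i', (tcomp t i == tcomp t i') ==>
     ((trow t i == trow t i') && (tcol t i < tcol t i') ==> (i < i'))%N &&
     ((tcol t i == tcol t i') && (trow t i < trow t i') ==> (i < i'))%N].

Definition SYT (sh : J -> seq nat) := {t : tableau | is_standard sh t}.

Definition tact (w : 'S_m) (t : tableau) : tableau := [ffun i => t (w^-1%g i)].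

(* (c_{i'} - r_{i'}) - (c_i - r_i), for i, i' in the same component *)
Definition axial (t : tableau) (i i' : 'I_m) : int :=
  ((tcol t i')%:Z - (trow t i')%:Z) - ((tcol t i)%:Z - (trow t i)%:Z).

Definition ext0 (V : zmodType) (sh : J -> seq nat) (v : SYT sh -> V)
  (t : tableau) : V := if insub t is Some t' then v t' else 0.

End Tableaux.

Definition is_bpartition (b n : nat) (lam : 'I_b -> seq nat) : bool :=
  [forall j, is_partition (lam j)] && (\sum_j sumn (lam j) == n)%N.

Definition bsize (b : nat) (lam : 'I_b -> seq nat) (j : 'I_b) : nat :=
  sumn (lam j).

Definition Zqa : comPzRingType := {poly {poly int}}.
Definition Zq : Zqa := ('X)%:P.
Definition Za : Zqa := 'X.

Section GenericAlgebra.
Variables b n : nat.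

Inductive Hgen : Type := GT of 'I_n | GR of 'I_n.-1.

Local Notation tm := (aterm Zqa Hgen).
Local Notation T j := (AGen (GT j) : tm).
Local Notation R i := (AGen (GR i) : tm).

(* T_{i+1}^{-k} is written T_{i+1}^{b-k} *)
Definition E_term (i : 'I_n.-1) : tm :=
  \big[@AAdd Zqa Hgen/AConst 0]_(k < b)
    (T (lo i) ^+ k * T (hi i) ^+ (b - k)%N)%AT.

Inductive Hrel : tm -> tm -> Prop :=
| H_Tpow j : Hrel (T j ^+ b) (AConst 1)
| H_TT j j' : Hrel (T j * T j') (T j' * T j)
| H_TR j i : Hrel (T j * R i) (R i * T (simple i j))
| H_RR (i i' : 'I_n.-1) : (i.+1 < i')%N || (i'.+1 < i)%N -> Hrel (R i * R i') (R i' * R i)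
| H_RRR (i i' : 'I_n.-1) : i' = i.+1 :> nat ->
    Hrel (R i * R i' * R i) (R i' * R i * R i')
| H_RR2 i : Hrel (R i * R i)
    (AConst Zq + AConst Za * T (lo i) ^+ ((b ^ 2 - b) %/ 2)%N * E_term i * R i).

Definition Hbn : pzAlgType Zqa := palg Hrel.

End GenericAlgebra.

Section Hecke.
Variables (A : comPzRingType) (c0 c1 : A) (m : nat).
Local Notation tm := (aterm A 'I_m.-1).
Local Notation S i := (AGen i : tm).

Inductive hecke_rel : tm -> tm -> Prop :=
| hecke_comm (i i' : 'I_m.-1) : (i.+1 < i')%N || (i'.+1 < i)%N ->
    hecke_rel (S i * S i') (S i' * S i)
| hecke_braid (i i' : 'I_m.-1) : i' = i.+1 :> nat ->
    hecke_rel (S i * S i' * S i) (S i' * S i * S i')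
| hecke_quad i : hecke_rel (S i * S i) (AConst c0 + AConst c1 * S i).

Definition hecke : pzAlgType A := palg hecke_rel.
Definition hecke_gen (i : 'I_m.-1) : hecke := palg_gen hecke_rel i.

End Hecke.

Record setting := Setting {
  sn : nat;
  sb : nat;
  sn_gt0 : (0 < sn)%N;
  sb_gt0 : (0 < sb)%N;
  realT : realType;
  zetaC : realT[i];
  zetaC_prim : sb.-primitive_root zetaC;
  (* an algebraic closure of C(q, a), with C(q, a) = Frac C[q][a] *)
  Kbar : closedFieldType;
  iotaK : {rmorphism {fraction {poly {poly realT[i]}}} -> Kbar};
  iotaK_alg : forall z : Kbar, algebraicOver iotaK z;
  (* a square root of b^2 a^2 + 4 q *)
  sqrtK : Kbar;
  sqrtK_sqr : sqrtK ^+ 2 =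
    (sb%:R * iotaK (tofrac 'X)) ^+ 2 + 4%:R * iotaK (tofrac ('X%:P))
}.

Section BaseRing.
Variable X : setting.
Local Notation n := (sn X).
Local Notation b := (sb X).
Local Notation K := (Kbar X).

Definition qK : K := iotaK X (tofrac ('X%:P)).
Definition aK : K := iotaK X (tofrac 'X).
Definition zetaK : K := iotaK X (tofrac (zetaC X)%:P%:P).

Definition xK : K :=
  (b%:R ^+ 2 * aK ^+ 2 + b%:R * aK * sqrtK X + 2%:R * qK) / (2%:R * qK).
Definition yK : K := (b%:R * aK + sqrtK X) / (2%:R * qK).

Definition unit_in (S : K -> Prop) (u : K) : Prop :=
  S u /\ exists2 v, S v & u * v = 1.

Definition admissible (S : K -> Prop) : Prop :=
  [/\ S 1, forall u v, S u -> S v -> S (u - v)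
         & forall u v, S u -> S v -> S (u * v)] /\
  [/\ S qK, S aK, S zetaK & S (sqrtK X)] /\
  [/\ unit_in S 2%:R, unit_in S b%:R, unit_in S qK
    & forall k, (1 <= k <= n - 2)%N -> unit_in S (\sum_(i < k.+1) xK ^+ i)].

Definition inA : {pred K} :=
  fun z => `[< forall S, admissible S -> S z >].

Lemma inAP z : reflect (forall S, admissible S -> S z) (z \in inA).
Proof. exact: asboolP. Qed.

Fact inA_subring : subring_closed inA.
Proof.
split=> [|u v /inAP hu /inAP hv|u v /inAP hu /inAP hv]; apply/inAP => S hS.
- by case: hS => [[]].
- by case: (hS) => [[_ + _] _]; apply; [apply: hu | apply: hv].
- by case: (hS) => [[_ _ +] _]; apply; [apply: hu | apply: hv].
Qed.
HB.instance Definition _ := GRing.isSubringClosed.Build K inA inA_subring.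

Definition A := {z : K | z \in inA}.
HB.instance Definition _ := [isSub of A for sval].
HB.instance Definition _ := [Choice of A by <:].
HB.instance Definition _ := [SubChoice_isSubComNzRing of A by <:].

(* Junk value 0 when z is not in A *)
Definition toA (z : K) : A := insubd 0 z.

Definition qA : A := toA qK.
Definition aA : A := toA aK.
Definition zetaA : A := toA zetaK.
Definition binvA : A := toA b%:R^-1.
Definition epsA : A := zetaA ^+ ((b ^ 2 - b) %/ 2)%N.

Definition hcoef1 (k : int) : A := toA ((xK - 1) / (yK * (1 - xK ^ k))).
Definition hcoef2 (k : int) : A := toA ((xK - xK ^ k) / (yK * (1 - xK ^ k))).

Definition ZqaA : {rmorphism Zqa -> A} :=
  horner_eval aA \o map_poly (horner_eval qA \o map_poly intr).

Lemma bK_neq0 : (b%:R : K) != 0.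
Proof.
rewrite -(rmorph_nat (iotaK X)) fmorph_eq0.
have <- : tofrac (b%:R : {poly {poly (realT X)[i]}}) = b%:R.
  exact: rmorph_nat.
rewrite tofrac_eq0 -[b%:R]polyC_natr polyC_eq0 -[b%:R]polyC_natr polyC_eq0.
by rewrite Num.Theory.pnatr_eq0 -lt0n sb_gt0.
Qed.

Lemma inA_bV : b%:R^-1 \in inA.
Proof.
apply/inAP => S [_ [_ [_ [_ [v Sv bv]] _ _]]].
suff -> : (b%:R : K)^-1 = v by [].
by apply: (mulfI bK_neq0); rewrite bv mulfV ?bK_neq0.
Qed.

Lemma binvAE : (b%:R : A) * binvA = 1.
Proof.
apply: val_inj; rewrite rmorphM rmorph1 rmorph_nat /= insubdK ?inA_bV //.
exact/mulfV/bK_neq0.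
Qed.

Lemma inA_zeta : zetaK \in inA.
Proof. by apply/inAP => S [_ [[]]]. Qed.

Lemma zetaA_pow : zetaA ^+ b = 1.
Proof.
apply: val_inj; rewrite rmorphXn rmorph1 /= insubdK ?inA_zeta //.
have h : (zetaC X)%:P%:P ^+ b = 1 :> {poly {poly (realT X)[i]}}.
  by rewrite -!polyC_exp (prim_expr_order (zetaC_prim X)) !polyC1.
rewrite /zetaK -(rmorphXn (iotaK X)) /=.
have <- : tofrac ((zetaC X)%:P%:P ^+ b) = tofrac (zetaC X)%:P%:P ^+ b.
  exact: rmorphXn.
by rewrite h tofrac1 rmorph1.
Qed.

End BaseRing.

Section Weights.
Variable X : setting.
Local Notation n := (sn X).
Local Notation b := (sb X).
Local Notation A := (A X).

(* d : D stands for diag(zeta^{d_1}, ..., zeta^{d_n}); since b > 0, this is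
   the group (Z/b)^n, written additively. *)
Definition D := {ffun 'I_n -> 'I_b.-1.+1}.

Definition diagD (d : D) : 'M[(realT X)[i]]_n :=
  diag_mx (\row_j zetaC X ^+ d j).

(* The matrix of w : it maps v_i to v_{w(i)} *)
Definition matW (w : 'S_n) : 'M[(realT X)[i]]_n := \matrix_(k, i) (k == w i)%:R.

Definition conjD (w : 'S_n) (d : D) : D := [ffun i => d (w i)].

Lemma sbK : b.-1.+1 = b.
Proof. exact: prednK (sb_gt0 X). Qed.

Lemma expr_D (F : pzSemiRingType) (z : F) (d d' : D) j :
  z ^+ b = 1 -> z ^+ (d + d')%R j = z ^+ d j * z ^+ d' j.
Proof.
move=> zb; rewrite ffunE /= -exprD; move: (nat_of_ord (d j)) (nat_of_ord (d' j)) => k k'.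
by rewrite sbK [in RHS](divn_eq (k + k') b) exprD mulnC exprM zb expr1n mul1r.
Qed.

Lemma diagD_add d d' : diagD (d + d') = diagD d *m diagD d'.
Proof.
rewrite /diagD mulmx_diag; congr diag_mx; apply/rowP => j; rewrite !mxE.
exact/expr_D/prim_expr_order/zetaC_prim.
Qed.

Lemma diagD_inj : injective diagD.
Proof.
move=> d d' /matrixP dd'; apply/ffunP => j; apply/val_inj.
move/(_ j j): dd'; rewrite !mxE eqxx !mulr1n => /eqP.
rewrite (eq_prim_root_expr (zetaC_prim X)) => /eqP.
by rewrite !modn_small // -[X in (_ < X)%N]sbK ltn_ord.
Qed.

Lemma diagD_surj (M : 'M[(realT X)[i]]_n) :
  is_diag_mx M -> (forall j, exists k : nat, M j j = zetaC X ^+ k) ->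
  exists d, M = diagD d.
Proof.
move=> /is_diag_mxP Md /choice[k Mk].
exists [ffun j => inord (k j %% b)]; apply/matrixP => i j; rewrite !mxE.
have [<-|ij] := eqVneq i j; last by rewrite Md.
rewrite mulr1n ffunE Mk inordK ?sbK ?ltn_mod ?sb_gt0 //.
by rewrite (prim_expr_mod (zetaC_prim X)).
Qed.

Lemma conjD_mx w d : matW w *m diagD (conjD w d) = diagD d *m matW w.
Proof.
apply/matrixP => i j; rewrite mul_mx_diag mul_diag_mx !mxE ffunE.
by have [->|] := eqVneq; rewrite ?mul1r ?mulr1 ?mul0r ?mulr0.
Qed.

Definition Hring : pzAlgType A := bcalg (ZqaA X) (Hbn b n).

Definition HT (j : 'I_n) : Hring :=
  bcalg_in (ZqaA X) (palg_gen (@Hrel b n) (GT j)).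
Definition HR (i : 'I_n.-1) : Hring :=
  bcalg_in (ZqaA X) (palg_gen (@Hrel b n) (GR i)).

Definition tD (d : D) : Hring := \prod_j HT j ^+ d j.
Definition tW (w : 'S_n) : Hring := \prod_(i <- reduced_word w) HR i.

Local Notation char := {ffun D -> A}.

(* Membership in X(D); the values of chi are then automatically units. *)
Definition is_char (chi : char) : Prop :=
  chi 0 = 1 /\ forall d d', chi (d + d') = chi d * chi d'.

Definition charW (w : 'S_n) (chi : char) : char := [ffun d : D => chi (conjD w d)].

Definition chi_of (i : 'I_n -> nat) : char :=
  [ffun d : D => zetaA X ^+ (\sum_j i j * d j)%N].

Definition eD (chi : char) : Hring :=
  binvA X ^+ n *:a \sum_(d : D) (chi (- d) *:a tD d).

Lemma chi_of_char i : is_char (chi_of i).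
Proof.
split=> [|d d']; rewrite !ffunE.
  by rewrite big1 // => j _; rewrite ffunE muln0.
rewrite -!prodrXr -big_split /=; apply: eq_bigr => j _.
rewrite ![(i j * _)%N]mulnC !exprM -exprMn; congr (_ ^+ _).
exact/expr_D/zetaA_pow.
Qed.

Lemma bcalg_inM u v : bcalg_in (ZqaA X) (u * v : Hbn b n) =
  bcalg_in (ZqaA X) u * bcalg_in (ZqaA X) v.
Proof.
rewrite [RHS](palg_mulE (@bc_rel _ _ (ZqaA X) (Hbn b n))).
exact/palg_eqP/ac_rel/bc_mul.
Qed.

Lemma HT_comm j j' : GRing.comm (HT j) (HT j').
Proof.
rewrite /GRing.comm -!bcalg_inM; congr bcalg_in.
rewrite [LHS](palg_mulE (@Hrel b n)) [RHS](palg_mulE (@Hrel b n)).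
exact/palg_eqP/ac_rel/H_TT.
Qed.

Lemma HT_pow j : HT j ^+ b = 1.
Proof.
have in1 : bcalg_in (ZqaA X) (1 : Hbn b n) = 1.
  rewrite -(rmorph1 (@algc _ (Hbn b n))) -(rmorph1 (@algc A Hring)).
  by rewrite -(rmorph1 (ZqaA X)); apply/palg_eqP/ac_rel/bc_const.
have inX (u : Hbn b n) k : bcalg_in (ZqaA X) (u ^+ k) = bcalg_in (ZqaA X) u ^+ k.
  by elim: k => [|k IH]; rewrite ?expr0 // !exprS bcalg_inM IH.
have piX (t : aterm Zqa (Hgen n)) k :
  (\pi_(palg (@Hrel b n)) t : Hbn b n) ^+ k = \pi_(palg (@Hrel b n)) (apow t k).
  elim: k => [//|k IH]; rewrite exprS IH.
  exact: (palg_mulE (@Hrel b n)).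
rewrite /HT -inX [_ ^+ b]piX -in1; congr bcalg_in.
exact/palg_eqP/ac_rel/H_Tpow.
Qed.

Lemma tD_add d d' : tD (d + d') = tD d * tD d'.
Proof.
rewrite /tD -prodrM_comm => [|i j _ _]; last exact/commrX/commr_sym/commrX/HT_comm.
by apply: eq_bigr => j _; apply/expr_D/HT_pow.
Qed.

Lemma eD_idem chi : is_char chi -> eD chi * eD chi = eD chi.
Proof.
move=> [chi0 chiD]; rewrite /eD /ascale.
set s := \sum_d _; set c := algc _.
have ss : s * s = algc (b%:R ^+ n) * s.
  rewrite {1}/s mulr_suml (eq_bigr (fun=> s)) => [|d _].
    rewrite sumr_const card_ffun !card_ord sbK rmorphXn rmorph_nat.
    by rewrite -natrX mulr_natl.
  rewrite /s mulr_sumr [RHS](reindex_inj (addrI d)) /=.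
  apply: eq_bigr => d' _; rewrite /ascale opprD chiD rmorphM tD_add.
  by rewrite -!mulrA; congr (_ * _); rewrite !mulrA algc_central.
rewrite -mulrA (mulrA s) -[s * c]algc_central -mulrA ss !mulrA.
congr (_ * _); rewrite /c -!rmorphM -mulrA; congr algc.
by rewrite -exprMn [binvA X * _]mulrC binvAE expr1n mulr1.
Qed.

End Weights.

Section Blocks.
Variable X : setting.
Local Notation n := (sn X).
Local Notation b := (sb X).
Local Notation A := (A X).
Variable al : 'I_b -> nat.

(* [al j] is m_{j+1}: the components, too, are numbered from 0. *)
Definition mbar (j : nat) : nat := \sum_(l < b | (l < j)%N) al l.

Definition in_block (j : 'I_b) (i : 'I_n) : bool := (mbar j <= i < mbar j.+1)%N.

Definition inWal (w : 'S_n) : Prop :=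
  forall (j : 'I_b) (i i' : 'I_n),
    in_block j i -> in_block j i' -> (i < i')%N -> (w i < w i')%N.

(* (1, ..., 1, ..., b, ..., b), with j repeated m_j times *)
Definition al_seq : seq nat := flatten [seq nseq (al j) j.+1 | j <- enum 'I_b].

Definition chi_al : {ffun D X -> A} := chi_of (fun i => nth 0%N al_seq i).

Definition orbit_al : seq {ffun D X -> A} :=
  undup [seq charW w chi_al | w <- enum 'S_n].

Definition e_al : Hring X := \sum_(chi <- orbit_al) eD chi.

Definition Hal : pzAlgType A := corner (eD_idem (chi_of_char _ : is_char chi_al)).

Definition in_weight (V : lmodType (Hring X)) (chi : {ffun D X -> A}) (v : V) :=
  exists u, v = eD chi *: u.

Definition in_O (V : lmodType (Hring X)) : Prop :=
  forall v : V, exists u, v = e_al *: u.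

Definition Ihecke (m : nat) : pzAlgType A := hecke (qA X) (b%:R * aA X) m.
Definition Ial : pzAlgType A := tnalg (fun j => Ihecke (al j)).

(* eta, with inverse etaV, is an isomorphism of A-algebras that sends the l-th
   generator of the j-th factor to epsilon^j t_s e_{chi_alpha}, where
   s = s_{mbar_{j-1} + l}. *)
Definition is_eta (eta : {rmorphism Ial -> Hal}) (etaV : {rmorphism Hal -> Ial}) :=
  [/\ cancel eta etaV, cancel etaV eta,
      forall c : A, eta (algc c) = algc c
    & forall (j : 'I_b) (l : 'I_(al j).-1) (i : 'I_n.-1), i = mbar j + l :> nat ->
        \val (eta (tnalg_in (j := j) (hecke_gen _ _ l))) =
        epsA X ^+ j.+1 *:a (tW (simple i) * eD chi_al)].

Section InducedModule.
Variable etaV : {rmorphism Hal -> Ial}.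
Variable P : forall j, lmodType (Ihecke (al j)).

Definition P0 : lmodType Hal := restr etaV (tnmod P).

Definition Vmod : lmodType (Hring X) :=
  btmod (@lideal_ract _ _ _ (eD_idem (chi_of_char _ : is_char chi_al))) P0.

End InducedModule.
End Blocks.

(* P is the I^m-module of Hoefsmit attached to the partition mu of m, with its
   A-basis p. *)
Definition is_hoefsmit (X : setting) (m : nat) (mu : seq nat)
    (P : lmodType (Ihecke X m)) (p : SYT m (fun _ : unit => mu) -> P) : Prop :=
  is_basis p /\
  forall (l : 'I_m.-1) (t : SYT m (fun _ : unit => mu)),
    let k := axial (\val t) (hi l) (lo l) in
    hecke_gen _ _ l *: p t =
      hcoef1 X k *:m p t + hcoef2 X k *:m ext0 p (tact (simple l) (\val t)).

Section StandardTableaux.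
Variables (b n : nat) (lam : 'I_b -> seq nat).

Definition inSYT0 (t : SYT n lam) : bool :=
  [forall i : 'I_n, forall i' : 'I_n, (i <= i')%N ==>
     (tcomp (\val t) i <= tcomp (\val t) i')%N].

End StandardTableaux.

Definition chi_tab (X : setting) (t : tableau 'I_(sb X) (sn X)) :
    {ffun D X -> A X} :=
  chi_of (fun i => (tcomp t i).+1).

(* Main.v *)
Require Import Defs.
From HB Require Import structures.
From mathcomp Require Import all_boot all_order all_algebra all_fingroup.
From mathcomp Require Import generic_quotient complex.
From mathcomp Require Import boolp classical_sets functions reals.
From mathcomp Require Import zify.

Set Implicit Arguments.
Unset Strict Implicit.
Unset Printing Implicit Defensive.

Import Order.TTheory GRing.Theory.

Local Open Scope ring_scope.
Local Open Scope quotient_scope.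

(** Why the theorem holds.

    Write e for the idempotent of the weight chi_alpha, so that V is the module
    H e (x)_{eHe} P0. For any idempotent e and any eHe-module N, the map
    z |-> e (x) z identifies N with e (H e (x) N) ([ind_in_inj],
    [ind_in_surj]): a retraction is v |-> e v, read in N. This gives the
    weight space of chi_alpha at once, without any basis of H.

    The other weight spaces come from this one. The weights in the orbit of
    chi_alpha are the colourings of the n letters with m_j letters of colour j,
    chi_alpha being the sorted colouring. If i and i+1 have different colours
    in c, then E_i kills the weight vectors of weight c, R_i maps V_c to
    V_{s_i c}, and R_i^2 acts on V_c as q, a unit ([HR_HR_wt]). Hence every
    V_c is a copy of P0, carried from the sorted weight by a product of R_i
    along a word that sorts c by swapping descents ([wt_word_inv]). All such
    words have the same product in H: two different first swaps either commute
    or belong to a braid, and both ways of finishing meet again ([sorts_uniq]).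
    A reduced word of an element of W^alpha is one of these words
    ([reduced_sorts], [sorts_block]), so the product is t_w. The weight spaces
    of the orbit span V, because their sum contains e (x) P0 and is stable under
    the generators ([wt_sumZ]), and the idempotents e_chi separate them.

    A standard b-tableau is the same thing as a colouring together with one
    standard tableau for each component, obtained by renumbering the entries of
    that component in order ([std_inj], [std_glue]). With the tensor products of
    the bases of Hoefsmit as a basis of P0 ([pure_basis]), the vectors
    v_tau = t_w (e (x) (x)_j p_{tau^j}) form the basis that is wanted. R_i acts
    on v_tau by lengthening or shortening t_w when the colours of i and i+1
    differ; when they agree, R_i t_w = t_w R_l where l is the place of i after
    sorting ([sorts_commute]), and R_l acts on e (x) P0 through eta, by the
    formula of Hoefsmit.

    For the last assertion, f V is again generated by a copy of f P0, which is
    the image of 1 (x) e, because the retraction above survives the extension of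
    scalars ([ind_in_sx]). As every weight space is t_w e g_w V for suitable g_w,
    no nonzero vector of f V is killed by all of e H, and submodules of f V and of
    f P0 determine each other closely enough to transfer irreducibility
    ([irreducible_induced]). *)

(** * Presented algebras and modules *)

Section PresentedInduction.

Lemma palg_ind (R : comPzRingType) (G : Type)
  (rel : aterm R G -> aterm R G -> Prop) (Q : palg rel -> Prop) :
  (forall x, Q (palg_gen rel x)) -> (forall c, Q (algc c)) ->
  (forall u v, Q u -> Q v -> Q (u + v)) -> (forall u, Q u -> Q (- u)) ->
  (forall u v, Q u -> Q v -> Q (u * v)) -> forall u, Q u.
Proof.
move=> Qg Qc Qa Qo Qm u; rewrite -[u]reprK; elim: (repr u) => {u}.
- exact: Qg.
- exact: Qc.
- by move=> s Qs t Qt; rewrite -palg_addE; apply: Qa.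
- by move=> s Qs; rewrite -palg_oppE; apply: Qo.
- by move=> s Qs t Qt; rewrite -palg_mulE; apply: Qm.
Qed.

Lemma pmod_ind (B : pzRingType) (G : Type)
  (rel : mterm B G -> mterm B G -> Prop) (Q : pmod rel -> Prop) :
  (forall x, Q (pmod_gen rel x)) -> Q 0 ->
  (forall u v, Q u -> Q v -> Q (u + v)) ->
  (forall h u, Q u -> Q (h *: u)) -> forall u, Q u.
Proof.
move=> Qg Q0 Qa Qs u; rewrite -[u]reprK; elim: (repr u) => {u}.
- exact: Qg.
- exact: Q0.
- by move=> s Qu t Qt; rewrite -pmod_addE; apply: Qa.
- move=> s Qu; rewrite -pmod_oppE -[pmod_opp _]/(- (_ : pmod rel)).
  by rewrite -scaleN1r; apply: Qs.
- by move=> h s Qu; rewrite -pmod_scaleE; apply: Qs.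
Qed.

Lemma palg_relE (R : comPzRingType) (G : Type)
  (rel : aterm R G -> aterm R G -> Prop) s t :
  rel s t -> aeval (palg_gen rel) s = aeval (palg_gen rel) t.
Proof.
have ev u : aeval (palg_gen rel) u = \pi_(palg rel) u.
  elim: u => //= [u -> v ->|u ->|u -> v ->].
  - exact: palg_addE.
  - exact: palg_oppE.
  - exact: palg_mulE.
by move=> st; rewrite !ev; apply/palg_eqP/ac_rel.
Qed.

Lemma pmod_relE (B : pzRingType) (G : Type)
  (rel : mterm B G -> mterm B G -> Prop) s t :
  rel s t -> meval (pmod_gen rel) s = meval (pmod_gen rel) t.
Proof.
have ev u : meval (pmod_gen rel) u = \pi_(pmod rel) u.
  elim: u => //= [u -> v ->|u ->|h u ->].
  - exact: pmod_addE.
  - exact: pmod_oppE.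
  - exact: pmod_scaleE.
by move=> st; rewrite !ev; apply/pmod_eqP/mc_rel.
Qed.

End PresentedInduction.

(** * Representations on modules over the base ring *)

Section LinearEndomorphisms.
Variables (R : comPzRingType) (V : lmodType R).

Definition is_lin : {pred V -> V} := fun f => `[< linear f >].

Fact is_lin_zmod : zmod_closed is_lin.
Proof.
split=> [|f g /asboolP fl /asboolP gl]; apply/asboolP => c u v.
  by rewrite /= scaler0 addr0.
rewrite -[LHS]/(f (c *: u + v) - g (c *: u + v)) fl gl.
rewrite -[RHS]/(c *: (f u - g u) + (f v - g v)).
by rewrite scalerBr addrACA opprD.
Qed.
HB.instance Definition _ := GRing.isZmodClosed.Build (V -> V) is_lin is_lin_zmod.

(** A subtype of the functions V -> V, so that it is an algebra over R, possibly
    zero: a target for the universal property of presented algebras. *)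
Definition lend := {f : V -> V | f \in is_lin}.
HB.instance Definition _ := [isSub of lend for sval].
HB.instance Definition _ := [Choice of lend by <:].
HB.instance Definition _ := [SubChoice_isSubZmodule of lend by <:].

Lemma lend_lin (f : lend) : linear (\val f).
Proof. by case: f => f /= /asboolP. Qed.

Lemma lendP (f g : lend) : (forall u, \val f u = \val g u) -> f = g.
Proof. by move=> fg; apply/val_inj/funext. Qed.

Lemma is_linP (f : V -> V) : linear f -> f \in is_lin.
Proof. by move=> fl; apply/asboolP. Qed.

Definition mk_lend (f : V -> V) (fl : linear f) : lend := Sub f (is_linP fl).

Lemma lendD (f : lend) u v : \val f (u + v) = \val f u + \val f v.
Proof. by rewrite -{1}[u]scale1r lend_lin scale1r. Qed.

Lemma lend0 (f : lend) : \val f 0 = 0.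
Proof. by apply: (addrI (\val f 0)); rewrite -lendD !addr0. Qed.

Lemma lendZ (f : lend) c u : \val f (c *: u) = c *: \val f u.
Proof. by rewrite -[c *: u]addr0 lend_lin lend0 addr0. Qed.

Fact lend_one_subproof : linear (@id V). Proof. by []. Qed.
Fact lend_mul_subproof (f g : lend) : linear (\val f \o \val g).
Proof. by move=> c u v; rewrite /= !lend_lin. Qed.
Fact lend_const_subproof (c : R) : linear (fun u : V => c *: u).
Proof. by move=> d u v; rewrite scalerDr !scalerA mulrC. Qed.

Definition lend_one := mk_lend lend_one_subproof.
Definition lend_mul f g := mk_lend (lend_mul_subproof f g).
Definition lend_const c := mk_lend (lend_const_subproof c).

Fact lend_mulA : associative lend_mul.
Proof. by move=> f g h; apply: lendP. Qed.
Fact lend_mul1l : left_id lend_one lend_mul.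
Proof. by move=> f; apply: lendP. Qed.
Fact lend_mul1r : right_id lend_one lend_mul.
Proof. by move=> f; apply: lendP. Qed.
Fact lend_mulDl : left_distributive lend_mul +%R.
Proof. by move=> f g h; apply: lendP. Qed.
Fact lend_mulDr : right_distributive lend_mul +%R.
Proof. by move=> f g h; apply: lendP => u /=; rewrite [LHS]lendD. Qed.

HB.instance Definition _ := GRing.Zmodule_isPzRing.Build lend
  lend_mulA lend_mul1l lend_mul1r lend_mulDl lend_mulDr.

Fact lend_const_nmod : nmod_morphism lend_const.
Proof.
split=> [|c d]; apply: lendP => u /=; first by rewrite scale0r.
by rewrite scalerDl.
Qed.
Fact lend_const_monoid : monoid_morphism lend_const.
Proof.
split=> [|c d]; apply: lendP => u /=; first by rewrite scale1r.
by rewrite -[RHS]/(c *: (d *: u)) scalerA.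
Qed.
Fact lend_const_central c (f : lend) : lend_const c * f = f * lend_const c.
Proof. by apply: lendP => u /=; rewrite -[RHS]/(\val f (c *: u)) lendZ. Qed.

HB.instance Definition _ := PzRing_isAlgOver.Build R lend
  lend_const_nmod lend_const_monoid lend_const_central.

End LinearEndomorphisms.

Section Representation.
Variables (R : comPzRingType) (V : lmodType R) (B : pzRingType).
Variable rho : {rmorphism B -> lend V}.

Definition rep_of (_ : {rmorphism B -> lend V}) : Type := V.
(** V with the action of B through a representation rho: a target for the
    universal property of presented modules. *)
Definition rep := rep_of rho.
HB.instance Definition _ := GRing.Zmodule.copy rep V.

Definition rep_scale (b : B) (u : rep) : rep := \val (rho b) (u : V).

Fact rep_scaleA b b' (u : rep) :
  rep_scale b (rep_scale b' u) = rep_scale (b * b') u.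
Proof. by rewrite /rep_scale rmorphM. Qed.
Fact rep_scale1 : left_id 1 rep_scale.
Proof. by move=> u; rewrite /rep_scale rmorph1. Qed.
Fact rep_scaleDr : right_distributive rep_scale +%R.
Proof. by move=> b u v; apply: lendD. Qed.
Fact rep_scaleDl (u : rep) : {morph rep_scale^~ u : b b' / b + b'}.
Proof. by move=> b b'; rewrite /rep_scale rmorphD. Qed.
HB.instance Definition _ := GRing.Zmodule_isLmodule.Build B rep
  rep_scaleA rep_scale1 rep_scaleDr rep_scaleDl.

End Representation.

(** * Coinduced modules *)

Section Coinduced.
Variables (H : pzRingType) (N : zmodType).

Definition is_addm : {pred H -> N} := fun f => `[< {morph f : x y / x + y} >].

Fact is_addm_zmod : zmod_closed is_addm.
Proof.
split=> [|f g /asboolP fl /asboolP gl]; apply/asboolP => u v.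
  by rewrite /= addr0.
rewrite -[LHS]/(f (u + v) - g (u + v)) fl gl.
by rewrite -[RHS]/((f u - g u) + (f v - g v)) addrACA opprD.
Qed.
HB.instance Definition _ := GRing.isZmodClosed.Build (H -> N) is_addm is_addm_zmod.

(** For the action (h f)(x) = f (x h) to be additive in h, the functions have to
    be additive. *)
Definition coind := {f : H -> N | f \in is_addm}.
HB.instance Definition _ := [isSub of coind for sval].
HB.instance Definition _ := [Choice of coind by <:].
HB.instance Definition _ := [SubChoice_isSubZmodule of coind by <:].

Lemma coindP (f g : coind) : (forall u, \val f u = \val g u) -> f = g.
Proof. by move=> fg; apply/val_inj/funext. Qed.

Lemma coindD (f : coind) u v : \val f (u + v) = \val f u + \val f v.
Proof. by case: f => f /= /asboolP. Qed.

Fact mk_coind_subproof (f : H -> N) : {morph f : x y / x + y} -> f \in is_addm.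
Proof. by move=> fl; apply/asboolP. Qed.
Definition mk_coind f fl : coind := Sub f (@mk_coind_subproof f fl).

Fact coind_scale_subproof (h : H) (f : coind) :
  {morph (fun x => \val f (x * h)) : x y / x + y}.
Proof. by move=> x y; rewrite mulrDl coindD. Qed.
Definition coind_scale h f := mk_coind (coind_scale_subproof h f).

Fact coind_scaleA h h' f : coind_scale h (coind_scale h' f) = coind_scale (h * h') f.
Proof. by apply: coindP => x /=; rewrite mulrA. Qed.
Fact coind_scale1 : left_id 1 coind_scale.
Proof. by move=> f; apply: coindP => x /=; rewrite mulr1. Qed.
Fact coind_scaleDr : right_distributive coind_scale +%R.
Proof. by move=> h f g; apply: coindP. Qed.
Fact coind_scaleDl f : {morph coind_scale^~ f : h h' / h + h'}.
Proof. by move=> h h'; apply: coindP => x /=; rewrite mulrDr [LHS]coindD. Qed.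
HB.instance Definition _ := GRing.Zmodule_isLmodule.Build H coind
  coind_scaleA coind_scale1 coind_scaleDr coind_scaleDl.

End Coinduced.

(** * Induction from a corner of an algebra *)

Section CornerModule.
Variables (R : comPzRingType) (H : pzAlgType R) (e : H) (idem : e * e = e).
Local Notation C := (corner idem).
Variable N : lmodType C.
Local Notation V := (btmod (@lideal_ract _ _ _ idem) N).

Fact cut_subproof (h : H) : e * h * e \in in_corner e.
Proof. by apply/in_cornerP; exists h. Qed.
Definition cut (h : H) : C := Sub (e * h * e) (cut_subproof h).

Lemma cutD h h' : cut (h + h') = cut h + cut h'.
Proof. by apply: val_inj; rewrite /= mulrDr mulrDl. Qed.

Lemma lideal_e (m : lideal e) : (\val m : H) * e = \val m.
Proof. by case: m => _ /= /in_lidealP[g ->]; rewrite -mulrA idem. Qed.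

Fact lideal_unit_subproof : (e : H^o) \in in_lideal e.
Proof. by apply/in_lidealP; exists 1; rewrite mul1r. Qed.
Definition lideal_unit : lideal e := Sub (e : H^o) lideal_unit_subproof.

Definition btgen (m : lideal e) (z : N) : V := pmod_gen _ (m, z).

Lemma btgenDr m z z' : btgen m (z + z') = btgen m z + btgen m z'.
Proof. exact: (pmod_relE (bt_addr _ m z z')). Qed.
Lemma btgen_bal m (s : C) z : btgen (lideal_ract m s) z = btgen m (s *: z).
Proof. exact: (pmod_relE (bt_bal _ m s z)). Qed.
Lemma btgenZ h m z : btgen (h *: m) z = h *: btgen m z.
Proof. exact: (pmod_relE (bt_scale _ h m z)). Qed.

(** The map z |-> e (x) z. *)
Definition ind_in (z : N) : V := btgen lideal_unit z.

Fact ind_in_nmod : nmod_morphism ind_in.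
Proof.
have iD : {morph ind_in : z z' / z + z'} by move=> z z'; apply: btgenDr.
by split=> //; apply: (addrI (ind_in 0)); rewrite -iD !addr0.
Qed.
HB.instance Definition _ := GRing.isNmodMorphism.Build N V ind_in ind_in_nmod.

(** Since m = m e, the generator m (x) z is m (e (x) z): the module is generated
    by e (x) N. *)
Lemma btgenE m z : btgen m z = (\val m : H) *: ind_in z.
Proof.
rewrite -btgenZ; congr (btgen _ z); apply: val_inj.
by rewrite /= -[LHS]lideal_e.
Qed.

Lemma ind_inZ (s : C) z : ind_in (s *: z) = \val s *: ind_in z.
Proof.
by rewrite /ind_in -btgen_bal btgenE /= corner_e_l.
Qed.

Lemma ind_in_e z : e *: ind_in z = ind_in z.
Proof. by rewrite -[LHS](ind_inZ (1 : C)) scale1r. Qed.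

Lemma ind_in_algc c z : ind_in ((algc c : C) *: z) = (algc c : H) *: ind_in z.
Proof. by rewrite ind_inZ /= -scalerA ind_in_e. Qed.

Lemma ind_ind (Q : V -> Prop) :
  (forall z, Q (ind_in z)) -> Q 0 -> (forall u v, Q u -> Q v -> Q (u + v)) ->
  (forall h u, Q u -> Q (h *: u)) -> forall u, Q u.
Proof.
move=> Qg Q0 Qa Qs; apply: pmod_ind => // -[m z].
by rewrite -[pmod_gen _ _]/(btgen m z) btgenE; apply/Qs/Qg.
Qed.

Fact ind_coind_subproof (x : lideal e * N) :
  {morph (fun h : H => cut (h * (\val x.1 : H)) *: x.2) : h h' / h + h'}.
Proof. by move=> h h'; rewrite mulrDl cutD scalerDl. Qed.

(** The retraction h (e (x) z) |-> (e h e) z of [ind_in]. It is not H-linear, so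
    the universal property does not give it directly. It gives the H-linear map
    from V to the additive maps H -> N that sends h e (x) z to
    x |-> (e x h e) z, and the retraction is its value at x = 1. *)
Lemma ind_out_exists : exists rho : V -> N,
  [/\ nmod_morphism rho, forall c u, rho ((algc c : H) *: u) = (algc c : C) *: rho u
    & forall h z, rho (h *: ind_in z) = cut h *: z].
Proof.
have [|Phi PhiE] := @pmod_universal H _ (@bt_rel _ _ _ (@lideal_ract _ _ _ idem) N)
   (coind H N) (fun x => mk_coind (@ind_coind_subproof x)).
  move=> _ _ [m m' x|m x x'|m s x|h m x]; apply: coindP => h' /=.
  - by rewrite mulrDr cutD scalerDl.
  - by rewrite scalerDr.
  - rewrite scalerA; congr (_ *: _); apply: val_inj => /=.
    by rewrite -!mulrA corner_e_r corner_e_l.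
  - by rewrite mulrA.
pose rho v := \val (Phi v) 1.
have rhoE h z : rho (h *: ind_in z) = cut h *: z.
  rewrite /rho linearZ /= mul1r PhiE /=; congr (_ *: _); apply: val_inj => /=.
  by rewrite -!mulrA idem.
have rhoD : {morph rho : u v / u + v} by move=> u v; rewrite /rho linearD.
have rhoM : nmod_morphism rho.
  by split=> //; apply: (addrI (rho 0)); rewrite -rhoD !addr0.
have rhoZ h u : rho (h *: u) = \val (Phi u) h.
  by rewrite /rho linearZ /= mul1r.
exists rho; split=> // c u.
elim/ind_ind: u => [z||u v IHu IHv|h u _].
- rewrite rhoE -[ind_in z]scale1r rhoE scalerA; congr (_ *: _).
  apply: val_inj => /=; rewrite mulr1 idem -(algc_central c e) -!mulrA.
  by rewrite !idem.
- by rewrite scaler0 rhoM.1 scaler0.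
- by rewrite scalerDr rhoD IHu IHv rhoD scalerDr.
rewrite scalerA; elim/ind_ind: u h => [z||u v IHu IHv|h' u IHu] h.
- rewrite !rhoE scalerA; congr (_ *: _); apply: val_inj => /=.
  by rewrite !mulrA -(algc_central c e) -!mulrA (mulrA e e) idem.
- by rewrite !scaler0 rhoM.1 scaler0.
- by rewrite !scalerDr !rhoD IHu IHv scalerDr.
- by rewrite !scalerA -mulrA IHu.
Qed.

Lemma ind_in_inj : injective ind_in.
Proof.
have [rho [_ _ rhoE]] := ind_out_exists.
apply: (can_inj (g := rho)) => z.
rewrite -[ind_in z]scale1r rhoE -[RHS]scale1r; congr (_ *: _).
by apply: val_inj; rewrite /= mulr1 idem.
Qed.

(** e V = e H e (x) N = e (x) N, as e H e can be moved across the tensor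
    sign. *)
Lemma ind_in_surj u : exists z, e *: u = ind_in z.
Proof.
elim/ind_ind: u => [z||u v [z zP] [z' z'P]|h u _].
- by exists z; rewrite ind_in_e.
- by exists 0; rewrite scaler0 raddf0.
- by exists (z + z'); rewrite scalerDr zP z'P raddfD.
elim/ind_ind: u h => [z||u v IHu IHv|h' u IHu] h.
- by exists (cut h *: z); rewrite ind_inZ -scalerA ind_in_e scalerA.
- by exists 0; rewrite !scaler0 raddf0.
- have [z zP] := IHu h; have [z' z'P] := IHv h.
  by exists (z + z'); rewrite !scalerDr zP z'P raddfD.
- by rewrite (scalerA h); apply: IHu.
Qed.

End CornerModule.

(** * Extension of scalars *)

Section ScalarExtensionTheory.
Variables (R S : comPzRingType) (f : {rmorphism R -> S}) (B : pzAlgType R).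
Local Notation fB := (bcalg f B).
Local Notation inB := (bcalg_in f (B := B)).

Lemma bcalg_inD u v : inB (u + v) = inB u + inB v.
Proof. exact: (palg_relE (bc_add _ u v)). Qed.
Lemma bcalg_inM u v : inB (u * v) = inB u * inB v.
Proof. exact: (palg_relE (bc_mul _ u v)). Qed.
Lemma bcalg_in_algc c : inB (algc c) = algc (f c).
Proof. exact: (palg_relE (bc_const _ _ c)). Qed.

Fact bcalg_in_nmod : nmod_morphism inB.
Proof.
split; last exact: bcalg_inD.
by rewrite -(rmorph0 (@algc R B)) bcalg_in_algc !rmorph0.
Qed.
Fact bcalg_in_monoid : monoid_morphism inB.
Proof.
split; last exact: bcalg_inM.
by rewrite -(rmorph1 (@algc R B)) bcalg_in_algc !rmorph1.
Qed.
HB.instance Definition _ := GRing.isNmodMorphism.Build B fB inB bcalg_in_nmod.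
HB.instance Definition _ := GRing.isMonoidMorphism.Build B fB inB bcalg_in_monoid.

(** The pure tensors c (x) h are closed under products, hence span the algebra
    additively. *)
Lemma bcalg_ind (Q : fB -> Prop) :
  (forall c h, Q (algc c * inB h)) -> (forall u v, Q u -> Q v -> Q (u + v)) ->
  forall u, Q u.
Proof.
move=> Qg Qa u; suff [s ->] : exists s : seq (S * B),
    u = \sum_(x <- s) algc x.1 * inB x.2.
  elim: s => [|x s IH]; last by rewrite big_cons; apply/Qa.
  by rewrite big_nil -(mul0r (inB 1)) -(rmorph0 (@algc S fB)); apply: Qg.
elim/palg_ind: u => [h|c|_ _ [s ->] [t ->]|_ [s ->]|_ _ [s ->] [t ->]].
- by exists [:: (1, h)]; rewrite big_seq1 /= rmorph1 mul1r.
- by exists [:: (c, 1)]; rewrite big_seq1 /= rmorph1 mulr1.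
- by exists (s ++ t); rewrite big_cat.
- exists [seq (- x.1, x.2) | x <- s]; rewrite big_map -sumrN.
  by apply: eq_bigr => x _; rewrite rmorphN mulNr.
- exists [seq (x.1 * y.1, x.2 * y.2) | x <- s, y <- t].
  rewrite big_allpairs_dep /= mulr_suml; apply: eq_bigr => x _.
  rewrite mulr_sumr; apply: eq_bigr => y _ /=.
  rewrite !rmorphM /= -!mulrA; congr (_ * _).
  by rewrite !mulrA; congr (_ * _); rewrite algc_central.
Qed.

Variable M : lmodType B.
Local Notation fM := (bcmod f M).
Definition bcm_in (m : M) : fM := pmod_gen _ m.

Fact bcm_in_nmod : nmod_morphism bcm_in.
Proof.
have iD : {morph bcm_in : u v / u + v}.
  by move=> u v; apply: (pmod_relE (bcm_add f u v)).
by split=> //; apply: (addrI (bcm_in 0)); rewrite -iD !addr0.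
Qed.
HB.instance Definition _ := GRing.isNmodMorphism.Build M fM bcm_in bcm_in_nmod.

Lemma bcm_inZ h m : bcm_in (h *: m) = inB h *: bcm_in m.
Proof. exact: (pmod_relE (bcm_scale f h m)). Qed.

Lemma bcm_ind (Q : fM -> Prop) :
  (forall c m, Q ((algc c : fB) *: bcm_in m)) ->
  (forall u v, Q u -> Q v -> Q (u + v)) -> forall u, Q u.
Proof.
move=> Qg Qa u; suff [s ->] : exists s : seq (S * M),
    u = \sum_(x <- s) (algc x.1 : fB) *: bcm_in x.2.
  elim: s => [|x s IH]; last by rewrite big_cons; apply/Qa.
  by rewrite big_nil -(scaler0 _ (algc 0)) -(raddf0 bcm_in); apply: Qg.
elim/pmod_ind: u => [m||_ _ [s ->] [t ->]|h _ [s ->]].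
- by exists [:: (1, m)]; rewrite big_seq1 /= rmorph1 scale1r.
- by exists [::]; rewrite big_nil.
- by exists (s ++ t); rewrite big_cat.
elim/bcalg_ind: h => [c h|h h' [t tP] [t' t'P]].
  exists [seq (c * x.1, h *: x.2) | x <- s]; rewrite big_map scaler_sumr.
  apply: eq_bigr => x _ /=; rewrite bcm_inZ !scalerA rmorphM -!mulrA.
  by congr ((_ * _) *: _); rewrite algc_central.
by exists (t ++ t'); rewrite scalerDl tP t'P big_cat.
Qed.

(** Presents S (x)_R M as a module over S alone. *)
Inductive sx_rel : mterm S M -> mterm S M -> Prop :=
| sx_add u v : sx_rel (MGen (u + v)) (MGen u + MGen v)%MT
| sx_scale c u : sx_rel (MGen ((algc c : B) *: u)) (f c *: MGen u)%MT.

Local Notation T := (pmod sx_rel).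
Local Notation inT := (pmod_gen sx_rel).

(** B acts on S (x)_R M through its second factor. *)
Lemma sx_act_exists h : exists L : {linear T -> T}, forall m, L (inT m) = inT (h *: m).
Proof.
apply: pmod_universal => _ _ [u v|c u] /=.
  by rewrite scalerDr; apply: (pmod_relE (sx_add (h *: u) (h *: v))).
rewrite scalerA -algc_central -scalerA.
exact: (pmod_relE (sx_scale c (h *: u))).
Qed.

(** By its presentation, S (x)_R M only has a universal property for modules over
    S (x)_R B. The action of B on the S-module presented by [sx_rel] identifies
    the two, and so every semilinear map out of M extends. *)
Lemma bcm_semilinear (G : lmodType S) (g : M -> G) :
  {morph g : u v / u + v} -> (forall c u, g ((algc c : B) *: u) = f c *: g u) ->
  exists phi : {additive fM -> G},
    (forall c u, phi ((algc c : fB) *: u) = c *: phi u) /\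
    forall m, phi (bcm_in m) = g m.
Proof.
move=> gD gZ; have [L LE] := choice sx_act_exists.
pose Lf h : lend T := mk_lend (linearP (L h)).
have TP (x y : lend T) : (forall m, \val x (inT m) = \val y (inT m)) -> x = y.
  move=> xy; apply: lendP => u; elim/pmod_ind: u => [//||u v xu xv|c u xu].
  - by rewrite !lend0.
  - by rewrite !lendD xu xv.
  - by rewrite !lendZ xu.
have [|rho [rhoC rhoB]] := @palg_universal S B (@bc_rel _ _ f B) (lend T) Lf.
  move=> _ _ [u v|u v|c] /=; apply: TP => m /=; rewrite !LE.
  - rewrite scalerDl -[RHS]/(L u (inT m) + L v (inT m)) !LE.
    exact: (pmod_relE (sx_add (u *: m) (v *: m))).
  - by rewrite scalerA.
  - exact: (pmod_relE (sx_scale c m)).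
have [|phi1 phi1E] := @pmod_universal fB M (@bcm_rel _ _ f B M) (rep rho) inT.
  move=> _ _ [u v|h u] /=; first exact: (pmod_relE (sx_add u v)).
  by rewrite -[RHS]/(\val (rho (bcalg_in f h)) (inT u)) rhoB /= LE.
have [|phi2 phi2E] := @pmod_universal S M sx_rel G g.
  by move=> _ _ [u v|c u] /=; rewrite ?gD ?gZ.
pose phi (u : fM) : G := phi2 (phi1 u : T).
have phiD : {morph phi : u v / u + v}.
  by move=> u v; rewrite /phi linearD; apply: (linearD phi2 (phi1 u : T) (phi1 v)).
have phiM : nmod_morphism phi.
  by split=> //; apply: (addrI (phi 0)); rewrite -phiD !addr0.
pose a := GRing.isNmodMorphism.Build _ _ phi phiM.
pose F : {additive fM -> G} := HB.pack phi a.
exists F; split=> [c u|m]; last by rewrite /= /phi phi1E phi2E.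
have phi1Z : phi1 ((algc c : fB) *: u) = c *: (phi1 u : T) :> T.
  by rewrite linearZ -[LHS]/(\val (rho (algc c)) (phi1 u : T)) rhoC.
by rewrite /= /phi phi1Z linearZ.
Qed.

End ScalarExtensionTheory.

(** * Irreducibility of induced modules *)

Section IrreducibleInduced.
Variables (R S : comPzRingType) (f : {rmorphism R -> S}).
Variables (H : pzAlgType R) (e : H) (idem : e * e = e).
Local Notation C := (corner idem).
Variable N : lmodType C.
Local Notation V := (btmod (@lideal_ract _ _ _ idem) N).
Local Notation fH := (bcalg f H).
Local Notation fC := (bcalg f C).
Local Notation fV := (bcmod f V).
Local Notation fN := (bcmod f N).
Local Notation inH := (bcalg_in f (B := H)).
Local Notation inC := (bcalg_in f (B := C)).
Local Notation inV := (bcm_in f (M := V)).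
Local Notation inN := (bcm_in f (M := N)).
Local Notation iota := (@ind_in _ _ _ idem N).

(** Extension of scalars does not preserve injections in general; here it does,
    because [ind_in] has a semilinear retraction. *)
Lemma ind_in_sx : exists i : {additive fN -> fV},
  [/\ forall c u, i ((algc c : fC) *: u) = (algc c : fH) *: i u,
      forall z, i (inN z) = inV (iota z) & injective i].
Proof.
have [|c z|i [iZ iE]] := @bcm_semilinear R S f C N
    (restr (@algc S fH : {rmorphism S -> fH}) fV) (fun z => inV (iota z)).
- by move=> z z'; rewrite /= !raddfD.
- by rewrite /= ind_in_algc bcm_inZ bcalg_in_algc.
have [rho [rhoD rhoZ rhoE]] := ind_out_exists N.
have [|c v|r [rZ rE]] := @bcm_semilinear R S f H V
    (restr (@algc S fC : {rmorphism S -> fC}) fN) (fun v => inN (rho v)).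
- by move=> u v; rewrite /= rhoD.2 raddfD.
- by rewrite /= rhoZ bcm_inZ bcalg_in_algc.
pose j (u : fN) : fV := i u.
have jD : nmod_morphism j by split=> [|u v]; rewrite /j ?raddf0 ?raddfD.
pose a := GRing.isNmodMorphism.Build _ _ j jD.
pose F : {additive fN -> fV} := HB.pack j a.
exists F; split=> [c u|z|]; [exact: iZ | exact: iE |].
apply: (can_inj (g := r)) => u; elim/bcm_ind: u => [c z|u v IHu IHv].
  rewrite /= /j iZ iE [LHS]rZ rE; congr (_ *: inN _).
  rewrite -[iota z]scale1r rhoE -[RHS]scale1r; congr (_ *: _).
  by apply: val_inj; rewrite /= mulr1 idem.
by rewrite !raddfD IHu IHv.
Qed.

Variables (J : finType) (a b : J -> H).
Hypothesis unit_sum : forall u : V, u = \sum_j a j *: (e *: (b j *: u)).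

(** The hypothesis on a and b says that H e H contains an element that acts on V
    as the identity, so that no nonzero vector of fV is killed by all of e H.
    A submodule of fV is compared with its preimage in fN; a submodule Q
    of fN is compared with the largest submodule U of fV such that
    e U lies in the image of Q. *)
Lemma irreducible_induced : irreducible_module fV <-> irreducible_module fN.
Proof.
have [i [iZ iE i_inj]] := ind_in_sx.
have i_in s u : i (inC s *: u) = inH (\val s) *: i u.
  elim/bcm_ind: u => [c z|u v IHu IHv]; last by rewrite !(scalerDr, raddfD) IHu IHv.
  rewrite scalerA -algc_central -scalerA iZ -bcm_inZ iE ind_inZ bcm_inZ.
  by rewrite iZ iE !scalerA algc_central.
have i_e u : inH e *: i u = i u by rewrite -{2}[u]scale1r -(rmorph1 inC) i_in.
have i_surj (u : fV) : exists z, inH e *: u = i z.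
  elim/bcm_ind: u => [c v|u v [z zP] [z' z'P]].
    have [z zP] := ind_in_surj v; exists ((algc c : fC) *: inN z).
    by rewrite scalerA -algc_central -scalerA -bcm_inZ zP iZ iE.
  by exists (z + z'); rewrite scalerDr zP z'P raddfD.
have fV_gen (Q : fV -> Prop) : (forall z, Q (i z)) ->
    (forall u v, Q u -> Q v -> Q (u + v)) ->
    (forall h u, Q u -> Q (h *: u)) -> forall u, Q u.
  move=> Qi Qa Qs; apply: bcm_ind => // c v; apply: (Qs).
  elim/ind_ind: v => [z||u v Qu Qv|h v Qv].
  - by rewrite -iE.
  - by rewrite raddf0 -(raddf0 i).
  - by rewrite raddfD; apply: Qa.
  - by rewrite bcm_inZ; apply: Qs.
have fV_dec (u : fV) : u = \sum_j inH (a j) *: (inH e *: (inH (b j) *: u)).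
  elim/bcm_ind: u => [c v|u v {1}-> {1}->].
    have cC (h : fH) (w : fV) : h *: ((algc c : fH) *: w) = (algc c : fH) *: (h *: w).
      by rewrite !scalerA algc_central.
    rewrite {1}[v]unit_sum raddf_sum scaler_sumr; apply: eq_bigr => j _.
    by rewrite /= !bcm_inZ !cC.
  by rewrite -big_split; apply: eq_bigr => j _; rewrite !scalerDr.
have fV_eq0 (u : fV) : (forall h, inH e *: (h *: u) = 0) -> u = 0.
  by move=> u0; rewrite [u]fV_dec big1 // => j _; rewrite u0 scaler0.
split=> [[[u0 u0P] irr]|[[z0 z0P] irr]]; split.
- apply: contrapT => N0; apply: u0P.
  apply: (fV_gen (fun u => u = 0)) => [z|u v -> ->|h u ->].
  + by have -> : z = 0; [apply: contrapT => zP; apply: N0; exists z | rewrite raddf0].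
  + by rewrite addr0.
  + by rewrite scaler0.
- move=> Q Q0 QD QZ.
  pose Q' (u : fV) := forall h, exists2 z, Q z & inH e *: (h *: u) = i z.
  have [||h u Qu h'|Q'0|Q'T] := irr Q'.
  + by move=> h; exists 0; rewrite // raddf0 !scaler0.
  + move=> u v Qu Qv h; have [z Qz zP] := Qu h; have [z' Qz' z'P] := Qv h.
    by exists (z + z'); [apply: (QD) | rewrite !scalerDr zP z'P raddfD].
  + by rewrite (scalerA h'); apply: Qu.
  + left=> z Qz; apply: i_inj; rewrite raddf0; apply: Q'0.
    elim/bcalg_ind=> [c h|h h' [z1 Qz1 z1P] [z2 Qz2 z2P]].
      exists ((algc c : fC) *: (inC (cut idem h) *: z)); first by do 2!apply: (QZ).
      rewrite iZ i_in /= !rmorphM -!scalerA i_e !scalerA.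
      by rewrite !mulrA algc_central.
    by exists (z1 + z2); [apply: (QD) | rewrite scalerDl scalerDr z1P z2P raddfD].
  + right=> z; have [z' Qz'] := Q'T (i z) 1.
    by rewrite scale1r i_e => /i_inj->.
- by exists (i z0) => iz0; apply: z0P; apply: i_inj; rewrite iz0 raddf0.
- move=> Q Q0 QD QZ.
  have [||h z Qz|Q'0|Q'T] := irr (fun z => Q (i z)).
  + by rewrite raddf0.
  + by move=> u v Qu Qv; rewrite raddfD; apply: (QD).
  + elim/bcalg_ind: h => [c s|h h' IH IH'].
      by rewrite -scalerA iZ i_in; do 2!apply: (QZ).
    by rewrite scalerDl raddfD; apply: (QD).
  + left=> u Qu; apply: fV_eq0 => h.
    have Qe : Q (inH e *: (h *: u)) by do 2!apply: (QZ).
    by have [z zP] := i_surj (h *: u); move: Qe; rewrite zP => /Q'0->; rewrite raddf0.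
  + by right; apply: fV_gen.
Qed.

End IrreducibleInduced.

(** * Bases of tensor products *)

Section FreeModule.
Variables (R : comPzRingType) (B : pzAlgType R) (V : lmodType B).

Lemma mscaleDr c (u v : V) : c *:m (u + v) = c *:m u + c *:m v.
Proof. exact: scalerDr. Qed.
Lemma mscaleDl c d (u : V) : (c + d) *:m u = c *:m u + d *:m u.
Proof. by rewrite /mscale rmorphD scalerDl. Qed.
Lemma mscaleA c d (u : V) : c *:m (d *:m u) = (c * d) *:m u.
Proof. by rewrite /mscale scalerA rmorphM. Qed.
Lemma mscale1 (u : V) : 1 *:m u = u.
Proof. by rewrite /mscale rmorph1 scale1r. Qed.
Lemma mscale0 (u : V) : 0 *:m u = 0.
Proof. by rewrite /mscale rmorph0 scale0r. Qed.
Lemma mscaler0 c : c *:m (0 : V) = 0.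
Proof. exact: scaler0. Qed.
Lemma mscaleN c (u : V) : (- c) *:m u = - (c *:m u).
Proof. by rewrite /mscale rmorphN scaleNr. Qed.
Lemma mscale_sumr (I : Type) (r : seq I) (Q : pred I) (F : I -> V) c :
  c *:m (\sum_(i <- r | Q i) F i) = \sum_(i <- r | Q i) c *:m F i.
Proof. exact: scaler_sumr. Qed.
Lemma mscale_suml (I : Type) (r : seq I) (Q : pred I) (F : I -> R) (u : V) :
  (\sum_(i <- r | Q i) F i) *:m u = \sum_(i <- r | Q i) F i *:m u.
Proof. by rewrite /mscale rmorph_sum scaler_suml. Qed.
Lemma mscaleC c (h : B) (u : V) : h *: (c *:m u) = c *:m (h *: u).
Proof. by rewrite /mscale !scalerA algc_central. Qed.

Variables (I : finType) (v : I -> V).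

Lemma basis_uniq : is_basis v -> forall c d : I -> R,
  \sum_i c i *:m v i = \sum_i d i *:m v i -> c =1 d.
Proof.
move=> [_ ind] c d cd i; apply/eqP; rewrite -subr_eq0; apply/eqP.
apply: (ind (fun i => c i - d i)); rewrite -[RHS](subrr (\sum_i c i *:m v i)).
rewrite {2}cd -sumrB; apply: eq_bigr => k _.
by rewrite mscaleDl mscaleN.
Qed.

End FreeModule.

Section TensorBasis.
Variables (R : comPzRingType) (J : finType) (B : J -> pzAlgType R).
Variables (M : forall j, lmodType (B j)) (I : J -> finType).
Variable p : forall j, I j -> M j.
Hypothesis pB : forall j, is_basis (@p j).
Local Notation T := (tnmod M).

Definition tngen (m : forall j, M j) : T := pmod_gen _ m.

Lemma tngen_dfwithD m j (u v : M j) :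
  tngen (dfwith m (u + v)) = tngen (dfwith m u) + tngen (dfwith m v).
Proof. exact: (pmod_relE (tm_add m u v)). Qed.
Lemma tngen_dfwithZ m j h (u : M j) :
  tngen (dfwith m (h *: u)) = tnalg_in h *: tngen (dfwith m u).
Proof. exact: (pmod_relE (tm_scale m h u)). Qed.

Lemma tnalg_in_algc j c : tnalg_in (algc c : B j) = algc c.
Proof. exact: (palg_relE (tn_const B j c)). Qed.

Lemma tngen_dfwithC m j c (u : M j) :
  tngen (dfwith m (c *:m u)) = c *:m tngen (dfwith m u).
Proof. by rewrite tngen_dfwithZ tnalg_in_algc. Qed.

Lemma tngen_dfwith0 m j : tngen (dfwith m (0 : M j)) = 0.
Proof. by rewrite -(mscale0 (0 : M j)) tngen_dfwithC mscale0. Qed.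

Lemma tngen_dfwith_sum m j (K : Type) (r : seq K) (F : K -> M j) :
  tngen (dfwith m (\sum_(i <- r) F i)) = \sum_(i <- r) tngen (dfwith m (F i)).
Proof.
elim: r => [|i r IH]; first by rewrite !big_nil tngen_dfwith0.
by rewrite !big_cons tngen_dfwithD IH.
Qed.

Lemma dfwith_id (F : J -> Type) (m : forall j, F j) j : dfwith m (m j) = m.
Proof.
apply: functional_extensionality_dep => j'.
by have [<-|jj'] := eqVneq j j'; rewrite ?dfwith_in ?dfwith_out.
Qed.

Definition pure (s : {dffun forall j, I j}) : T := tngen (fun j => p (s j)).

(** The slots are expanded in the given bases one after the other, which shows
    that pure tensors of arbitrary vectors lie in the span; then the span is
    stable under the algebra. *)
Lemma pure_span u : in_span predT pure u.
Proof.
have sD x y : in_span predT pure x -> in_span predT pure y -> in_span predT pure (x + y).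
  move=> [c ->] [d ->]; exists (fun s => c s + d s).
  by rewrite -big_split; apply: eq_bigr => s _; rewrite mscaleDl.
have sZ c x : in_span predT pure x -> in_span predT pure (c *:m x).
  move=> [d ->]; exists (fun s => c * d s); rewrite mscale_sumr.
  by apply: eq_bigr => s _; rewrite mscaleA.
have s0 : in_span predT pure 0.
  by exists (fun=> 0); rewrite big1 // => s _; rewrite mscale0.
have sS (K : finType) (F : K -> T) : (forall k, in_span predT pure (F k)) ->
    in_span predT pure (\sum_k F k).
  by move=> sF; apply: (big_ind (in_span predT pure)).
have sG m : in_span predT pure (tngen m).
  suff gen (r : seq J) : forall m, (forall j, j \notin r -> exists i, m j = p i) ->
      in_span predT pure (tngen m).
    by apply: (gen (enum J)) => j; rewrite mem_enum.
  elim: r => [|j r IH] {}m mr.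
    have [s sP] : exists s : {dffun forall j, I j}, forall j, m j = p (s j).
      have [s sP] := fin_all_exists (fun j => mr j isT).
      by exists (finfun s) => j; rewrite ffunE.
    exists (fun t => (t == s)%:R).
    rewrite (bigD1 s) //= eqxx mscale1 big1 => [|t /negPf->].
      by rewrite addr0; congr tngen; apply: functional_extensionality_dep.
    by rewrite mscale0.
  rewrite -[m](dfwith_id m j); have [c ->] := (pB j).1 (m j).
  rewrite tngen_dfwith_sum; apply: sS => i; rewrite tngen_dfwithC; apply/sZ/IH => j'.
  have [<- _|jj' j'r] := eqVneq j j'; first by exists i; rewrite dfwith_in.
  by rewrite dfwith_out //; apply: mr; rewrite inE negb_or eq_sym jj'.
elim/pmod_ind: u => [m||x y|h u su]; [exact: sG | exact: s0 | exact: sD |].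
elim/palg_ind: h u su => [[j h]|c|h h' IH IH'|h IH|h h' IH IH'] u su.
- have [c ->] := su; rewrite scaler_sumr; apply: sS => s; rewrite mscaleC.
  rewrite /pure -(dfwith_id (fun j => p (s j)) j) -tngen_dfwithZ.
  exact/sZ/sG.
- exact: sZ.
- by rewrite scalerDl; apply: sD; [apply: IH | apply: IH'].
- by rewrite scaleNr -scaleN1r -(rmorphN1 (@algc R (tnalg B))); apply/sZ/IH.
- by rewrite -scalerA; apply/IH/IH'.
Qed.

Definition fam_upd (s : {dffun forall j, I j}) j (i : I j) : {dffun forall j, I j} :=
  finfun (dfwith (fun j => s j) i).

Lemma fam_upd_in s j (i : I j) : fam_upd s i j = i.
Proof. by rewrite ffunE dfwith_in. Qed.
Lemma fam_upd_out s j (i : I j) j' : j != j' -> fam_upd s i j' = s j'.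
Proof. by move=> jj'; rewrite ffunE dfwith_out. Qed.
Lemma fam_upd_id s j : fam_upd s (s j) = s.
Proof.
apply/ffunP => j'.
by have [<-|jj'] := eqVneq j j'; rewrite ?fam_upd_in ?fam_upd_out.
Qed.
Lemma fam_upd_upd s j (i i' : I j) : fam_upd (fam_upd s i) i' = fam_upd s i'.
Proof.
by apply/ffunP => j'; have [<-|jj'] := eqVneq j j'; rewrite ?fam_upd_in ?fam_upd_out.
Qed.
Lemma fam_upd_comm s j j' (i : I j) (i' : I j') : j != j' ->
  fam_upd (fam_upd s i) i' = fam_upd (fam_upd s i') i.
Proof.
move=> jj'; apply/ffunP => k.
have [jk|jk] := eqVneq j k.
  by subst k; rewrite fam_upd_out 1?eq_sym // !fam_upd_in.
have [j'k|j'k] := eqVneq j' k; last by rewrite !fam_upd_out.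
by subst k; rewrite fam_upd_in fam_upd_out // fam_upd_in.
Qed.

Section Coordinates.
Variable co : forall j, M j -> I j -> R.
Hypothesis coE : forall j u, u = \sum_i co u i *:m p i :> M j.

Lemma coord_uniq j u d : u = \sum_i d i *:m p i -> co u =1 d :> (I j -> R).
Proof. by move=> ud; apply: (basis_uniq (pB j)); rewrite -coE. Qed.

Lemma coordD j (u v : M j) i : co (u + v) i = co u i + co v i.
Proof.
apply: (coord_uniq (d := fun i => co u i + co v i)).
rewrite {1}[u]coE {1}[v]coE -big_split; apply: eq_bigr => k _.
by rewrite mscaleDl.
Qed.

Lemma coord_basis j (i k : I j) a : co (a *:m p i) k = a * (k == i)%:R.
Proof.
apply: (coord_uniq (d := fun k => a * (k == i)%:R)).
rewrite (bigD1 i) //= eqxx mulr1 big1 ?addr0 // => l /negPf->.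
by rewrite mulr0 mscale0.
Qed.

Lemma coordZ j h (u : M j) i : co (h *: u) i = \sum_k co (h *: p k) i * co u k.
Proof.
apply: (coord_uniq (d := fun i => \sum_k co (h *: p k) i * co u k)).
rewrite {1}[u]coE scaler_sumr.
under [RHS]eq_bigr => l _ do rewrite mscale_suml.
rewrite exchange_big /=; apply: eq_bigr => k _.
rewrite mscaleC {1}[h *: p k]coE mscale_sumr; apply: eq_bigr => l _.
by rewrite mscaleA mulrC.
Qed.

Local Notation X := {ffun {dffun forall j, I j} -> R^o}.

(** The action of h, placed in the slot j, on the coordinates of an element of
    the tensor product. *)
Definition tnop j (h : B j) (x : X) : X :=
  [ffun s : {dffun forall j, I j} => \sum_k co (h *: p k) (s j) * x (fam_upd s k)].

Lemma tnop_lin j (h : B j) : linear (tnop h).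
Proof.
move=> a x y; apply/ffunP => s; rewrite !ffunE scaler_sumr -big_split /=.
apply: eq_bigr => k _; rewrite !ffunE mulrDr; congr (_ + _).
by rewrite -[a *: _]/(a * _) -[RHS]/(a * _) mulrCA.
Qed.

Lemma tnopD j (u v : B j) x : tnop (u + v) x = tnop u x + tnop v x.
Proof.
apply/ffunP => s; rewrite !ffunE -big_split; apply: eq_bigr => k _.
by rewrite scalerDl coordD mulrDl.
Qed.

Lemma tnopM j (u v : B j) x : tnop (u * v) x = tnop u (tnop v x).
Proof.
apply/ffunP => s; rewrite !ffunE.
under eq_bigr => k _ do rewrite -scalerA coordZ mulr_suml.
rewrite exchange_big /=; apply: eq_bigr => k _.
rewrite ffunE mulr_sumr; apply: eq_bigr => l _.
by rewrite fam_upd_in fam_upd_upd mulrA.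
Qed.

Lemma tnop_algc j a x : tnop (algc a : B j) x = a *: x.
Proof.
apply/ffunP => s; rewrite !ffunE (bigD1 (s j)) //= big1 => [|k /negPf ks].
  by rewrite addr0 fam_upd_id [co _ _]coord_basis eqxx mulr1.
by rewrite [co _ _]coord_basis eq_sym ks mulr0 mul0r.
Qed.

(** Different slots update different components of the index. *)
Lemma tnop_comm j j' (u : B j) (v : B j') x : j != j' ->
  tnop u (tnop v x) = tnop v (tnop u x).
Proof.
move=> jj'; apply/ffunP => s; rewrite !ffunE.
under eq_bigr => k _ do rewrite ffunE mulr_sumr.
under [RHS]eq_bigr => k _ do rewrite ffunE mulr_sumr.
rewrite exchange_big /=; apply: eq_bigr => l _; apply: eq_bigr => k _.
by rewrite fam_upd_out // (@fam_upd_out _ j') 1?eq_sym // fam_upd_comm // mulrCA.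
Qed.

Lemma tnrep_exists : exists rho : {rmorphism tnalg B -> lend X},
  (forall c x, \val (rho (algc c)) x = c *: x) /\
  forall j (h : B j) x, \val (rho (tnalg_in h)) x = tnop h x.
Proof.
have [|rho [rhoC rhoG]] := @palg_universal R _ (@tn_rel R J B) (lend X)
    (fun g => mk_lend (@tnop_lin (tag g) (tagged g))).
  move=> _ _ [j u v|j u v|j a|j j' u v jj']; apply: lendP => x.
  - exact: tnopD.
  - exact: tnopM.
  - exact: tnop_algc.
  - exact: tnop_comm.
exists rho; split=> [c x|j h x]; first by rewrite rhoC.
by rewrite rhoG.
Qed.

(** The coordinates of the pure tensor of m. *)
Definition tnform (m : forall j, M j) : X :=
  [ffun s : {dffun forall j, I j} => \prod_j co (m j) (s j)].

Lemma tnform_dfwith (m : forall j, M j) j (u : M j) s : tnform (dfwith m u) s =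
  co u (s j) * \prod_(j' | j' != j) co (m j') (s j').
Proof.
rewrite ffunE (bigD1 j) //= dfwith_in; congr (_ * _); apply: eq_bigr => j' jj'.
by rewrite dfwith_out // eq_sym.
Qed.

Lemma tnformD (m : forall j, M j) j (u v : M j) :
  tnform (dfwith m (u + v)) = tnform (dfwith m u) + tnform (dfwith m v).
Proof.
apply/ffunP => s.
by rewrite [RHS]ffunE !tnform_dfwith coordD mulrDl.
Qed.

Lemma tnformZ (m : forall j, M j) j (h : B j) (u : M j) :
  tnform (dfwith m (h *: u)) = tnop h (tnform (dfwith m u)).
Proof.
apply/ffunP => s; rewrite [RHS]ffunE !tnform_dfwith coordZ mulr_suml.
apply: eq_bigr => k _; rewrite tnform_dfwith fam_upd_in mulrA; congr (_ * _).
by apply: eq_bigr => j' jj'; rewrite fam_upd_out // eq_sym.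
Qed.

Lemma tnform_pure (s t : {dffun forall j, I j}) :
  tnform (fun j => p (s j)) t = (t == s)%:R.
Proof.
rewrite ffunE; have [->|ts] := eqVneq t s.
  by rewrite big1 // => j _; rewrite -[p _]mscale1 coord_basis eqxx mulr1.
have [j /negPf tsj] : exists j, t j != s j.
  apply/existsP; apply: contra_neqT ts => /existsPn ts.
  by apply/ffunP => j; apply/eqP; move: (ts j); rewrite negbK.
by rewrite (bigD1 j) //= -[p _]mscale1 coord_basis tsj mulr0 mul0r.
Qed.

(** The operators [tnop] represent the tensor product of the algebras on the free
    module with coordinates indexed by the families, and [tnform] is compatible
    with them. The resulting linear map sends the pure tensors of basis vectors
    to the standard basis, which is free. *)
Lemma pure_free_coord (c : {dffun forall j, I j} -> R) :
  \sum_s c s *:m pure s = 0 -> forall s, c s = 0.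
Proof.
have [rho [rhoC rhoG]] := tnrep_exists.
have [|phi phiE] := @pmod_universal (tnalg B) _ (@tm_rel R J B M) (rep rho) tnform.
  move=> _ _ [m j u v|m j h u]; first exact: tnformD.
  by rewrite -[RHS]/(\val (rho (tnalg_in h)) (tnform (dfwith m u))) rhoG -tnformZ.
move=> c0 s; have : phi (\sum_s c s *:m pure s) = 0 by rewrite c0 linear0.
rewrite linear_sum /= => /(congr1 (fun x : X => x s)).
have -> : (\sum_t phi (c t *:m pure t) : rep rho) =
    (\sum_t c t *: tnform (fun j => p (t j)) : X).
  apply: eq_bigr => t _.
  rewrite linearZ -[LHS]/(\val (rho (algc (c t))) (phi (pure t))) rhoC.
  by rewrite phiE.
rewrite sum_ffunE ffunE (bigD1 s) //= big1 => [|t /negPf ts].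
  by rewrite ffunE tnform_pure eqxx addr0 -[_ *: _]/(_ * _) mulr1.
by rewrite ffunE tnform_pure eq_sym ts -[_ *: _]/(_ * _) mulr0.
Qed.

End Coordinates.

Lemma pure_basis : is_basis pure.
Proof.
have [co coE] : exists co : forall j, M j -> I j -> R,
    forall j u, u = \sum_i co j u i *:m p i.
  apply: (@fin_all_exists J _ (fun j co =>
    forall u : M j, u = \sum_i co u i *:m p i)) => j.
  have /choice[co coE] : forall u : M j, exists c : I j -> R, u = \sum_i c i *:m p i.
    by move=> u; have [d ->] := (pB j).1 u; exists d.
  by exists co.
by split; [exact: pure_span | exact: pure_free_coord coE].
Qed.

End TensorBasis.

(** * Simple transpositions *)

Section SimpleTranspositions.
Variable n : nat.
Implicit Types (i k : 'I_n.-1) (a : 'I_n) (w : 'S_n).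

Lemma simpleE i a :
  simple i a = (if a == i :> nat then i.+1
                else if a == i.+1 :> nat then (i : nat) else a) :> nat.
Proof.
rewrite permE /= -!val_eqE /=.
by case: eqP => // ai; case: eqP.
Qed.

Lemma simple_lo i : simple i (lo i) = hi i. Proof. exact: tpermL. Qed.
Lemma simple_hi i : simple i (hi i) = lo i. Proof. exact: tpermR. Qed.
Lemma simple_out i a : a != i :> nat -> a != i.+1 :> nat -> simple i a = a.
Proof. by move=> ai ai1; apply: val_inj; rewrite /= simpleE (negPf ai) (negPf ai1). Qed.
Lemma simpleK i : involutive (simple i). Proof. exact: tpermK. Qed.
Lemma simpleV i : (simple i)^-1%g = simple i. Proof. exact: tpermV. Qed.

Lemma simple_far i k : (i.+1 < k)%N -> (simple i * simple k = simple k * simple i)%g.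
Proof.
move=> ik; apply/permP => a; apply: val_inj; rewrite /= !permM !simpleE.
by repeat case: eqP; lia.
Qed.

Lemma simple_braid i k : k = i.+1 :> nat ->
  (simple i * simple k * simple i = simple k * simple i * simple k)%g.
Proof.
move=> ik; apply/permP => a; apply: val_inj; rewrite /= !permM !simpleE.
by repeat case: eqP; lia.
Qed.

Lemma simple_inj : injective (@simple n).
Proof.
move=> i k ik; apply: val_inj => /=.
have := simpleE i (lo i); rewrite ik simpleE /= eqxx.
have := simpleE i (hi i); rewrite ik simpleE /= eqxx.
by repeat case: eqP; lia.
Qed.

Lemma simple_mono i a a' : (a < a')%N -> ~~ ((a == lo i) && (a' == hi i)) ->
  (simple i a < simple i a')%N.
Proof. by rewrite -!val_eqE /= !simpleE; repeat case: eqP => //=; lia. Qed.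

Lemma card_lt_ord (k : nat) : (k <= n)%N -> #|[set x : 'I_n | (x < k)%N]| = k.
Proof.
move=> kn; rewrite -sum1dep_card.
by rewrite -(big_ord_widen n (fun=> 1%N) kn) sum1_card card_ord.
Qed.

(** Such a set is an initial segment, and is known from its cardinal. *)
Lemma down_card (S : {set 'I_n}) a :
  (forall x y : 'I_n, (x <= y)%N -> y \in S -> x \in S) ->
  (a \in S) = (a < #|S|)%N.
Proof.
move=> dS; apply/idP/idP => [aS|].
  rewrite -(@card_lt_ord a.+1) //; apply/subset_leq_card/fintype.subsetP => x.
  by rewrite inE ltnS => xa; apply: dS aS.
apply: contraLR => aS; rewrite -leqNgt.
apply: (@leq_trans #|[set x : 'I_n | (x < a)%N]|); last by rewrite card_lt_ord // ltnW.
apply/subset_leq_card/fintype.subsetP => x xS; rewrite inE ltnNge.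
by apply: contra aS => ax; apply: dS xS.
Qed.

End SimpleTranspositions.

(** * Colourings and their sorting *)

Section Colourings.
Variables n N : nat.
Local Notation col := {ffun 'I_n -> 'I_N}.
Implicit Types (c : col) (i k l : 'I_n.-1) (a x y : 'I_n) (w : 'S_n).

Definition cact w c : col := [ffun a => c (w^-1%g a)].

Lemma cactM w w' c : cact w (cact w' c) = cact (w' * w) c.
Proof. by apply/ffunP => a; rewrite !ffunE invMg permM. Qed.
Lemma cact1 c : cact 1 c = c.
Proof. by apply/ffunP => a; rewrite ffunE invg1 perm1. Qed.
Lemma cactK i : involutive (cact (simple i)).
Proof. by move=> c; rewrite cactM tperm2 cact1. Qed.
Lemma cact_simple i c a : cact (simple i) c a = c (simple i a).
Proof. by rewrite ffunE simpleV. Qed.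
Lemma cact_perm w c a : cact w c (w a) = c a.
Proof. by rewrite ffunE permK. Qed.

Definition csorted c : bool :=
  [forall x : 'I_n, forall y : 'I_n, (x <= y)%N ==> (c x <= c y)%N].

Lemma csortedP c : reflect (forall x y, (x <= y)%N -> (c x <= c y)%N) (csorted c).
Proof.
apply: (iffP forallP) => [h x y xy|h x]; last by apply/forallP => y; apply/implyP/h.
by move/forallP: (h x) => /(_ y)/implyP/(_ xy).
Qed.

Definition descent c i : bool := (c (hi i) < c (lo i))%N.

Lemma csortedPn c : ~~ csorted c -> exists i, descent c i.
Proof.
move=> cN; apply/existsP; apply: contraR cN => /existsPn cD.
apply/csortedP => x y; have [m] := ubnP (y - x); elim: m y => // m IH y ym.
rewrite leq_eqVlt => /orP[/eqP/val_inj->//|xy].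
have yn : (y.-1 < n.-1)%N by have := ltn_ord y; lia.
have yE : y = hi (Ordinal yn) by apply: val_inj => /=; lia.
have := cD (Ordinal yn); rewrite -leqNgt -yE; apply: leq_trans.
by apply: IH => /=; lia.
Qed.

(** A measure of how far c is from being sorted: early letters count most, so
    moving a large colour to the right decreases it. *)
Definition disorder c : nat := (\sum_(a < n) (n - a) * c a)%N.

Lemma disorder_descent c i : descent c i -> (disorder (cact (simple i) c) < disorder c)%N.
Proof.
rewrite /descent => ci; have lh : hi i != lo i by rewrite -val_eqE /=; lia.
have wE (d : col) : disorder d = ((n - lo i) * d (lo i) + ((n - hi i) * d (hi i) +
    \sum_(a < n | (a != lo i) && (a != hi i)) (n - a) * d a))%N.
  by rewrite /disorder (bigD1 (lo i)) //= (bigD1 (hi i)).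
rewrite !wE !addnA.
rewrite [X in (_ + X < _)%N](_ : _ =
    \sum_(a < n | (a != lo i) && (a != hi i)) (n - a) * c a)%N; last first.
  apply: eq_bigr => a; rewrite -!val_eqE /= => /andP[al ah].
  by rewrite cact_simple simple_out.
rewrite ltn_add2r !cact_simple simple_lo simple_hi.
by have := ltn_ord (hi i); rewrite /= => hn; nia.
Qed.

(** Each letter of the word swaps a descent, and the end of the word leaves a
    sorted colouring. If c is w applied to a sorted colouring, with w increasing
    on each colour, these words are the reduced words of w. *)
Fixpoint sorts c (ws : seq 'I_n.-1) : bool :=
  if ws is i :: ws' then descent c i && sorts (cact (simple i) c) ws' else csorted c.

Lemma sorts_exists c : exists ws, sorts c ws.
Proof.
have [m] := ubnP (disorder c); elim: m c => // m IH c; rewrite ltnS => cm.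
have [cS|/csortedPn[i ci]] := boolP (csorted c); first by exists [::].
have [|ws wsP] := IH (cact (simple i) c); last by exists (i :: ws); rewrite /= ci.
by apply: leq_trans cm; apply: disorder_descent.
Qed.

Lemma csorted_descent c i : csorted c -> ~~ descent c i.
Proof. by move=> /csortedP cS; rewrite -leqNgt; apply: cS => /=. Qed.

Lemma sorts_sorted c ws : sorts c ws -> csorted (cact (word_perm ws)^-1 c).
Proof.
elim: ws c => [|i ws IH] c /=; first by rewrite invg1 cact1.
by move=> /andP[_ /IH]; rewrite cactM invMg simpleV.
Qed.

(** The order in which the letters appear after a stable sort by colour. *)
Definition lex_lt c x a : bool := (c x < c a)%N || (c x == c a) && (x < a)%N.
(** The position of the letter a after that sort. *)
Definition pos c a : nat := #|[set x | lex_lt c x a]|.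

Lemma lex_lt_trans c : transitive (lex_lt c).
Proof. by move=> y x z; rewrite /lex_lt -!val_eqE /=; lia. Qed.
Lemma lex_lt_irr c a : lex_lt c a a = false.
Proof. by rewrite /lex_lt !ltnn andbF. Qed.
Lemma lex_lt_total c x y : x != y -> lex_lt c x y || lex_lt c y x.
Proof. by rewrite /lex_lt -!val_eqE /=; lia. Qed.

Lemma pos_mono c x y : lex_lt c x y -> (pos c x < pos c y)%N.
Proof.
move=> xy; apply/proper_card/properP; split.
  by apply/fintype.subsetP => z; rewrite !inE => /lex_lt_trans; apply.
by exists x; rewrite inE ?lex_lt_irr.
Qed.

Lemma pos_ltn c a : (pos c a < n)%N.
Proof.
rewrite -[X in (_ < X)%N]card_ord -cardsT; apply/proper_card/properP.
by split; [apply: finset.subsetT | exists a; rewrite ?inE ?lex_lt_irr].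
Qed.

Lemma pos_lt c x y : (pos c x < pos c y)%N = lex_lt c x y.
Proof.
apply/idP/idP => [|/pos_mono//]; apply: contraTT => xy.
have [->|/(lex_lt_total c)] := eqVneq x y; first by rewrite ltnn.
by rewrite (negPf xy) -leqNgt => /pos_mono/ltnW.
Qed.

Lemma pos_inj c x y : pos c x = pos c y -> x = y.
Proof.
by move=> xy; apply: contra_eq xy => /(lex_lt_total c)/orP[]/pos_mono; lia.
Qed.

Fact posO_inj c : injective (fun a => Ordinal (pos_ltn c a)).
Proof. by move=> x y [/pos_inj]. Qed.
Definition sort_perm c : 'S_n := perm (@posO_inj c).

Lemma sort_permE c a : sort_perm c a = pos c a :> nat.
Proof. by rewrite permE. Qed.

Lemma pos_surj c (k : nat) : (k < n)%N -> exists a, pos c a = k.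
Proof.
by move=> kn; exists ((sort_perm c)^-1%g (Ordinal kn)); rewrite -sort_permE permKV.
Qed.

Lemma csorted_sort c : csorted (cact (sort_perm c) c).
Proof.
apply/csortedP => x y; rewrite !ffunE.
rewrite -{1}(permKV (sort_perm c) x) -{1}(permKV (sort_perm c) y).
move: (_ x) (_ y) => {}x {}y; rewrite !sort_permE leqNgt pos_lt.
by rewrite /lex_lt -val_eqE /=; lia.
Qed.

Lemma pos_sorted c a : csorted c -> pos c a = a.
Proof.
move=> /csortedP cS; rewrite -[RHS](@card_lt_ord n a) 1?ltnW //.
congr #|pred_of_set _|; apply/setP => x; rewrite !inE /lex_lt -val_eqE /=.
by have := cS x a; have := cS a x; lia.
Qed.

(** For a sorted c, these are the minimal length representatives of the cosets of
    the stabilizer of c. *)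
Definition cmono w c := forall x y, c x = c y -> (x < y)%N -> (w x < w y)%N.

Lemma cmono_lt w c x y : cmono w c -> c x = c y -> (w x < w y)%N = (x < y)%N.
Proof.
move=> wc xy; apply/idP/idP => [|/wc->//]; apply: contraTT; rewrite -!leqNgt.
rewrite leq_eqVlt => /orP[/eqP/val_inj->//|/wc yx].
by apply: ltnW; apply: yx.
Qed.

(** Sorting c and sorting its image under w give the same word, since w keeps
    the order of the letters of each colour. *)
Lemma pos_perm w c a : cmono w c -> pos (cact w c) (w a) = pos c a.
Proof.
move=> wc; rewrite /pos -[RHS](card_imset _ (@perm_inj _ w)); congr #|pred_of_set _|.
apply/setP => x; rewrite inE -[x](permKV w) mem_imset ?inE; last exact: perm_inj.
move: (_ x) => {}x; rewrite /lex_lt !cact_perm.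
by have [xa|] := eqVneq (c x) (c a); rewrite ?(cmono_lt wc xa).
Qed.

Lemma cmono_simple c i : c (lo i) != c (hi i) -> cmono (simple i) c.
Proof.
move=> ci x y xy lt_xy; apply: simple_mono => //; apply: contra ci.
by move=> /andP[/eqP<- /eqP<-]; rewrite xy.
Qed.

Lemma pos_simple c i a : c (lo i) != c (hi i) ->
  pos (cact (simple i) c) (simple i a) = pos c a.
Proof. by move=> ci; apply/pos_perm/cmono_simple. Qed.

Lemma pos_hi c i : c (lo i) = c (hi i) -> pos c (hi i) = (pos c (lo i)).+1.
Proof.
move=> ci; rewrite /pos.
rewrite (_ : [set x | lex_lt c x (hi i)] =
    lo i |: [set x | lex_lt c x (lo i)]); last first.
  apply/setP => x; rewrite !inE /lex_lt -ci; have [->|] := eqVneq x (lo i).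
    by rewrite eqxx /= ltnSn orbT.
  by rewrite -!val_eqE /=; lia.
by rewrite cardsU1 inE lex_lt_irr.
Qed.

Definition content c (j : 'I_N) : nat := #|[set a | c a == j]|.

Lemma content_cact w c j : content (cact w c) j = content c j.
Proof.
rewrite /content -[RHS](card_imset _ (@perm_inj _ w)); congr #|pred_of_set _|.
apply/setP => x; rewrite inE -[x](permKV w) mem_imset ?inE; last exact: perm_inj.
by rewrite cact_perm.
Qed.

Lemma card_colours_lt c (j : nat) :
  #|[set a | (c a < j)%N]| = (\sum_(l < N | (l < j)%N) content c l)%N.
Proof.
rewrite -sum1dep_card (partition_big c (fun l : 'I_N => (l < j)%N)) //=.
apply: eq_bigr => l lj; rewrite sum1dep_card; congr #|pred_of_set _|.
by apply/setP => a; rewrite !inE; have [->|] := eqVneq (c a) l; rewrite ?lj ?andbF.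
Qed.

(** In a sorted colouring the letters of colour less than j come first. *)
Lemma csorted_lt c a (j : nat) : csorted c ->
  (c a < j)%N = (a < \sum_(l < N | (l < j)%N) content c l)%N.
Proof.
move=> /csortedP cS; rewrite -card_colours_lt -down_card ?inE // => x y xy.
by rewrite !inE; apply: leq_ltn_trans; apply: cS.
Qed.

Lemma csorted_uniq c c' : csorted c -> csorted c' -> content c =1 content c' -> c = c'.
Proof.
move=> cS cS' cc'; apply/ffunP => a; apply: val_inj.
have lt j : (c a < j)%N = (c' a < j)%N.
  by rewrite !csorted_lt //; congr (_ < _)%N; apply: eq_bigr => l _; rewrite cc'.
by have := lt (c a).+1; have := lt (c' a).+1; rewrite /=; lia.
Qed.

Definition rank c a : nat := #|[set x | (c x == c a) && (x < a)%N]|.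

Lemma pos_rank c a : pos c a = (\sum_(l < N | (l < c a)%N) content c l + rank c a)%N.
Proof.
rewrite -card_colours_lt /pos /rank.
rewrite (_ : [set x | lex_lt c x a] =
   [set x | (c x < c a)%N] :|: [set x | (c x == c a) && (x < a)%N]); last first.
  by apply/setP => x; rewrite !inE.
rewrite cardsU (_ : _ :&: _ = finset.set0) ?cards0 ?subn0 //; apply/setP => x.
by rewrite !inE -val_eqE /=; lia.
Qed.

Lemma rank_lt c a : (rank c a < content c (c a))%N.
Proof.
apply/proper_card/properP; split; last by exists a; rewrite !inE ?ltnn ?andbF.
by apply/fintype.subsetP => x; rewrite !inE => /andP[].
Qed.

End Colourings.

(** * Sorting words and the braid relations *)

Section BraidWords.
Variables (n : nat) (B : pzRingType) (f : 'I_n.-1 -> B).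
Hypothesis f_far : forall i k : 'I_n.-1, (i.+1 < k)%N -> f i * f k = f k * f i.
Hypothesis f_braid : forall i k : 'I_n.-1, k = i.+1 :> nat ->
  f i * f k * f i = f k * f i * f k.
Local Notation pr ws := (\prod_(i <- ws) f i).

(** The theorem of Matsumoto for minimal coset representatives, proved as a diamond
    lemma. If two sorting words of c start with different swaps i and k, then
    either i and k are far apart and each can follow the other, or
    they are neighbours and c has three decreasing colours in a row, which
    both i k i and k i k reverse. In both cases the two words are compared with
    words that agree after these swaps. *)
Lemma sorts_uniq N (c : {ffun 'I_n -> 'I_N}) ws ws' : sorts c ws -> sorts c ws' ->
  size ws = size ws' /\ pr ws = pr ws'.
Proof.
have [m] := ubnP (disorder c); elim: m c ws ws' => // m IH c ws ws'; rewrite ltnS => cm.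
case: ws ws' => [|i u] [|i' u'] //=.
- by move=> cS /andP[ci' _]; have := @csorted_descent _ _ c i' cS; rewrite ci'.
- by move=> /andP[ci _] cS; have := @csorted_descent _ _ c i cS; rewrite ci.
wlog ii' : i i' u u' / (i <= i')%N => [wl|].
  have [le_ii'|/ltnW le_i'i] := leqP i i'; first exact: wl.
  by move=> gi gi'; have [-> ->] := wl _ _ _ _ le_i'i gi' gi.
move=> /andP[ci gu] /andP[ci' gu'].
have IHd k v v' : descent c k -> sorts (cact (simple k) c) v ->
    sorts (cact (simple k) c) v' -> size v = size v' /\ pr v = pr v'.
  by move=> ck; apply: IH; apply: leq_trans cm; apply: disorder_descent.
move: ii'; rewrite leq_eqVlt => /orP[/eqP/val_inj ii'|].
  by move: gu'; rewrite -ii' !big_cons => /(IHd _ _ _ ci gu)[-> ->].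
rewrite leq_eqVlt => /orP[/eqP ii'|ii'].
  have bE : hi i = lo i' by apply: val_inj.
  have lo_out : simple i' (lo i) = lo i by apply: simple_out; rewrite /=; lia.
  have hi_out : simple i (hi i') = hi i' by apply: simple_out; rewrite /=; lia.
  have e1 : simple i (lo i') = lo i by rewrite -bE simple_hi.
  have e2 : simple i' (hi i) = hi i' by rewrite bE simple_lo.
  (* s_i s_k s_i = s_k s_i s_k, so the words k i x and i k x both continue. *)
  have [x gx] := sorts_exists (cact (simple i * simple i' * simple i) c).
  have gx' := gx; rewrite simple_braid // in gx'.
  have g1 : sorts (cact (simple i) c) [:: i', i & x].
    rewrite /= !cactM ?mulgA gx andbT /descent -!cactM !cact_simple.
    rewrite e1 e2 lo_out hi_out simple_lo.
    by move: ci ci'; rewrite /descent -bE => ci ci'; apply/andP; split; lia.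
  have g2 : sorts (cact (simple i') c) [:: i, i' & x].
    rewrite /= !cactM ?mulgA gx' andbT /descent -!cactM !cact_simple.
    rewrite hi_out simple_hi e1 lo_out e2 -bE.
    by move: ci ci'; rewrite /descent -bE => ci ci'; apply/andP; split; lia.
  have [s1 p1] := IHd _ _ _ ci gu g1; have [s2 p2] := IHd _ _ _ ci' gu' g2.
  rewrite !big_cons s1 s2 p1 p2 !big_cons !mulrA; split=> //.
  by rewrite f_braid.
have [x gx] := sorts_exists (cact (simple i * simple i') c).
have gx' := gx; rewrite simple_far // in gx'.
have out (k : 'I_n) : (k == i' :> nat) || (k == i'.+1 :> nat) -> simple i k = k.
  by move=> ki'; apply: simple_out; lia.
have out' (k : 'I_n) : (k == i :> nat) || (k == i.+1 :> nat) -> simple i' k = k.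
  by move=> ki'; apply: simple_out; lia.
have g1 : sorts (cact (simple i) c) (i' :: x).
  by rewrite /= cactM gx andbT /descent !cact_simple !out ?eqxx ?orbT.
have g2 : sorts (cact (simple i') c) (i :: x).
  by rewrite /= cactM gx' andbT /descent !cact_simple !out' ?eqxx ?orbT.
have [s1 p1] := IHd _ _ _ ci gu g1; have [s2 p2] := IHd _ _ _ ci' gu' g2.
rewrite !big_cons s1 s2 p1 p2 !big_cons !mulrA; split=> //.
by rewrite f_far.
Qed.

(** If i and i+1 have the same colour, sorting moves them together to l and l+1,
    and f i slides along: a swap far from i commutes with f i, and a letter that
    passes across both i and i+1 contributes two swaps, on which f i acts by the
    braid relation. *)
Lemma sorts_commute N (c : {ffun 'I_n -> 'I_N}) ws (i l : 'I_n.-1) :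
  sorts c ws -> c (lo i) = c (hi i) -> l = pos c (lo i) :> nat ->
  f i * pr ws = pr ws * f l.
Proof.
have [m] := ubnP (disorder c); elim: m c ws i => // m IH c ws i; rewrite ltnS => cm.
have IHd (v : {ffun 'I_n -> 'I_N}) (k : 'I_n.-1) : (disorder v < disorder c)%N ->
    forall u, sorts v u -> v (lo k) = v (hi k) ->
    l = pos v (lo k) :> nat -> f k * pr u = pr u * f l.
  by move=> vc u; apply: IH; apply: leq_trans cm.
case: ws => [|k u].
  move=> cS _; rewrite pos_sorted // => li; have -> : l = i by apply: val_inj.
  by rewrite !big_nil mulr1 mul1r.
move=> gku ci lP; have /andP[ck gu] := gku.
have ckn : c (lo k) != c (hi k) by move: ck; rewrite /descent -val_eqE /=; lia.
have ck1 := disorder_descent ck.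
have [ik|ik] := ltnP i.+1 k.
  have out (x : 'I_n) : (x == i :> nat) || (x == i.+1 :> nat) -> simple k x = x.
    by move=> xi; apply: simple_out; lia.
  rewrite !big_cons mulrA f_far // -!mulrA; congr (_ * _).
  apply: (IHd (cact (simple k) c)) => //.
    by rewrite !cact_simple !out ?eqxx ?orbT.
  by rewrite -(out (lo i)) ?eqxx // pos_simple.
have [ki|ki] := ltnP k.+1 i.
  have out (x : 'I_n) : (x == i :> nat) || (x == i.+1 :> nat) -> simple k x = x.
    by move=> xi; apply: simple_out; lia.
  rewrite !big_cons mulrA -f_far // -!mulrA; congr (_ * _).
  apply: (IHd (cact (simple k) c)) => //.
    by rewrite !cact_simple !out ?eqxx ?orbT.
  by rewrite -(out (lo i)) ?eqxx // pos_simple.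
have ik' : i <> k :> nat by move=> /val_inj ik'; move: ckn; rewrite -ik' ci eqxx.
have {ik ki ik'} [ik|ki] : k = i.+1 :> nat \/ i = k.+1 :> nat by lia.
- have bE : hi i = lo k by apply: val_inj.
  have lo_out : simple k (lo i) = lo i by apply: simple_out; rewrite /=; lia.
  have hi_out : simple i (hi k) = hi k by apply: simple_out; rewrite /=; lia.
  have di : descent (cact (simple k) c) i.
    by move: ck; rewrite /descent !cact_simple lo_out bE simple_lo ci bE.
  have cin : cact (simple k) c (lo i) != cact (simple k) c (hi i).
    by move: di; rewrite /descent -val_eqE /=; lia.
  have [x gx] := sorts_exists (cact (simple i) (cact (simple k) c)).
  have [|_ ->] := sorts_uniq gku (_ : sorts c [:: k, i & x]); first by rewrite /= ck di.
  rewrite !big_cons !mulrA f_braid // -!mulrA; do 2!congr (_ * _).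
  apply: (IHd (cact (simple i) (cact (simple k) c))) => //.
  + by apply: ltn_trans ck1; apply: disorder_descent.
  + by rewrite !cact_simple -bE simple_hi lo_out hi_out simple_hi ci bE.
  + by rewrite lP -(pos_simple _ ckn) lo_out -(pos_simple _ cin) simple_lo bE.
have bE : hi k = lo i by apply: val_inj.
have lo_out : simple i (lo k) = lo k by apply: simple_out; rewrite /=; lia.
have hi_out : simple k (hi i) = hi i by apply: simple_out; rewrite /=; lia.
have di : descent (cact (simple k) c) i.
  by move: ck; rewrite /descent !cact_simple hi_out -bE simple_hi -ci bE.
have cin : cact (simple k) c (lo i) != cact (simple k) c (hi i).
  by move: di; rewrite /descent -val_eqE /=; lia.
have [x gx] := sorts_exists (cact (simple i) (cact (simple k) c)).
have [|_ ->] := sorts_uniq gku (_ : sorts c [:: k, i & x]); first by rewrite /= ck di.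
rewrite !big_cons !mulrA -f_braid // -!mulrA; do 2!congr (_ * _).
apply: (IHd (cact (simple i) (cact (simple k) c))) => //.
+ by apply: ltn_trans ck1; apply: disorder_descent.
+ by rewrite !cact_simple lo_out simple_lo bE simple_lo hi_out.
+ by rewrite lP -bE -(pos_simple _ ckn) simple_hi -(pos_simple _ cin) lo_out.
Qed.

End BraidWords.

(** * Reduced words *)

Section ReducedWords.
Variable n : nat.
Implicit Types (w : 'S_n) (ws : seq 'I_n.-1).

Lemma csorted_perm w : csorted (finfun w) -> w = 1%g.
Proof.
move=> wS; apply/permP => a; rewrite perm1; apply: val_inj.
suff cE : content (finfun w) =1 content (finfun (1%g : 'S_n)).
  have S1 : csorted (finfun (1%g : 'S_n)).
    by apply/csortedP => x y; rewrite !ffunE !perm1.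
  by have /ffunP/(_ a) := csorted_uniq wS S1 cE; rewrite !ffunE perm1 => ->.
have c1 v j : content (finfun (v : 'S_n)) j = 1%N.
  rewrite /content -(cards1 (v^-1%g j)); congr #|pred_of_set _|.
  by apply/setP => x; rewrite !inE ffunE -(can2_eq (permK v) (permKV v)).
by move=> j; rewrite !c1.
Qed.

Lemma reduced_cons w i ws : reduced w (i :: ws) -> reduced (w * simple i)%g ws.
Proof.
have sK : (simple i * simple i)%g = 1%g by apply: tperm2.
move=> [/= <- wm]; rewrite -mulgA sK mulg1; split=> // ws' ws'P.
by apply: (wm (i :: ws')); rewrite /= ws'P.
Qed.

(** If the first letter i of a reduced word of w did not swap a descent of w^-1,
    then i would be a descent for the permutation that the rest of the word
    sorts. A sorting word of that permutation that starts with i has the length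
    of the rest, by [sorts_uniq], and without the letter i it is a word of w
    that is too short. *)
Lemma reduced_sorts w ws : reduced w ws -> sorts (finfun (w^-1)%g) ws.
Proof.
elim: ws w => [|i ws IH] w wr.
  by case: wr => /= <- _; apply/csortedP => x y; rewrite !ffunE invg1 !perm1.
have gw := IH _ (reduced_cons wr).
have cE : cact (simple i) (finfun (w^-1)%g) = finfun ((w * simple i)^-1)%g.
  by apply/ffunP => a; rewrite !ffunE invMg permM.
have -> : sorts (finfun (w^-1)%g) (i :: ws) = descent (finfun (w^-1)%g) i.
  by rewrite /= cE gw andbT.
apply/negPn/negP => wi; case: wr => [_ wm].
have di : descent (finfun ((w * simple i)^-1)%g) i.
  move: wi; rewrite /descent -cE !cact_simple simple_lo simple_hi !ffunE -leqNgt.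
  by rewrite leq_eqVlt => /orP[/eqP/val_inj/perm_inj/(congr1 val)/=|//]; lia.
have [x gx] := sorts_exists (finfun (w^-1)%g).
have gix : sorts (finfun ((w * simple i)^-1)%g) (i :: x).
  by rewrite /= di -cE cactK.
(* Only the lengths of the words matter here, so the operators are trivial. *)
have [sz _] := sorts_uniq (B := int) (f := fun=> 1)
  (fun _ _ _ => erefl) (fun _ _ _ => erefl) gw gix.
have xw : word_perm x = w.
  have := sorts_sorted gx; set v := word_perm x.
  have -> : cact v^-1 (finfun (w^-1)%g) = finfun (v * w^-1)%g.
    by apply/ffunP => a; rewrite !ffunE invgK permM.
  by move=> /csorted_perm vw; rewrite -[v](mulgKV w) vw mul1g.
by have := wm _ xw; rewrite /= sz /=; lia.
Qed.

(** When w is increasing on each colour, no swap in a reduced word of w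
    exchanges two letters of one colour, so each descent of w^-1 remains a
    descent of the colours. *)
Lemma sorts_block N w ws (c : {ffun 'I_n -> 'I_N}) : csorted c -> cmono w c ->
  sorts (finfun (w^-1)%g) ws -> sorts (cact w c) ws.
Proof.
move=> cS; have cP := csortedP _ cS; elim: ws w => [|i ws IH] w wc /=.
  by move=> /csorted_perm w1; rewrite -[w]invgK w1 invg1 cact1.
have cE : cact (simple i) (finfun (w^-1)%g) = finfun ((w * simple i)^-1)%g.
  by apply/ffunP => a; rewrite !ffunE invMg permM.
rewrite cE cactM => /andP[wi gw].
have ci : c (w^-1%g (hi i)) != c (w^-1%g (lo i)).
  apply/eqP => ci; move: wi; rewrite /descent !ffunE => /(wc _ _ ci).
  by rewrite !permKV /=; lia.
rewrite IH ?andbT //.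
  move: wi; rewrite /descent !ffunE => /ltnW/cP.
  by rewrite leq_eqVlt => /orP[/eqP/val_inj/eqP|//]; rewrite (negPf ci).
move=> x y xy lt_xy; rewrite !permM; apply: simple_mono; first exact: wc.
apply: contra ci => /andP[/eqP xi /eqP yi]; rewrite -xi -yi !permK xy.
exact: eqxx.
Qed.

Lemma reduced_wordP w : reduced w (reduced_word w).
Proof.
rewrite /reduced_word; case: xgetP => [ws -> //|abs].
have [ws0 ws0P] : exists ws, word_perm ws = w.
  have [ws gws] := sorts_exists (finfun (w^-1)%g); exists ws.
  have := sorts_sorted gws; set v := word_perm ws.
  have -> : cact v^-1 (finfun (w^-1)%g) = finfun (v * w^-1)%g.
    by apply/ffunP => a; rewrite !ffunE invgK permM.
  by move=> /csorted_perm vw; rewrite -[v](mulgKV w) vw mul1g.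
pose Q m := `[< exists ws, word_perm ws = w /\ size ws = m >].
have Qex : exists m, Q m by exists (size ws0); apply/asboolP; exists ws0.
have := ex_minnP Qex; case=> m /asboolP[ws [wsP <-]] wm.
by case: (abs ws); split=> // ws' ws'P; apply: wm; apply/asboolP; exists ws'.
Qed.

Lemma reduced_word_simple i : reduced_word (simple i) = [:: i] :> seq 'I_n.-1.
Proof.
have [ws wm] := reduced_wordP (simple i).
have /wm : word_perm [:: i] = simple i by rewrite /= mul1g.
case: (reduced_word _) ws => [|k [|//]] /=.
  move=> /(congr1 (fun v : 'S_n => val (v (lo i)))) /=.
  by rewrite perm1 simple_lo /=; lia.
by rewrite mul1g => /simple_inj-> _.
Qed.

End ReducedWords.

(** * The base ring *)

Section BaseRingFacts.
Variable X : setting.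
Local Notation n := (sn X).
Local Notation b := (sb X).
Local Notation A := (A X).
Local Notation K := (Kbar X).

(** The base ring is a subring of a field. *)
Lemma A_mulf_eq0 (x y : A) : x * y = 0 -> x != 0 -> y = 0.
Proof.
move=> /(congr1 val)/eqP; rewrite rmorphM rmorph0 /= mulf_eq0 => /orP[/eqP x0|/eqP y0].
  by case/eqP; apply: val_inj.
by move=> _; apply: val_inj.
Qed.

Lemma inA_q : qK X \in @inA X.
Proof. by apply/inAP => S [_ [[]]]. Qed.

Lemma qK_neq0 : qK X != 0.
Proof. by rewrite fmorph_eq0 tofrac_eq0 polyC_eq0 polyX_eq0. Qed.

Lemma inA_qV : (qK X)^-1 \in @inA X.
Proof.
apply/inAP => S [_ [_ [_ _ [_ [v Sv bv]] _]]].
suff -> : (qK X)^-1 = v by [].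
by apply: (mulfI qK_neq0); rewrite bv mulfV ?qK_neq0.
Qed.

Definition qinvA : A := toA (qK X)^-1.

Lemma toAK z : z \in @inA X -> \val (toA z : A) = z.
Proof. by move=> zA; rewrite /toA val_insubd zA. Qed.

Lemma qinvAE : qA X * qinvA = 1.
Proof.
apply: val_inj; rewrite rmorphM rmorph1 -[LHS]/(\val (qA X) * \val qinvA).
by rewrite (toAK inA_q) (toAK inA_qV) mulfV ?qK_neq0.
Qed.

Lemma zetaK_val : \val (zetaA X) = zetaK X.
Proof. exact/toAK/inA_zeta. Qed.

Lemma zetaC_of_K k : zetaK X ^+ k = 1 -> zetaC X ^+ k = 1.
Proof.
rewrite /zetaK -(rmorphXn (iotaK X)) -(rmorph1 (iotaK X)) => /fmorph_inj.
have <- : tofrac ((zetaC X)%:P%:P ^+ k) = tofrac (zetaC X)%:P%:P ^+ k.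
  exact: rmorphXn.
rewrite -tofrac1 => /eqP; rewrite tofrac_eq => /eqP.
by rewrite -!polyC_exp -!polyC1 => /polyC_inj/polyC_inj.
Qed.

Lemma zetaK_prim : b.-primitive_root (zetaK X).
Proof.
have zb : zetaK X ^+ b = 1.
  by rewrite -zetaK_val -rmorphXn zetaA_pow rmorph1.
apply/andP; split; first exact: sb_gt0.
apply/forallP => i; apply/eqP; rewrite unity_rootE; apply/eqP/eqP => [|-> //].
move/zetaC_of_K/eqP; rewrite -(prim_order_dvd (zetaC_prim X)).
by move=> /(dvdn_leq (ltn0Sn i)) bi; apply/eqP; rewrite eqn_leq ltn_ord bi.
Qed.

Lemma zetaA_inj (i j : 'I_b) : zetaA X ^+ i.+1 = zetaA X ^+ j.+1 -> i = j.
Proof.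
move/(congr1 val); rewrite !rmorphXn /= zetaK_val => /eqP.
rewrite (eq_prim_root_expr zetaK_prim) -(addn1 i) -(addn1 j) eqn_modDr.
by rewrite !modn_small // => /eqP/val_inj.
Qed.

Lemma epsA_sqr : epsA X * epsA X = 1.
Proof.
have e : (b ^ 2 - b = b * (b - 1))%N by rewrite mulnBr muln1 mulnn.
rewrite /epsA -exprD addnn -muln2 e divnK; first by rewrite exprM zetaA_pow expr1n.
by rewrite dvdn2 oddM oddB ?sb_gt0 //; case: (odd b).
Qed.

(** For x = zeta^s and y = zeta^t this is the scalar by which E_i acts on a
    weight vector. *)
Lemma geometric_sum0 (x y : A) : x ^+ b = 1 -> y ^+ b = 1 -> x != y ->
  \sum_(k < b) x ^+ k * y ^+ (b - k)%N = 0.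
Proof.
move=> xb yb xy; have yx : y - x != 0 by rewrite subr_eq0 eq_sym.
apply: A_mulf_eq0 yx; transitivity (y * (y ^+ b - x ^+ b)); last first.
  by rewrite xb yb subrr mulr0.
rewrite subrXX mulrCA; congr (_ * _); rewrite mulr_sumr; apply: eq_bigr => k _.
rewrite mulrA -exprS mulrC; congr (_ ^+ _ * _).
by have := ltn_ord k; lia.
Qed.

End BaseRingFacts.

(** * Relations of the algebra with parameters q and a *)

Section HeckeRelations.
Variable X : setting.
Local Notation n := (sn X).
Local Notation b := (sb X).
Local Notation A := (A X).
Local Notation H := (Hring X).
Local Notation inH := (bcalg_in (ZqaA X) (B := Hbn b n)).
Implicit Types (i k : 'I_n.-1) (j : 'I_n).

(** The algebra is an extension of scalars of a presented algebra; this combines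
    the induction principles of both presentations. *)
Lemma H_ind (Q : H -> Prop) :
  (forall j, Q (HT j)) -> (forall i, Q (HR i)) -> (forall c, Q (algc c)) ->
  (forall u v, Q u -> Q v -> Q (u + v)) -> (forall u, Q u -> Q (- u)) ->
  (forall u v, Q u -> Q v -> Q (u * v)) -> forall u, Q u.
Proof.
move=> QT QR Qc Qa Qo Qm; apply: palg_ind => // u.
rewrite -[palg_gen _ _]/(inH u); elim/palg_ind: u => [[j|i]|c|u v Qu Qv|u Qu|u v Qu Qv].
- exact: QT.
- exact: QR.
- by rewrite bcalg_in_algc.
- by rewrite rmorphD; apply: Qa.
- by rewrite rmorphN; apply: Qo.
- by rewrite rmorphM; apply: Qm.
Qed.

Lemma aeval_pow (R : comPzRingType) (B : pzAlgType R) (G : Type) (g : G -> B)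
  t (m : nat) :
  aeval g (t ^+ m)%AT = aeval g t ^+ m.
Proof.
elim: m => [|m IH]; first by rewrite expr0 /= rmorph1.
by rewrite exprS -IH.
Qed.

Lemma aeval_sum (R : comPzRingType) (B : pzAlgType R) (G : Type) (g : G -> B)
  (I : Type) (r : seq I) (F : I -> aterm R G) :
  aeval g (\big[@AAdd R G/AConst 0]_(i <- r) F i) = \sum_(i <- r) aeval g (F i).
Proof.
elim: r => [|i r IH]; first by rewrite !big_nil /= rmorph0.
by rewrite !big_cons /= IH.
Qed.

Lemma HTR j i : HT j * HR i = HR i * HT (simple i j).
Proof.
rewrite /HT /HR -!bcalg_inM; congr inH.
exact: (palg_relE (H_TR b j i)).
Qed.

Lemma HR_far i k : (i.+1 < k)%N -> HR i * HR k = HR k * HR i.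
Proof.
move=> ik; rewrite /HR -!bcalg_inM; congr inH.
have h : (i.+1 < k)%N || (k.+1 < i)%N by rewrite ik.
exact: (palg_relE (H_RR b h)).
Qed.

Lemma HR_braid i k : k = i.+1 :> nat -> HR i * HR k * HR i = HR k * HR i * HR k.
Proof.
move=> ik; rewrite /HR -!bcalg_inM; congr inH.
exact: (palg_relE (H_RRR b ik)).
Qed.

Lemma ZqaA_q : ZqaA X Zq = qA X.
Proof. by rewrite /ZqaA /= map_polyC /= map_polyX /horner_eval hornerC hornerX. Qed.
Lemma ZqaA_a : ZqaA X Za = aA X.
Proof. by rewrite /ZqaA /= map_polyX /horner_eval hornerX. Qed.

Lemma HR_sqr i : HR i * HR i = algc (qA X) +
  algc (aA X) * HT (lo i) ^+ ((b ^ 2 - b) %/ 2)%N *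
  (\sum_(k < b) HT (lo i) ^+ k * HT (hi i) ^+ (b - k)%N) * HR i.
Proof.
rewrite {1 2}/HR -bcalg_inM.
have := palg_relE (H_RR2 b i); rewrite /= aeval_pow aeval_sum => ->.
rewrite rmorphD !rmorphM rmorphXn rmorph_sum /= !bcalg_in_algc ZqaA_q ZqaA_a.
congr (_ + _ * _ * _); apply: eq_bigr => k _.
by rewrite /= !aeval_pow rmorphM !rmorphXn.
Qed.

Lemma tW_simple i : tW (simple i) = HR i.
Proof. by rewrite /tW reduced_word_simple big_seq1. Qed.

End HeckeRelations.

(** * Weight spaces *)

Section WeightSpaces.
Variable X : setting.
Local Notation n := (sn X).
Local Notation b := (sb X).
Local Notation A := (A X).
Local Notation H := (Hring X).
Local Notation D := (D X).
Local Notation col := {ffun 'I_n -> 'I_b}.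
Implicit Types (i k : 'I_n.-1) (j : 'I_n) (c : col) (d : D) (w : 'S_n).

Definition chi c : {ffun D -> A} := chi_of (X := X) (fun j => (c j).+1).

Lemma chi_char c : is_char (chi c). Proof. exact: chi_of_char. Qed.

Lemma charW_chi w c : charW w (chi c) = chi (cact w c).
Proof.
apply/ffunP => d; rewrite !ffunE; congr (_ ^+ _).
rewrite [RHS](reindex_inj (@perm_inj _ w)) /=; apply: eq_bigr => j _.
by rewrite !ffunE permK.
Qed.

(** The diagonal matrix with zeta at j and 1 elsewhere. The exponent 1 is reduced
    modulo b, which matters for b = 1. *)
Definition unitD j : D := [ffun j' => if j' == j then inord (1 %% b)%N else 0].

Lemma unitD_val j : unitD j j = (1 %% b)%N :> nat.
Proof. by rewrite ffunE eqxx inordK // sbK ltn_mod sb_gt0. Qed.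

Lemma expr_mod1 (R : pzSemiRingType) (x : R) : x ^+ b = 1 -> x ^+ (1 %% b)%N = x.
Proof. by move=> xb; rewrite (expr_mod _ xb) expr1. Qed.

Lemma chi_unit c j : chi c (unitD j) = zetaA X ^+ (c j).+1.
Proof.
rewrite ffunE (bigD1 j) //= big1 => [|j' /negPf jj']; last first.
  by rewrite ffunE jj' /= muln0.
by rewrite addn0 unitD_val mulnC exprM expr_mod1 ?zetaA_pow.
Qed.

(** Multiplication with psi(d) does not change the sum of a character psi over D,
    and psi(d) - 1 is not a zero divisor for some d when psi is nontrivial. *)
Lemma chi_orthogonal c c' : c != c' -> \sum_(d : D) chi c (- d) * chi c' d = 0.
Proof.
move=> /eqP cc'; have [j cj] : exists j, c j != c' j.
  by apply/existsP; apply: contra_notT cc' => /existsPn h; apply/ffunP => j;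
     apply/eqP; move: (h j); rewrite negbK.
pose psi (d : D) := chi c (- d) * chi c' d.
have [chi0 chiD] := chi_char c; have [chi0' chiD'] := chi_char c'.
have psiD d d' : psi (d + d') = psi d * psi d'.
  by rewrite /psi opprD chiD chiD' mulrACA.
apply: (@A_mulf_eq0 X (psi (unitD j) - 1)); last first.
  apply: contra cj; rewrite subr_eq0 => /eqP psi1; apply/eqP/zetaA_inj.
  rewrite -!chi_unit -[RHS]mul1r -chi0 -(subrr (unitD j)) chiD -mulrA.
  by rewrite -[X in _ * X]/(psi _) psi1 mulr1.
rewrite mulrBl mul1r mulr_sumr [X in _ - X](reindex_inj (addrI (unitD j))) /=.
by rewrite -sumrB big1 // => d _; rewrite -/(psi d) -/(psi _) psiD subrr.
Qed.

Variable V : lmodType H.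
Implicit Types v u : V.

(** The weight space of chi c, as a joint eigenspace of the generators T_j of the
    diagonal part. *)
Definition wt c v := forall j, HT j *: v = algc (zetaA X ^+ (c j).+1) *: v.

Lemma wt0 c : wt c 0.
Proof. by move=> j; rewrite !scaler0. Qed.
Lemma wtD c u v : wt c u -> wt c v -> wt c (u + v).
Proof. by move=> uc vc j; rewrite !scalerDr uc vc. Qed.
Lemma wtZ c a v : wt c v -> wt c ((algc a : H) *: v).
Proof.
by move=> vc j; rewrite scalerA -algc_central -scalerA vc !scalerA -!rmorphM mulrC.
Qed.

Lemma wt_HTX c v j (m : nat) :
  wt c v -> HT j ^+ m *: v = algc (zetaA X ^+ ((c j).+1 * m)%N) *: v.
Proof.
move=> vc; elim: m => [|m IH]; first by rewrite muln0 !expr0 rmorph1.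
rewrite exprS -scalerA IH scalerA -algc_central -scalerA vc scalerA -rmorphM -exprD.
by rewrite mulnS addnC.
Qed.

Lemma wt_tD c v d : wt c v -> tD d *: v = algc (chi c d) *: v.
Proof.
move=> vc; rewrite /tD ffunE; elim: (index_enum _) => [|j r IH].
  by rewrite !big_nil expr0 rmorph1.
rewrite !big_cons -scalerA IH scalerA -algc_central -scalerA (wt_HTX _ _ vc) scalerA.
by rewrite -rmorphM -exprD addnC.
Qed.

Lemma eD_wt c c' v : wt c' v ->
  eD (chi c) *: v = algc (binvA X ^+ n * \sum_(d : D) chi c (- d) * chi c' d) *: v.
Proof.
move=> vc; rewrite rmorphM rmorph_sum -!scalerA; congr (_ *: _).
rewrite !scaler_suml; apply: eq_bigr => d _.
by rewrite rmorphM -!scalerA (wt_tD _ vc).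
Qed.

Lemma eD_wt_id c v : wt c v -> eD (chi c) *: v = v.
Proof.
move=> vc; rewrite (eD_wt c vc) (eq_bigr (fun=> 1)) => [|d _].
  rewrite sumr_const card_ffun !card_ord sbK natrX -exprMn mulrC binvAE.
  by rewrite expr1n rmorph1 scale1r.
have [chi0 chiD] := chi_char c.
by rewrite -chiD addNr.
Qed.

Lemma eD_wt_neq c c' v : c != c' -> wt c' v -> eD (chi c) *: v = 0.
Proof.
by move=> cc' vc; rewrite (eD_wt c vc) chi_orthogonal // mulr0 rmorph0 scale0r.
Qed.

Lemma HT_unit j : HT j = tD (unitD j).
Proof.
rewrite /tD; have bigj (r : seq 'I_n) : uniq r ->
    \prod_(j' <- r) HT j' ^+ unitD j j' = if j \in r then HT j else 1.
  elim: r => [|j' r IH] /=; first by rewrite big_nil.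
  move=> /andP[j'r ur]; rewrite big_cons IH // inE eq_sym.
  have [jj'|jj'] := eqVneq j' j.
    by rewrite -jj' (negPf j'r) unitD_val expr_mod1 ?HT_pow ?mulr1.
  by rewrite ffunE (negPf jj') expr0 mul1r.
by rewrite bigj ?mem_index_enum ?index_enum_uniq.
Qed.

Lemma in_weightP c v : in_weight (chi c) v <-> wt c v.
Proof.
split=> [[u ->] j|vc]; last by exists v; rewrite eD_wt_id.
have [chi0 chiD] := chi_char c.
rewrite !scalerA; congr (_ *: _); rewrite HT_unit -chi_unit /eD /ascale.
have algcCA (h u' : H) a : h * (algc a * u') = algc a * (h * u').
  by rewrite !mulrA algc_central.
rewrite !(algcCA _ _ (binvA X ^+ n)); congr (_ * _).
rewrite !mulr_sumr [RHS](reindex_inj (addrI (unitD j))) /=.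
apply: eq_bigr => d _; rewrite algcCA -tD_add mulrA -rmorphM.
by rewrite -chiD opprD addNKr.
Qed.

Lemma wt_HR c i v : wt c v -> wt (cact (simple i) c) (HR i *: v).
Proof.
move=> vc j; rewrite scalerA HTR -scalerA vc scalerA -algc_central -scalerA.
by rewrite cact_simple.
Qed.

(** E_i acts on a vector of weight s_i c as a sum of the powers of a b-th root of
    unity different from 1, and the term with E_i disappears from the quadratic
    relation. *)
Lemma HR_HR_wt c i v : wt c v -> c (lo i) != c (hi i) ->
  HR i *: (HR i *: v) = algc (qA X) *: v.
Proof.
move=> vc ci; rewrite scalerA HR_sqr scalerDl -!scalerA; set u := HR i *: v.
have uc : wt (cact (simple i) c) u by apply: wt_HR.
have -> : (\sum_(k < b) HT (lo i) ^+ k * HT (hi i) ^+ (b - k)%N) *: u = 0.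
  pose x := zetaA X ^+ (c (hi i)).+1; pose y := zetaA X ^+ (c (lo i)).+1.
  rewrite scaler_suml.
  rewrite (eq_bigr (fun k : 'I_b => algc (x ^+ k * y ^+ (b - k)%N) *: u)) => [|k _].
    rewrite -scaler_suml -rmorph_sum geometric_sum0 ?rmorph0 ?scale0r //.
    - by rewrite /x exprAC zetaA_pow expr1n.
    - by rewrite /y exprAC zetaA_pow expr1n.
    - by apply: contra ci => /eqP/zetaA_inj->.
  rewrite -scalerA (wt_HTX _ _ uc) scalerA -algc_central -scalerA (wt_HTX _ _ uc).
  rewrite scalerA -rmorphM !cact_simple simple_lo simple_hi mulrC.
  by rewrite /x /y -!exprM.
by rewrite !scaler0 addr0.
Qed.

Lemma wt_word c ws v : sorts c ws -> wt (cact (word_perm ws)^-1 c) v ->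
  wt c ((\prod_(i <- ws) HR i) *: v).
Proof.
elim: ws c => [|i ws IH] c /=; first by rewrite invg1 cact1 big_nil scale1r.
move=> /andP[_ gws]; rewrite invMg -cactM simpleV => vc.
rewrite big_cons -scalerA -[c](cactK i); exact/wt_HR/IH.
Qed.

(** Along a sorting word each factor R_i acts between weight spaces on which R_i^2
    is q, so the whole product is inverted by the reversed word, up to a power
    of q. *)
Lemma wt_word_inv c ws : sorts c ws -> exists h : H,
  (forall v, wt c v -> wt (cact (word_perm ws)^-1 c) (h *: v) /\
                       (\prod_(i <- ws) HR i) *: (h *: v) = v) /\
  (forall v, wt (cact (word_perm ws)^-1 c) v ->
     h *: ((\prod_(i <- ws) HR i) *: v) = v).
Proof.
have qK v : algc (qinvA X) *: ((algc (qA X) : H) *: v) = v.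
  by rewrite scalerA -rmorphM mulrC qinvAE rmorph1 scale1r.
elim: ws c => [|i ws IH] c /=.
  by exists 1; rewrite invg1 cact1 big_nil; split=> v vc; rewrite !scale1r.
move=> /andP[ci gws]; have [h [h1 h2]] := IH _ gws.
have ci' : c (lo i) != c (hi i).
  by move: ci; rewrite /descent; case: eqVneq => // ->; rewrite ltnn.
have ci'' : cact (simple i) c (lo i) != cact (simple i) c (hi i).
  by rewrite !cact_simple simple_lo simple_hi eq_sym.
rewrite invMg -cactM simpleV big_cons.
exists (h * algc (qinvA X) * HR i); split=> v vc; rewrite -!scalerA.
  have [] := h1 ((algc (qinvA X) : H) *: (HR i *: v)).
    exact/wtZ/wt_HR.
  move=> hv hvE; split=> //; rewrite hvE scalerA -algc_central -scalerA.
  by rewrite (HR_HR_wt vc ci') qK.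
by rewrite (HR_HR_wt (wt_word gws vc) ci'') qK h2.
Qed.

End WeightSpaces.

(** * Products along sorting words *)

Section SortingProducts.
Variable X : setting.
Local Notation n := (sn X).
Local Notation b := (sb X).
Local Notation H := (Hring X).
Local Notation col := {ffun 'I_n -> 'I_b}.
Implicit Types (c : col) (i l : 'I_n.-1).

Definition sorting_word c : seq 'I_n.-1 := xget [::] [set ws | sorts c ws]%classic.

Lemma sorting_wordP c : sorts c (sorting_word c).
Proof.
rewrite /sorting_word; case: xgetP => [ws -> //|abs].
by have [ws wsP] := sorts_exists c; case: (abs ws).
Qed.

(** The element t_w, where w is the minimal length element that takes the sorted
    colouring to c. *)
Definition tword c : H := \prod_(i <- sorting_word c) HR i.

Lemma twordE c ws : sorts c ws -> \prod_(i <- ws) HR i = tword c.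
Proof.
move=> gws.
by have [_ ->] := sorts_uniq (@HR_far X) (@HR_braid X) gws (sorting_wordP c).
Qed.

Lemma tword_sorted c : csorted c -> tword c = 1.
Proof. by move=> cS; rewrite -(@twordE c [::]) ?big_nil. Qed.

Lemma tword_descent c i : descent c i -> tword c = HR i * tword (cact (simple i) c).
Proof.
move=> ci; rewrite -(@twordE c (i :: sorting_word (cact (simple i) c))) ?big_cons //.
by rewrite /= ci sorting_wordP.
Qed.

Lemma HR_tword c i l : c (lo i) = c (hi i) -> l = pos c (lo i) :> nat ->
  HR i * tword c = tword c * HR l.
Proof.
move=> ci li.
exact: (sorts_commute (@HR_far X) (@HR_braid X) (sorting_wordP c) ci li).
Qed.

Lemma tW_cact c w : csorted c -> cmono w c -> tW w = tword (cact w c).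
Proof.
move=> cS cw; apply: twordE; apply: sorts_block => //.
exact/reduced_sorts/reduced_wordP.
Qed.

End SortingProducts.

(** * The orbit of a block *)

Section BlockColouring.
Variables (X : setting) (al : 'I_(sb X) -> nat).
Local Notation n := (sn X).
Local Notation b := (sb X).
Local Notation col := {ffun 'I_n -> 'I_b}.

(** The list that defines chi_alpha repeats the colours in increasing order, with
    multiplicities alpha. *)
Lemma block_colouring : (\sum_j al j)%N = n ->
  exists c0 : col, [/\ csorted c0, content c0 =1 al & chi_al al = chi c0].
Proof.
move=> al_n; pose s := flatten [seq nseq (al j) j | j <- enum 'I_b].
have sE : al_seq al = [seq (val j).+1 | j <- s].
  rewrite /s /al_seq map_flatten; congr flatten; rewrite -[RHS]map_comp.
  by apply: eq_map => j; rewrite /= map_nseq.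
have szs : size s = n.
  rewrite size_flatten /shape sumnE 2!big_map -al_n big_enum /=.
  by apply: eq_bigr => j _; rewrite size_nseq.
pose x0 := Ordinal (sb_gt0 X).
pose c0 : col := [ffun i : 'I_n => nth x0 s i].
have cnt j : count_mem j s = al j.
  rewrite /s count_flatten sumnE 2!big_map big_enum /= (bigD1 j) //=.
  rewrite count_nseq /= eqxx mul1n.
  rewrite big1 ?addn0 // => j' jj'; rewrite count_nseq /= eq_sym.
  by rewrite eq_sym (negPf jj').
have spw : pairwise (fun x y : 'I_b => (x <= y)%N) s.
  have : pairwise (fun x y : 'I_b => (x < y)%N) (enum 'I_b).
    have := iota_ltn_sorted 0 b; rewrite -val_enum_ord sorted_map sorted_pairwise //.
    by move=> x y z /= yx xz; apply: ltn_trans xz.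
  rewrite /s; elim: (enum 'I_b) => //= j r IH /andP[/allP jr /IH pr].
  rewrite pairwise_cat pr andbT; apply/andP; split.
    apply/allrelP => x y /nseqP[-> _] /flattenP[t /mapP[j' j'r ->]] /nseqP[-> _].
    exact/ltnW/jr.
  by elim: (al j) => //= m ->; rewrite andbT all_nseq /= leqnn orbT.
exists c0; split.
- apply/csortedP => x y; rewrite !ffunE leq_eqVlt => /orP[/eqP/val_inj->//|xy].
  by move/(pairwiseP x0): spw; apply; rewrite ?inE ?szs.
- move=> j; rewrite /content -cnt -sum1_count (big_nth x0) szs big_mkord -sum1dep_card.
  by apply: eq_bigl => i; rewrite ffunE.
apply/ffunP => d; rewrite !ffunE; congr (_ ^+ _); apply: eq_bigr => i _.
by rewrite ffunE sE (nth_map x0) // szs.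
Qed.

Variable c0 : col.
Hypotheses (c0S : csorted c0) (c0al : content c0 =1 al) (chi0 : chi_al al = chi c0).

Lemma mbar_content (c : col) : content c =1 al ->
  forall j : nat, mbar al j = (\sum_(l < b | (l < j)%N) content c l)%N.
Proof. by move=> cal j; apply: eq_bigr => l _; rewrite cal. Qed.

Lemma in_blockE j i : in_block al j i = (c0 i == j).
Proof.
rewrite /in_block !(mbar_content c0al) leqNgt -!csorted_lt // -val_eqE /= ltnS.
by rewrite -leqNgt eqn_leq andbC.
Qed.

Lemma inWal_cmono w : inWal al w <-> cmono w c0.
Proof.
split=> [h x y xy|h j x y]; last first.
  by rewrite !in_blockE => /eqP xj /eqP yj; apply: h; rewrite xj yj.
by apply: (h (c0 x)); rewrite in_blockE ?xy.
Qed.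

Lemma sorted_block (c : col) : csorted c -> content c =1 al -> c = c0.
Proof. by move=> cS cal; apply: csorted_uniq => // j; rewrite cal c0al. Qed.

(** Sorting c is the action of a permutation. *)
Lemma orbit_perm (c : col) : content c =1 al -> exists w, c = cact w c0.
Proof.
move=> cal; exists (sort_perm c)^-1%g.
rewrite -[c0](@sorted_block (cact (sort_perm c) c)).
- by rewrite cactM mulgV cact1.
- exact: csorted_sort.
- by move=> j; rewrite content_cact.
Qed.

Lemma word_block (c : col) ws :
  content c =1 al -> sorts c ws -> cact (word_perm ws)^-1 c = c0.
Proof.
by move=> cal /sorts_sorted cS; apply: sorted_block => // j; rewrite content_cact.
Qed.

Lemma orbit_alP f : reflect (exists2 c, content c =1 al & f = chi c) (f \in orbit_al al).
Proof.
rewrite mem_undup; apply: (iffP mapP) => [[w _ ->]|[c cal ->]].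
  by exists (cact w c0) => [j|]; rewrite ?content_cact // chi0 charW_chi.
have [w cw] := orbit_perm cal; exists w; first by rewrite mem_enum.
by rewrite chi0 charW_chi cw.
Qed.

Variable V : lmodType (Hring X).

Lemma e_al_wt (c : col) (v : V) : content c =1 al -> wt c v -> e_al al *: v = v.
Proof.
move=> cal vc; rewrite /e_al scaler_suml.
have chiO : chi c \in orbit_al al by apply/orbit_alP; exists c.
rewrite (bigD1_seq (chi c)) ?undup_uniq //= eD_wt_id // big_seq_cond big1 ?addr0 //.
move=> f /andP[/orbit_alP[c' _ ->] cc']; apply: eD_wt_neq vc.
by apply: contraNneq cc' => ->.
Qed.

Definition has_content (c : col) : bool := [forall j, content c j == al j].

Lemma has_contentP (c : col) : reflect (content c =1 al) (has_content c).
Proof. by apply: (iffP forallP) => h j; apply/eqP/h. Qed.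

Definition wt_sum (v : V) : Prop := exists x : col -> V,
  (forall c, wt c (x c)) /\ v = \sum_(c | has_content c) x c.

Lemma wt_sum0 : wt_sum 0.
Proof. by exists (fun=> 0); split=> [c|]; [exact: wt0 | rewrite big1]. Qed.

Lemma wt_sumD u v : wt_sum u -> wt_sum v -> wt_sum (u + v).
Proof.
move=> [x [xw ->]] [y [yw ->]]; exists (fun c => x c + y c); split=> [c|].
  exact: wtD.
by rewrite big_split.
Qed.

Lemma wt_sum_wt (c : col) v : has_content c -> wt c v -> wt_sum v.
Proof.
move=> cO vc; exists (fun c' => if c' == c then v else 0); split=> [c'|].
  by case: eqP => [->|_]; [exact: vc | exact: wt0].
rewrite (bigD1 c) //= eqxx big1 ?addr0 // => c' /andP[_ /negPf->//].
Qed.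

Lemma wt_sumZ h v : wt_sum v -> wt_sum (h *: v).
Proof.
elim/H_ind: h v => [j|i|a|h h' IH IH'|h IH|h h' IH IH'] v vw.
- case: vw => x [xw ->]; rewrite scaler_sumr; apply: (big_ind wt_sum).
  + exact: wt_sum0.
  + exact: wt_sumD.
  + by move=> c cO; apply: (wt_sum_wt cO); rewrite xw; apply: wtZ.
- case: vw => x [xw ->]; rewrite scaler_sumr; apply: (big_ind wt_sum).
  + exact: wt_sum0.
  + exact: wt_sumD.
  + move=> c cO; apply: (@wt_sum_wt (cact (simple i) c)); last exact: wt_HR.
    by apply/has_contentP => j; rewrite content_cact; apply/has_contentP.
- case: vw => x [xw ->]; rewrite scaler_sumr; apply: (big_ind wt_sum).
  + exact: wt_sum0.
  + exact: wt_sumD.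
  + by move=> c cO; apply: (wt_sum_wt cO); apply: wtZ.
- by rewrite scalerDl; apply: wt_sumD; [apply: IH | apply: IH'].
- have [x [xw hx]] := IH _ vw; exists (fun c => - x c); split=> [c|].
    by move=> j; rewrite !scalerN xw.
  by rewrite scaleNr hx sumrN.
- by rewrite -scalerA; apply/IH/IH'.
Qed.

Lemma wt_sum_eD v : wt_sum v -> v = \sum_(c | has_content c) eD (chi c) *: v.
Proof.
move=> [x [xw ->]]; apply: eq_bigr => c cO; rewrite scaler_sumr (bigD1 c) //=.
rewrite eD_wt_id // big1 ?addr0 // => c' /andP[_ cc'].
by apply: eD_wt_neq (xw c'); rewrite eq_sym.
Qed.

Lemma wt_sum_e_al v : wt_sum v -> e_al al *: v = v.
Proof.
move=> [x [xw ->]]; rewrite scaler_sumr; apply: eq_bigr => c /has_contentP cO.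
exact: e_al_wt (xw c).
Qed.

Lemma wt_tword (c : col) (v : V) : content c =1 al -> wt c0 v -> wt c (tword c *: v).
Proof.
move=> cal vc; apply: wt_word (sorting_wordP c) _.
by rewrite (word_block cal) // sorting_wordP.
Qed.

Lemma tword_inv (c : col) : content c =1 al -> exists h,
  (forall v : V, wt c v -> wt c0 (h *: v) /\ tword c *: (h *: v) = v) /\
  (forall v : V, wt c0 v -> h *: (tword c *: v) = v).
Proof.
move=> cal; have [h] := wt_word_inv V (sorting_wordP c).
by rewrite (word_block cal (sorting_wordP c)); exists h.
Qed.

End BlockColouring.

(** * Tableaux *)

Section TableauBasics.
Variables (J : finType) (m : nat) (sh : J -> seq nat).
Implicit Types (t : tableau J m).

Lemma is_tableauP t : reflect [/\ injective t, forall i, in_shape sh (t i)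
    & forall z, in_shape sh z -> exists i, t i = z] (is_tableau sh t).
Proof.
apply: (iffP and3P) => [[/injectiveP ti /forallP ts /forallP tz]|[ti ts tz]]; split=> //.
- by move=> z zs; have /implyP/(_ zs)/existsP[i /eqP] := tz z; exists i.
- exact/injectiveP.
- exact/forallP.
- apply/forallP => z; apply/implyP => /tz[i iz]; apply/existsP; exists i.
  exact/eqP.
Qed.

Definition increasing t := forall i i', tcomp t i = tcomp t i' ->
  (trow t i = trow t i' -> (tcol t i < tcol t i')%N -> (i < i')%N) /\
  (tcol t i = tcol t i' -> (trow t i < trow t i')%N -> (i < i')%N).

Lemma is_standardP t : reflect (is_tableau sh t /\ increasing t) (is_standard sh t).
Proof.
apply: (iffP andP) => [[ti /forallP h]|[ti h]]; split=> //.
  move=> i i' ii'; have /forallP/(_ i')/implyP := h i.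
  move=> /(_ (introT eqP ii'))/andP[/implyP h1 /implyP h2].
  split=> e lt; [apply: h1 | apply: h2]; by rewrite e eqxx.
apply/forallP => i; apply/forallP => i'; apply/implyP => /eqP/h[h1 h2].
by apply/andP; split; apply/implyP => /andP[/eqP]; [apply: h1 | apply: h2].
Qed.

Lemma is_tableau_tact w t : is_tableau sh t -> is_tableau sh (tact w t).
Proof.
move=> /is_tableauP[ti ts tz]; apply/is_tableauP; split.
- by move=> x y; rewrite !ffunE => /ti/perm_inj.
- by move=> i; rewrite ffunE.
- by move=> z /tz[i iz]; exists (w i); rewrite ffunE permK.
Qed.

Lemma tcomp_tact w t a : tcomp (tact w t) a = tcomp t (w^-1%g a).
Proof. by rewrite /tcomp ffunE. Qed.
Lemma trow_tact w t a : trow (tact w t) a = trow t (w^-1%g a).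
Proof. by rewrite /trow ffunE. Qed.
Lemma tcol_tact w t a : tcol (tact w t) a = tcol t (w^-1%g a).
Proof. by rewrite /tcol ffunE. Qed.

End TableauBasics.

Lemma nth_sumn (s : seq nat) r : (nth 0 s r <= sumn s)%N.
Proof.
elim: s r => [|x s IH] [|r] //=; first exact: leq_addr.
exact: leq_trans (IH r) (leq_addl _ _).
Qed.

Lemma size_sumn (s : seq nat) : 0%N \notin s -> (size s <= sumn s)%N.
Proof.
elim: s => //= x s IH; rewrite inE negb_or => /andP[x0 /IH]; lia.
Qed.

Lemma sum_nth_sumn (s : seq nat) n : (size s <= n)%N ->
  (\sum_(r < n) nth 0%N s r = sumn s)%N.
Proof.
move=> sn; rewrite sumnE (big_nth 0%N) big_mkord [RHS](big_ord_widen n (nth 0%N s)) //.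
rewrite [RHS]big_mkcond /=. apply: eq_bigr => r _; case: ltnP => // rs.
by rewrite nth_default.
Qed.

(** * Standardization of the components of a tableau *)

Section Standardization.
Variables (b n : nat) (lam : 'I_b -> seq nat).
Hypothesis lamP : is_bpartition n lam.
Local Notation m := (bsize lam).
Local Notation tab := (tableau 'I_b n).
Local Notation col := {ffun 'I_n -> 'I_b}.
Implicit Types (t : tab) (j : 'I_b) (a : 'I_n).

Lemma sum_bsize : (\sum_j m j)%N = n.
Proof. by case/andP: lamP => _ /eqP. Qed.

Lemma bsize_le j : (m j <= n)%N.
Proof. by rewrite -sum_bsize (bigD1 j) //= leq_addr. Qed.

(** A partition of m without zero parts has its diagram inside an m by m square;
    here this bounds the coordinates in component j by the size of that
    component. *)
Lemma part_lt j (r c : nat) : (c < nth 0 (lam j) r)%N -> (r < m j)%N /\ (c < m j)%N.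
Proof.
move=> cr; split; last exact: leq_trans cr (nth_sumn _ _).
case/andP: lamP => /forallP/(_ j)/andP[_ /size_sumn szm] _.
apply: leq_trans szm; rewrite ltnNge; apply: contraTN cr => rs.
by rewrite nth_default.
Qed.

Definition ctab t : col := [ffun i => tcomp t i].

Lemma ctab_tact w t : ctab (tact w t) = cact w (ctab t).
Proof. by apply/ffunP => i; rewrite !ffunE /tcomp ffunE. Qed.

Lemma inSYT0E (t : SYT n lam) : inSYT0 t = csorted (ctab (\val t)).
Proof.
by apply: eq_forallb => i; apply: eq_forallb => i'; rewrite !ffunE.
Qed.

(** Through the filling, the entries of component j correspond to the boxes of
    the j-th diagram. *)
Lemma content_ctab t : is_tableau lam t -> content (ctab t) =1 m.
Proof.
move=> /is_tableauP[ti ts tz] j.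
have -> : content (ctab t) j = #|[set p : 'I_n * 'I_n | (p.2 < nth 0 (lam j) p.1)%N]|.
  rewrite /content -(card_in_imset (f := fun a => (t a).2)); last first.
    move=> x y; rewrite !inE !ffunE => /eqP xj /eqP yj xy; apply: ti.
    rewrite [LHS]surjective_pairing [RHS]surjective_pairing xy; congr pair.
    by rewrite -/(tcomp t x) xj -yj.
  congr #|pred_of_set _|; apply/setP => p; rewrite inE; apply/imsetP/idP => [[a]|pj].
    by rewrite inE ffunE => /eqP aj ->; have := ts a; rewrite /in_shape -/(tcomp t a) aj.
  have [a aP] := tz (j, p) pj; exists a; last by rewrite aP.
  by rewrite inE ffunE /tcomp aP.
rewrite -sum1dep_card.
rewrite -(pair_big_dep xpredT (fun r c : 'I_n => (c < nth 0 (lam j) r)%N)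
  (fun _ _ => 1%N)) /=.
rewrite (eq_bigr (fun r : 'I_n => nth 0 (lam j) r)%N) => [|r _].
  rewrite sum_nth_sumn //; case/andP: lamP => /forallP/(_ j)/andP[_ /size_sumn szm] _.
  exact: leq_trans szm (bsize_le j).
rewrite sum1dep_card card_lt_ord //; apply: leq_trans (nth_sumn _ _) (bsize_le j).
Qed.

(** The letters of smaller colours occupy the first places after sorting. *)
Lemma pos_colour (c : col) a (j : nat) :
  (c a < j)%N = (pos c a < \sum_(l < b | (l < j)%N) content c l)%N.
Proof.
rewrite -(cact_perm (sort_perm c) c a) csorted_lt ?csorted_sort // sort_permE.
by congr (_ < _)%N; apply: eq_bigr => l _; rewrite content_cact.
Qed.

Lemma rank_inj (c : col) x y : c x = c y -> rank c x = rank c y -> x = y.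
Proof. by move=> xy r; apply: (@pos_inj _ _ c); rewrite !pos_rank xy r. Qed.

Lemma rank_surj (c : col) j (l : nat) : (l < content c j)%N ->
  exists a, c a = j /\ rank c a = l.
Proof.
move=> lj.
have Sj : (\sum_(k < b | (k < j.+1)%N) content c k =
    \sum_(k < b | (k < j)%N) content c k + content c j)%N.
  rewrite (bigD1 j) //= addnC; congr (_ + _)%N; apply: eq_bigl => k.
  by rewrite -val_eqE /=; lia.
have ln : (\sum_(k < b | (k < j)%N) content c k + l < n)%N.
  apply: (@leq_trans (\sum_(k < b | (k < j.+1)%N) content c k)).
    by rewrite Sj ltn_add2l.
  by rewrite -card_colours_lt -[X in (_ <= X)%N]card_ord max_card.
have [a aP] := pos_surj c ln.
have aj : c a = j.
  apply: val_inj; have := pos_colour c a j; have := pos_colour c a j.+1.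
  by rewrite aP Sj /=; lia.
by exists a; split=> //; move: aP; rewrite pos_rank aj => /addnI.
Qed.

Lemma rank_pos (c c' : col) (x y : 'I_n) : content c =1 content c' -> c x = c' y ->
  pos c x = pos c' y -> rank c x = rank c' y.
Proof.
move=> cc' xy; rewrite !pos_rank xy.
by rewrite (eq_bigr (content c')) => [/addnI|l _ //].
Qed.

(** The entry of rank l among the entries of component j becomes the entry l. The
    coordinates are known to be small enough only for tableaux; the default
    values l only serve to make the definition total. *)
Definition std t j : tableau unit (m j) :=
  [ffun l : 'I_(m j) =>
     if [pick a : 'I_n | (ctab t a == j) && (rank (ctab t) a == l :> nat)] is Some a
             then (tt, (insubd l (val (trow t a)), insubd l (val (tcol t a))))
             else (tt, (l, l))].

Lemma stdP t j a (l : 'I_(m j)) : is_tableau lam t -> tcomp t a = j ->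
  rank (ctab t) a = l ->
  trow (std t j) l = trow t a :> nat /\ tcol (std t j) l = tcol t a :> nat.
Proof.
move=> /is_tableauP[_ ts _] aj al; rewrite /trow /tcol ffunE.
have ca : ctab t a = j by rewrite ffunE.
case: pickP => [a' /andP[/eqP a'j /eqP a'l]|/(_ a)]; last by rewrite ca al !eqxx.
have -> : a' = a by apply: (@rank_inj (ctab t)); rewrite ?a'j ?a'l.
have [r_lt c_lt] := part_lt (ts a).
move: r_lt c_lt; rewrite -/(tcomp t a) aj => r_lt c_lt.
by rewrite /= !val_insubd r_lt c_lt.
Qed.

Lemma std_slot t j (l : 'I_(m j)) : is_tableau lam t ->
  exists a, [/\ tcomp t a = j, rank (ctab t) a = l
     & trow (std t j) l = trow t a :> nat /\ tcol (std t j) l = tcol t a :> nat].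
Proof.
move=> tt; have lj : (l < content (ctab t) j)%N by rewrite content_ctab.
have [a [aj al]] := rank_surj lj; exists a.
by move: aj; rewrite ffunE => aj; split=> //; apply: stdP.
Qed.

Lemma entry_slot t a : is_tableau lam t ->
  exists l : 'I_(m (tcomp t a)), rank (ctab t) a = l.
Proof.
move=> tt; have ra : (rank (ctab t) a < m (tcomp t a))%N.
  by have := rank_lt (ctab t) a; rewrite (content_ctab tt) ffunE.
by exists (Ordinal ra).
Qed.

Lemma tab_ext (J : finType) (k : nat) (z z' : J * ('I_k * 'I_k)) :
  z.1 = z'.1 -> z.2.1 = z'.2.1 :> nat -> z.2.2 = z'.2.2 :> nat -> z = z'.
Proof.
by case: z z' => [x [r c]] [x' [r' c']] /= -> /val_inj-> /val_inj->.
Qed.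

Lemma std_tableau t j : is_tableau lam t -> is_tableau (fun _ : unit => lam j) (std t j).
Proof.
move=> tT; have [ti ts tz] := is_tableauP _ _ tT; apply/is_tableauP; split.
- move=> l l' ll'; have [a [aj al [ar ac]]] := std_slot l tT.
  have [a' [a'j a'l [a'r a'c]]] := std_slot l' tT.
  apply: val_inj; rewrite /= -al -a'l; congr rank; apply/ti/tab_ext.
  + by rewrite -/(tcomp t a) -/(tcomp t a') aj a'j.
  + by rewrite -/(trow t a) -/(trow t a') -ar -a'r /trow ll'.
  + by rewrite -/(tcol t a) -/(tcol t a') -ac -a'c /tcol ll'.
- move=> l; have [a [aj al [ar ac]]] := std_slot l tT.
  by have := ts a; rewrite /in_shape -/(trow t a) -/(tcol t a) -ar -ac -/(tcomp t a) aj.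
- move=> [u [r c]] rc.
  have [a aP] := tz (j, (widen_ord (bsize_le j) r, widen_ord (bsize_le j) c)) rc.
  have aj : tcomp t a = j by rewrite /tcomp aP.
  have [l al] := entry_slot a tT; move: l al; rewrite aj => l al; exists l.
  have [lr lc] := stdP tT aj al; apply: tab_ext; first by case: (_.1); case: u {rc aP}.
    by rewrite -[LHS]/(nat_of_ord (trow (std t j) l)) lr /trow aP.
  by rewrite -[LHS]/(nat_of_ord (tcol (std t j) l)) lc /tcol aP.
Qed.

Lemma rank_mono (c : col) x y : c x = c y -> (rank c x < rank c y)%N = (x < y)%N.
Proof.
move=> xy; have := pos_lt c x y; rewrite !pos_rank xy ltn_add2l => ->.
by rewrite /lex_lt xy ltnn eqxx.
Qed.

(** Being standard only compares entries of the same component, and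
    standardization preserves their order. *)
Lemma standard_std t : is_tableau lam t ->
  is_standard lam t = [forall j, is_standard (fun _ : unit => lam j) (std t j)].
Proof.
move=> tT; apply/is_standardP/forallP => [[_ inc] j|h].
  apply/is_standardP; split; first exact: std_tableau.
  move=> l l' _; have [a [aj al [ar ac]]] := std_slot l tT.
  have [a' [a'j a'l [a'r a'c]]] := std_slot l' tT.
  have [h1 h2] := inc a a' (etrans aj (esym a'j)).
  have e : (a < a')%N = (l < l')%N.
    by rewrite -al -a'l rank_mono // !ffunE aj a'j.
  split=> /(congr1 val)/=; rewrite -e ?ar ?ac ?a'r ?a'c => rr.
    by apply: h1; apply: val_inj.
  by apply: h2; apply: val_inj.
split=> // a a' aa'; have [l al] := entry_slot a tT; have [l' a'l] := entry_slot a' tT.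
move: l' a'l; rewrite -aa' => l' a'l.
have [lr lc] := stdP tT erefl al; have [l'r l'c] := stdP tT (esym aa') a'l.
have /is_standardP[_ inc] := h (tcomp t a).
have [//|h1 h2] := inc l l'; first by case: (tcomp _ _); case: (tcomp _ _).
have e : (a < a')%N = (l < l')%N.
  by rewrite -al -a'l rank_mono // !ffunE aa'.
rewrite e -lr -l'r -lc -l'c; split=> /(congr1 val)/= rr.
  by apply: h1; apply: val_inj; rewrite /= lr l'r.
by apply: h2; apply: val_inj; rewrite /= lc l'c.
Qed.

Lemma std_inj t t' : is_tableau lam t -> is_tableau lam t' -> ctab t = ctab t' ->
  (forall j, std t j = std t' j) -> t = t'.
Proof.
move=> tT tT' cc' ss'; apply/ffunP => a.
have aa' : tcomp t a = tcomp t' a by have /ffunP/(_ a) := cc'; rewrite !ffunE.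
have [l al] := entry_slot a tT; have [lr lc] := stdP tT erefl al.
have a'l := al; rewrite cc' in a'l.
have [l'r l'c] := stdP tT' (esym aa') a'l.
apply: tab_ext => //.
  by rewrite -[LHS]/(nat_of_ord (trow t a)) -lr ss' l'r.
by rewrite -[LHS]/(nat_of_ord (tcol t a)) -lc ss' l'c.
Qed.

Lemma std_ext t j (s : tableau unit (m j)) : is_tableau lam t ->
  (forall a (l : 'I_(m j)), tcomp t a = j -> rank (ctab t) a = l ->
     trow s l = trow t a :> nat /\ tcol s l = tcol t a :> nat) -> std t j = s.
Proof.
move=> tT h; apply/ffunP => l; have [a [aj al [ar ac]]] := std_slot l tT.
have [sr sc] := h a l aj al; apply: tab_ext; first by case: (_.1); case: (_.1).
  by rewrite -[LHS]/(nat_of_ord (trow (std t j) l)) ar -sr.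
by rewrite -[LHS]/(nat_of_ord (tcol (std t j) l)) ac -sc.
Qed.

Lemma std_tact_mono w t j : is_tableau lam t -> cmono w (ctab t) ->
  std (tact w t) j = std t j.
Proof.
move=> tT wt; apply: std_ext => [|a l aj al]; first exact: is_tableau_tact.
have aE : a = w (w^-1%g a) by rewrite permKV.
move: aj al; rewrite tcomp_tact trow_tact tcol_tact aE permK.
set x := (w^-1%g a) => xj xl.
apply: (stdP tT xj); rewrite -xl ctab_tact; apply/esym/rank_pos.
- by move=> k; rewrite content_cact.
- exact: cact_perm.
- exact: pos_perm.
Qed.

Section SameColour.
Variables (t : tab) (i : 'I_n.-1) (j : 'I_b) (l : 'I_(m j).-1).
Hypotheses (tT : is_tableau lam t) (loj : tcomp t (lo i) = j).
Hypotheses (hij : tcomp t (hi i) = j) (li : rank (ctab t) (lo i) = l).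

Lemma ctab_tact_same : ctab (tact (simple i) t) = ctab t.
Proof.
rewrite ctab_tact; apply/ffunP => a; rewrite cact_simple !ffunE.
have [->|al] := eqVneq a (lo i); first by rewrite simple_lo loj hij.
have [->|ah] := eqVneq a (hi i); first by rewrite simple_hi loj hij.
by rewrite simple_out.
Qed.

Lemma rank_hi : rank (ctab t) (hi i) = l.+1.
Proof.
have cc : ctab t (lo i) = ctab t (hi i) by rewrite !ffunE loj hij.
by have := pos_hi cc; rewrite !pos_rank cc -addnS => /addnI; rewrite li.
Qed.

Lemma std_lo : trow (std t j) (lo l) = trow t (lo i) :> nat /\
  tcol (std t j) (lo l) = tcol t (lo i) :> nat.
Proof. exact: stdP. Qed.
Lemma std_hi : trow (std t j) (hi l) = trow t (hi i) :> nat /\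
  tcol (std t j) (hi l) = tcol t (hi i) :> nat.
Proof. by apply: stdP => //; rewrite rank_hi. Qed.

Lemma axial_std : axial (std t j) (hi l) (lo l) = axial t (hi i) (lo i).
Proof.
by have [lr lc] := std_lo; have [hr hc] := std_hi; rewrite /axial lr lc hr hc.
Qed.

(** Two consecutive entries of component j have consecutive ranks there, and
    exchanging them exchanges their ranks. *)
Lemma std_tact_same : std (tact (simple i) t) j = tact (simple l) (std t j).
Proof.
have cs x : tcomp t (simple i x) = tcomp t x.
  by have /ffunP/(_ x) := ctab_tact_same; rewrite ctab_tact cact_simple !ffunE.
apply: std_ext => [|a k]; first exact: is_tableau_tact.
rewrite ctab_tact_same tcomp_tact !trow_tact !tcol_tact !simpleV.
move=> aj ak; apply: stdP => //.
have caj : ctab t a = j by rewrite ffunE -cs.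
have clj : ctab t (lo i) = j by rewrite ffunE.
have chj : ctab t (hi i) = j by rewrite ffunE.
have [al|al] := eqVneq a (lo i).
  have -> : k = lo l by apply: val_inj; rewrite /= -ak al.
  by rewrite al !simple_lo rank_hi.
have [ah|ah] := eqVneq a (hi i).
  have -> : k = hi l by apply: val_inj; rewrite /= -ak ah rank_hi.
  by rewrite ah !simple_hi.
rewrite [simple i a]simple_out // [simple l k]simple_out //= -ak.
  by apply: contra_neq al; rewrite -li => /rank_inj; apply; rewrite caj.
by apply: contra_neq ah; rewrite -rank_hi => /rank_inj; apply; rewrite caj.
Qed.

Lemma std_tact_other j' : j' != j -> std (tact (simple i) t) j' = std t j'.
Proof.
move=> j'j; apply: std_ext => [|a k]; first exact: is_tableau_tact.
rewrite ctab_tact_same tcomp_tact trow_tact tcol_tact simpleV => aj ak.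
have al : simple i a != lo i by apply: contra j'j => /eqP al; rewrite -aj al loj.
have ah : simple i a != hi i by apply: contra j'j => /eqP ah; rewrite -aj ah hij.
have aa : simple i a = a by rewrite -[RHS](simpleK i) [RHS]simple_out.
rewrite aa in aj *; exact: stdP.
Qed.

End SameColour.

Section Glue.
Variables (c : col) (s : forall j, tableau unit (m j)).
Hypotheses (cm : content c =1 m).
Hypothesis sT : forall j, is_tableau (fun _ : unit => lam j) (s j).

Fact glue_rank a : (rank c a < m (c a))%N.
Proof. by rewrite -cm rank_lt. Qed.

(** The inverse of standardization, for given colours of the letters. *)
Definition glue_tab : tab := [ffun a => (c a,
  (widen_ord (bsize_le (c a)) (trow (s (c a)) (Ordinal (glue_rank a))),
   widen_ord (bsize_le (c a)) (tcol (s (c a)) (Ordinal (glue_rank a)))))].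

Lemma ctab_glue : ctab glue_tab = c.
Proof. by apply/ffunP => a; rewrite ffunE /tcomp ffunE. Qed.

Lemma glueE a j (l : 'I_(m j)) : c a = j -> rank c a = l ->
  trow glue_tab a = trow (s j) l :> nat /\ tcol glue_tab a = tcol (s j) l :> nat.
Proof.
move=> cj; case: j / cj l => l al; rewrite /trow /tcol ffunE /=.
by rewrite (_ : Ordinal _ = l) //; apply: val_inj.
Qed.

Lemma glue_tableau : is_tableau lam glue_tab.
Proof.
have gc a : (glue_tab a).1 = c a by rewrite ffunE.
apply/is_tableauP; split.
- move=> x y xy; have cxy : c x = c y by rewrite -!gc xy.
  have lx := glue_rank x; have ly := glue_rank y; rewrite cxy in lx.
  have [xr xc] := @glueE x _ (Ordinal lx) cxy erefl.
  have [yr yc] := @glueE y _ (Ordinal ly) erefl erefl.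
  have [si _ _] := is_tableauP _ _ (sT (c y)).
  apply: (@rank_inj c) => //.
  suff : Ordinal lx = Ordinal ly by case.
  apply/si/tab_ext; first by case: (_.1); case: (_.1).
    by rewrite -[LHS]xr -[RHS]yr /trow xy.
  by rewrite -[LHS]xc -[RHS]yc /tcol xy.
- move=> a; have [ar ac] := @glueE a _ (Ordinal (glue_rank a)) erefl erefl.
  have [_ ss _] := is_tableauP _ _ (sT (c a)).
  have := ss (Ordinal (glue_rank a)).
  rewrite /in_shape -/(trow (s (c a)) _) -/(tcol (s (c a)) _) -ar -ac.
  by rewrite gc.
- move=> [j [r k]] rk; have /= [rj kj] := part_lt rk.
  have [_ _ sz] := is_tableauP _ _ (sT j).
  have [l lP] := sz (tt, (Ordinal rj, Ordinal kj)) rk.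
  have [a [aj al]] : exists a, c a = j /\ rank c a = l by apply: rank_surj; rewrite cm.
  have [ar ac] := glueE aj al; exists a; apply: tab_ext; first by rewrite gc aj.
    by rewrite -[LHS]/(nat_of_ord (trow glue_tab a)) ar /trow lP.
  by rewrite -[LHS]/(nat_of_ord (tcol glue_tab a)) ac /tcol lP.
Qed.

Lemma std_glue j : std glue_tab j = s j.
Proof.
apply: std_ext => [|a l]; first exact: glue_tableau.
rewrite ctab_glue => aj al; have ca : c a = j by rewrite -aj /tcomp ffunE.
by have [-> ->] := glueE ca al.
Qed.

End Glue.

End Standardization.

(** * The tableau basis of the induced module *)

Section HoefsmitInduced.
Variables (X : setting) (lam : 'I_(sb X) -> seq nat).
Hypothesis lamP : is_bpartition (sn X) lam.
Local Notation n := (sn X).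
Local Notation b := (sb X).
Local Notation A := (A X).
Local Notation H := (Hring X).
Local Notation al := (bsize lam).
Local Notation col := {ffun 'I_n -> 'I_b}.
Local Notation SYTn := (SYT n lam).
Local Notation SYTj := (fun j => SYT (al j) (fun _ : unit => lam j)).
Variables (P : forall j, lmodType (Ihecke X (al j))) (p : forall j, SYTj j -> P j).
Hypothesis pP : forall j, is_hoefsmit (@p j).
Variables (eta : {rmorphism Ial al -> Hal al}) (etaV : {rmorphism Hal al -> Ial al}).
Hypothesis etaP : is_eta eta etaV.
Local Notation P0lam := (P0 etaV P).
Local Notation V := (Vmod etaV P).
Local Notation e := (eD (chi_al al)).
Local Notation idem := (eD_idem (chi_of_char _ : is_char (chi_al al))).
Local Notation SYT_family := {dffun forall j, SYTj j}.

(** [ind_in] on the underlying tensor product, which keeps its own module structure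
    over the tensor product of the Hecke algebras. *)
Definition iota (z : tnmod P) : V := @ind_in _ _ _ idem P0lam z.

Lemma iotaD : {morph iota : z z' / z + z'}.
Proof. exact: raddfD (@ind_in _ _ _ idem P0lam). Qed.
Lemma iota0 : iota 0 = 0.
Proof. exact: raddf0 (@ind_in _ _ _ idem P0lam). Qed.
Lemma iota_inj : injective iota.
Proof. exact: ind_in_inj. Qed.

(** Transports the action of the tensor product of Hecke algebras to the action
    of the corner of H. *)
Lemma iota_eta h z : iota (h *: z) = \val (eta h) *: iota z.
Proof.
rewrite /iota -ind_inZ; congr ind_in.
by rewrite -[RHS]/(etaV (eta h) *: z); case: etaP => -> _ _ _.
Qed.

Lemma iota_scale a z : iota (a *:m z) = a *:m iota z.
Proof.
rewrite /iota /mscale -ind_in_algc; congr ind_in.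
by have -> : algc a = etaV (algc a) by case: etaP => etaK _ <- _; rewrite etaK.
Qed.

Lemma iota_sum (I : Type) (r : seq I) (Q : pred I) (F : I -> tnmod P) :
  iota (\sum_(i <- r | Q i) F i) = \sum_(i <- r | Q i) iota (F i).
Proof. exact: raddf_sum (@ind_in _ _ _ idem P0lam) _ _ _ _. Qed.

Lemma iota_e z : e *: iota z = iota z.
Proof. exact: ind_in_e. Qed.

Lemma SYT_tab (t : SYTn) : is_tableau lam (\val t).
Proof. by have /andP[] := valP t. Qed.

Lemma content_SYT (t : SYTn) : content (ctab (\val t)) =1 al.
Proof. exact: content_ctab (SYT_tab t). Qed.

Fact stdS_subproof (t : SYTn) j :
  is_standard (fun _ : unit => lam j) (std lam (\val t) j).
Proof. by have := valP t; rewrite (standard_std lamP (SYT_tab t)) => /forallP. Qed.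

Definition std_family (t : SYTn) : SYT_family :=
  [ffun j => Sub (std lam (\val t) j) (stdS_subproof t j)].

Lemma std_family_val t j : \val (std_family t j) = std lam (\val t) j.
Proof. by rewrite ffunE. Qed.

Lemma std_family_inj t t' : ctab (\val t) = ctab (\val t') ->
  std_family t = std_family t' -> t = t'.
Proof.
move=> cc ff; apply/val_inj/(std_inj lamP) => //; try exact: SYT_tab.
by move=> j; rewrite -!std_family_val ff.
Qed.

Lemma glueS_exists c (s : SYT_family) : content c =1 al ->
  exists t : SYTn, ctab (\val t) = c /\ std_family t = s.
Proof.
move=> cal; have sT j : is_tableau (fun _ : unit => lam j) (\val (s j)).
  by have /andP[] := valP (s j).
have gT := glue_tableau lamP cal sT.
have gS : is_standard lam (glue_tab lamP (fun j => \val (s j)) cal).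
  rewrite (standard_std lamP gT); apply/forallP => j.
  by rewrite (std_glue lamP cal sT) (valP (s j)).
exists (Sub _ gS); split; first by rewrite /= ctab_glue.
by apply/ffunP => j; apply: val_inj; rewrite std_family_val /= (std_glue lamP cal sT).
Qed.

(** A standard tableau with given colours is the same thing as a family of
    standard tableaux. *)
Lemma sum_fibre (U : nmodType) c (F : SYT_family -> U) : content c =1 al ->
  \sum_(t : SYTn | ctab (\val t) == c) F (std_family t) = \sum_s F s.
Proof.
move=> cal; have [g gP] := choice (fun s => glueS_exists s cal).
rewrite [LHS](reindex_onto g std_family) => [|t /eqP tc]; last first.
  by have [gc gf] := gP (std_family t); apply: std_family_inj; rewrite ?gc ?tc.
apply: eq_big => s; have [gc gf] := gP s; last by rewrite gf.
by rewrite gc gf !eqxx.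
Qed.

Definition vtab (t : SYTn) : V := tword (ctab (\val t)) *: iota (pure p (std_family t)).

Lemma p_basis : is_basis (pure p).
Proof. by apply: pure_basis => j; case: (pP j). Qed.

Lemma tact_std (t : SYTn) w : cmono w (ctab (\val t)) ->
  exists t' : SYTn, [/\ \val t' = tact w (\val t) & std_family t' = std_family t].
Proof.
move=> wt_; have wT := is_tableau_tact w (SYT_tab t).
have wS : is_standard lam (tact w (\val t)).
  rewrite (standard_std lamP wT); apply/forallP => j.
  by rewrite (std_tact_mono lamP) ?stdS_subproof //; apply: SYT_tab.
exists (Sub _ wS); split=> //; apply/ffunP => j; apply: val_inj.
by rewrite !std_family_val /= (std_tact_mono lamP) //; apply: SYT_tab.
Qed.

Lemma ext0_val (t : SYTn) : ext0 vtab (\val t) = vtab t.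
Proof. by rewrite /ext0 valK. Qed.

Lemma tW_vtab_lt (t : SYTn) i : (tcomp (\val t) (lo i) < tcomp (\val t) (hi i))%N ->
  tW (simple i) *: vtab t = ext0 vtab (tact (simple i) (\val t)).
Proof.
move=> ii; rewrite tW_simple.
have [|t' [t'E t'f]] := @tact_std t (simple i).
  by apply: cmono_simple; rewrite !ffunE; apply: contraTneq ii => ->; rewrite ltnn.
rewrite -t'E ext0_val /vtab t'E t'f ctab_tact (@tword_descent _ (cact _ _) i).
  by rewrite cactK scalerA.
by rewrite /descent !cact_simple simple_lo simple_hi !ffunE.
Qed.

(** The sign epsilon^j in the definition of eta is its own inverse. *)
Lemma HR_iota (j : 'I_b) (l : 'I_(al j).-1) (i : 'I_n.-1) z : i = mbar al j + l :> nat ->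
  HR i *: iota z = epsA X ^+ j.+1 *:m iota (tnalg_in (j := j) (hecke_gen _ _ l) *: z).
Proof.
move=> il; rewrite iota_eta; case: etaP => _ _ _ /(_ j l i il)->.
have epsK (v : V) : epsA X ^+ j.+1 *:m (epsA X ^+ j.+1 *:m v) = v.
  by rewrite mscaleA -exprMn epsA_sqr expr1n mscale1.
rewrite /ascale -scalerA -/(mscale _ _) epsK -scalerA.
by rewrite iota_e tW_simple.
Qed.

(** R_i passes through t_w and becomes R_l, which acts in the slot j of the tensor
    product as the l'-th generator of the j-th Hecke algebra, where l' is the
    rank of i in component j. The formula of Hoefsmit applies; the term with s_i
    vanishes exactly when s_i tau is not standard, because only the component j
    is changed. *)
Lemma tW_vtab_eq (t : SYTn) i : tcomp (\val t) (lo i) = tcomp (\val t) (hi i) ->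
  let k := axial (\val t) (hi i) (lo i) in
  let j := tcomp (\val t) (lo i) in
  tW (simple i) *: vtab t = (epsA X ^+ j.+1 * hcoef1 X k) *:m vtab t +
     (epsA X ^+ j.+1 * hcoef2 X k) *:m ext0 vtab (tact (simple i) (\val t)).
Proof.
set j := tcomp _ _ => hij /=; set k := axial _ _ _; set c := ctab (\val t).
have tT := SYT_tab t.
have cc : c (lo i) = c (hi i) by rewrite !ffunE.
have cj : c (lo i) = j by rewrite ffunE.
have rk : (rank c (lo i) < (al j).-1)%N.
  have := rank_lt c (hi i); rewrite -cc cj (content_SYT t).
  have := pos_hi cc; rewrite !pos_rank -cc -addnS => /addnI->; lia.
pose l := Ordinal rk.
have pl : pos c (lo i) = (mbar al j + l)%N.
  by rewrite pos_rank cj (mbar_content (content_SYT t)).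
have pn : (pos c (lo i) < n.-1)%N.
  by have := pos_ltn c (hi i); rewrite pos_hi //; lia.
have hax : axial (std lam (\val t) j) (hi l) (lo l) = k by apply: axial_std.
rewrite tW_simple {1}/vtab scalerA (@HR_tword _ _ _ (Ordinal pn)) // -scalerA.
rewrite (@HR_iota j l) // mscaleC -!mscaleA -mscaleDr; congr (_ *:m _).
rewrite /pure -{1}(dfwith_id (fun j => p (std_family t j)) j) -tngen_dfwithZ.
have [_ /(_ l (std_family t j))] := pP j.
rewrite /= std_family_val hax => ->.
rewrite tngen_dfwithD !tngen_dfwithC dfwith_id iotaD scalerDr !iota_scale !mscaleC.
rewrite -/(pure p (std_family t)) -/(vtab t); congr (_ + _ *:m _).
have sE := standard_std lamP (is_tableau_tact (simple i) tT).
have sj : std lam (tact (simple i) (\val t)) j = tact (simple l) (std lam (\val t) j).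
  exact: std_tact_same.
have sj' j' : j' != j -> std lam (tact (simple i) (\val t)) j' = std lam (\val t) j'.
  by move=> j'j; apply: (std_tact_other lamP (j := j)).
have [st|st] := boolP (is_standard lam (tact (simple i) (\val t))); last first.
  have nst : ~~ is_standard (fun _ : unit => lam j)
      (tact (simple l) (std lam (\val t) j)).
    apply: contra st => st; rewrite sE; apply/forallP => j'.
    have [->|/sj'->] := eqVneq j' j; first by rewrite sj.
    exact: stdS_subproof.
  by rewrite /ext0 !insubN // tngen_dfwith0 iota0 scaler0.
have stj : is_standard (fun _ : unit => lam j) (tact (simple l) (std lam (\val t) j)).
  by move: st; rewrite sE => /forallP/(_ j); rewrite sj.
rewrite /ext0 !insubT /vtab; congr (tword _ *: iota (tngen _)).
  by rewrite /= (ctab_tact_same (j := j)).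
apply: functional_extensionality_dep => j'; have [<-|jj'] := eqVneq j j'.
  by rewrite dfwith_in; congr p; apply: val_inj; rewrite std_family_val /= sj.
rewrite dfwith_out //; congr p; apply: val_inj; rewrite !std_family_val /= sj' //.
by rewrite eq_sym.
Qed.

Lemma chi_tabE (t : tableau 'I_b n) : chi_tab t = chi (ctab t).
Proof.
apply/ffunP => d; rewrite !ffunE; congr (_ ^+ _); apply: eq_bigr => i _.
by rewrite ffunE.
Qed.

Variable c0 : col.
Hypotheses (c0S : csorted c0) (c0al : content c0 =1 al) (chi0 : chi_al al = chi c0).

Lemma wt_iota z : wt c0 (iota z).
Proof. by apply/in_weightP; rewrite -chi0; exists (iota z); rewrite iota_e. Qed.

Lemma wt_iotaP u : wt c0 u -> exists z, u = iota z.
Proof.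
move=> uc; have [z zP] := ind_in_surj u; exists z.
by rewrite -[LHS](eD_wt_id uc) -chi0.
Qed.

(** t_w maps the weight space of chi_alpha onto that of w chi_alpha. *)
Lemma wt_twordP c u : content c =1 al -> wt c u -> exists z, u = tword c *: iota z.
Proof.
move=> cal uc; have [h [h1 _]] := tword_inv c0S c0al V cal.
by have [/wt_iotaP[z zE] hE] := h1 u uc; exists z; rewrite -zE hE.
Qed.

(** The sum of the weight spaces of the orbit is a submodule that contains the
    generators e (x) z. *)
Lemma V_wt_sum (u : V) : wt_sum al u.
Proof.
elim/ind_ind: u => [z||u v uw vw|h u uw].
- by apply: (@wt_sum_wt _ _ _ c0); [apply/has_contentP | apply: wt_iota].
- exact: wt_sum0.
- exact: wt_sumD.
- exact: wt_sumZ.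
Qed.

Lemma wt_vtab t : wt (ctab (\val t)) (vtab t).
Proof. exact: (wt_tword c0S c0al) (content_SYT t) (wt_iota _). Qed.

Lemma wt_span c u : content c =1 al -> wt c u -> exists a : SYT_family -> A,
  u = \sum_(t : SYTn | ctab (\val t) == c) a (std_family t) *:m vtab t.
Proof.
move=> cal /(wt_twordP cal)[z ->]; have [a ->] := p_basis.1 z; exists a.
rewrite iota_sum scaler_sumr -(sum_fibre _ cal); apply: eq_bigr => t /eqP tc.
by rewrite iota_scale mscaleC /vtab tc.
Qed.

(** The weight spaces are separated by the idempotents e_chi, and inside one
    weight space t_w carries the basis of P0 to the vectors v_tau. *)
Lemma vtab_basis : is_basis vtab.
Proof.
split=> [u|a a0 t].
  have /choice[a aP] : forall c : col, exists a : SYT_family -> A, has_content al c ->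
      eD (chi c) *: u = \sum_(t : SYTn | ctab (\val t) == c) a (std_family t) *:m vtab t.
    move=> c; have [cO|] := boolP (has_content al c); last by exists (fun=> 0).
    have [|a aP] := @wt_span c (eD (chi c) *: u) (elimT (has_contentP _ _) cO).
      by apply/in_weightP; exists u.
    by exists a.
  exists (fun t => a (ctab (\val t)) (std_family t)).
  rewrite {1}[u](wt_sum_eD (V_wt_sum u)).
  rewrite (partition_big (fun t : SYTn => ctab (\val t)) (has_content al)) => [|t _] /=.
    by apply: eq_bigr => c /aP->; apply: eq_bigr => t /eqP->.
  exact/has_contentP/content_SYT.
set c := ctab (\val t); have cal : content c =1 al := content_SYT t.
have [g gP] := choice (fun s => glueS_exists s cal).
have ac : \sum_(t' : SYTn | ctab (\val t') == c) a t' *:m vtab t' = 0.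
  transitivity (eD (chi c) *: (\sum_t' a t' *:m vtab t')); last by rewrite a0 scaler0.
  rewrite scaler_sumr [LHS]big_mkcond.
  apply: eq_bigr => t' _; rewrite mscaleC; have [<-|cc'] := eqVneq.
    by rewrite eD_wt_id //; apply: wt_vtab.
  rewrite (@eD_wt_neq _ _ _ (ctab (\val t'))) ?mscaler0 //; last exact: wt_vtab.
  by rewrite eq_sym.
have [h [_ hE]] := tword_inv c0S c0al V cal.
have : \sum_s a (g s) *:m pure p s = 0.
  apply: iota_inj; rewrite iota0 iota_sum.
  transitivity (h *: \sum_(t' : SYTn | ctab (\val t') == c) a t' *:m vtab t').
    rewrite scaler_sumr -(sum_fibre _ cal); apply: eq_bigr => t' /eqP tc.
    rewrite mscaleC /vtab tc hE; last exact: wt_iota.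
    rewrite iota_scale; congr (a _ *:m _); have [gc gf] := gP (std_family t').
    by apply: std_family_inj; rewrite ?gc ?tc ?gf.
  by rewrite ac scaler0.
move=> /(p_basis.2 _)/(_ (std_family t)); congr (a _ = 0).
by have [gc gf] := gP (std_family t); apply: std_family_inj; rewrite ?gc ?gf.
Qed.

Lemma inSYT0_c0 (t : SYTn) : inSYT0 t = (ctab (\val t) == c0).
Proof.
rewrite inSYT0E; apply/idP/eqP => [tS|->//].
exact: sorted_block tS (content_SYT t).
Qed.

Lemma tword_c0 : tword c0 = 1. Proof. exact: tword_sorted. Qed.

Lemma vtab_SYT0 t : inSYT0 t -> vtab t = iota (pure p (std_family t)).
Proof. by rewrite inSYT0_c0 /vtab => /eqP->; rewrite tword_c0 scale1r. Qed.

Lemma tW_tword w : inWal al w -> tW w = tword (cact w c0).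
Proof. by move=> /(inWal_cmono c0S c0al) wc; apply: tW_cact. Qed.

Lemma vtab_tact (t t0 : SYTn) w : inWal al w -> inSYT0 t0 -> \val t = tact w (\val t0) ->
  vtab t = tW w *: vtab t0.
Proof.
move=> wW t0S tE; rewrite (vtab_SYT0 t0S) (tW_tword wW) /vtab.
have t0c : ctab (\val t0) = c0 by apply/eqP; rewrite -inSYT0_c0.
rewrite tE ctab_tact t0c; congr (_ *: iota (pure p _)).
apply/ffunP => j; apply: val_inj; rewrite !std_family_val tE (std_tact_mono lamP) //.
  exact: SYT_tab.
by rewrite t0c; apply/(inWal_cmono c0S c0al).
Qed.

Lemma weight_span w u : inWal al w -> in_weight (charW w (chi_al al)) u <->
  in_span (@inSYT0 _ _ lam) (fun t0 => tW w *: vtab t0) u.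
Proof.
move=> wW; rewrite chi0 charW_chi in_weightP (tW_tword wW).
have cal : content (cact w c0) =1 al by move=> j; rewrite content_cact.
split=> [/(wt_twordP cal)[z ->]|[a ->]].
  have [a ->] := p_basis.1 z; exists (fun t => a (std_family t)).
  rewrite iota_sum scaler_sumr -(sum_fibre _ c0al).
  apply: eq_big => [t|t tc]; first by rewrite -inSYT0_c0.
  by rewrite iota_scale mscaleC vtab_SYT0 ?inSYT0_c0.
apply: (big_ind (wt (cact w c0))) => [||t t0]; [exact: wt0 | exact: wtD |].
apply/wtZ/(wt_tword c0S c0al) => //.
by move: (wt_vtab t); move: t0; rewrite inSYT0_c0 => /eqP->.
Qed.

Lemma weight_span0 u : in_weight (chi_al al) u <-> in_span (@inSYT0 _ _ lam) vtab u.
Proof.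
have W1 : inWal al (1%g : 'S_n) by move=> j x y _ _; rewrite !perm1.
have := weight_span u W1; rewrite (tW_tword W1) cact1 tword_c0 chi0 charW_chi cact1 => ->.
by split=> -[a ->]; exists a; apply: eq_bigr => t _; rewrite scale1r.
Qed.

Lemma tW_vtab_gt (t : SYTn) i : (tcomp (\val t) (lo i) > tcomp (\val t) (hi i))%N ->
  tW (simple i) *: vtab t = qA X *:m ext0 vtab (tact (simple i) (\val t)).
Proof.
move=> ii; rewrite tW_simple.
have [|t' [t'E t'f]] := @tact_std t (simple i).
  by apply: cmono_simple; rewrite !ffunE; apply: contraTneq ii => ->; rewrite ltnn.
rewrite -t'E ext0_val {1}/vtab (@tword_descent _ _ i); last by rewrite /descent !ffunE.
rewrite -scalerA -ctab_tact -t'E -t'f (HR_HR_wt (wt_vtab t')) //.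
rewrite t'E ctab_tact !cact_simple simple_lo simple_hi !ffunE.
by apply: contraTneq ii => ->; rewrite ltnn.
Qed.

(** On the weight space of c, the identity is t_w g with g mapping into the
    weight space of chi_alpha, where e is the identity. *)
Lemma V_unit_sum : exists a g : col -> H, forall u : V,
  u = \sum_c a c *: (e *: (g c *: u)).
Proof.
have /choice[h hP] : forall c, exists h : H, has_content al c ->
    forall v : V, wt c v -> wt c0 (h *: v) /\ tword c *: (h *: v) = v.
  move=> c; have [cO|] := boolP (has_content al c); last by exists 0.
  by have [h [h1 _]] := tword_inv c0S c0al V (elimT (has_contentP _ _) cO); exists h.
exists (fun c => if has_content al c then tword c else 0), (fun c => h c * eD (chi c)).
move=> u; rewrite {1}[u](wt_sum_eD (V_wt_sum u)) big_mkcond.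
apply: eq_bigr => c _; case: ifP => [cO|]; last by rewrite scale0r.
have [|w1 w2] := hP c cO (eD (chi c) *: u); first by apply/in_weightP; exists u.
by rewrite -scalerA chi0 (eD_wt_id w1) w2.
Qed.

End HoefsmitInduced.

(** * Structure and irreducibility of the induced module *)

Theorem theorem3p17 (X : setting) (lam : 'I_(sb X) -> seq nat)
  (lamP : is_bpartition (sn X) lam)
  (P : forall j, lmodType (Ihecke X (bsize lam j)))
  (p : forall j, SYT (bsize lam j) (fun _ : unit => lam j) -> P j)
  (pP : forall j, is_hoefsmit (@p j))
  (eta : {rmorphism Ial (bsize lam) -> Hal (bsize lam)})
  (etaV : {rmorphism Hal (bsize lam) -> Ial (bsize lam)})
  (etaP : is_eta eta etaV) :
  let alpha := bsize lam in
  let P0lam := P0 etaV P in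
  let V := Vmod etaV P in
  (exists v : SYT (sn X) lam -> V,
    is_basis v /\
    (forall (t t0 : SYT (sn X) lam) (w : 'S_(sn X)),
       inWal alpha w -> inSYT0 t0 -> \val t = tact w (\val t0) ->
       v t = tW w *: v t0) /\
    (forall w : 'S_(sn X), inWal alpha w ->
       forall u : V, in_weight (charW w (chi_al alpha)) u <->
         in_span (@inSYT0 _ _ lam) (fun t0 => tW w *: v t0) u) /\
    (forall u : V, in_weight (chi_al alpha) u <->
       in_span (@inSYT0 _ _ lam) v u) /\
    (exists phi : {additive P0lam -> V},
       [/\ injective phi,
           forall u : V, in_weight (chi_al alpha) u <-> exists z, phi z = u
         & forall (h : Hal alpha) z, phi (h *: z) = \val h *: phi z]) /\
    in_O alpha V /\
    (forall (t : SYT (sn X) lam) (d : D X),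
       tD d *: v t = chi_tab (\val t) d *:m v t) /\
    (forall (t : SYT (sn X) lam) (i : 'I_(sn X).-1),
       let j := tcomp (\val t) (lo i) in
       let j' := tcomp (\val t) (hi i) in
       let k := axial (\val t) (hi i) (lo i) in
       let vs := ext0 v (tact (simple i) (\val t)) in
       [/\ (j < j')%N -> tW (simple i) *: v t = vs,
           j = j' -> tW (simple i) *: v t =
             (epsA X ^+ j.+1 * hcoef1 X k) *:m v t +
             (epsA X ^+ j.+1 * hcoef2 X k) *:m vs
         & (j > j')%N -> tW (simple i) *: v t = qA X *:m vs])) /\
  (forall (k : comPzRingType) (f : {rmorphism A X -> k}),
     irreducible_module (bcmod f V) <-> irreducible_module (bcmod f P0lam)).
Proof.
move=> alpha P0lam V.
have [c0 [c0S c0al chi0]] := block_colouring (sum_bsize lamP).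
split; last first.
  move=> k f; have [a [g ag]] := V_unit_sum P etaV c0S c0al chi0.
  exact: irreducible_induced ag.
exists (vtab lamP p etaV).
split; first exact: (vtab_basis lamP pP etaP c0S c0al chi0).
split; first by move=> t t0 w; apply: (vtab_tact lamP p etaV c0S c0al).
split; first by move=> w wW u; apply: (weight_span lamP pP etaP c0S c0al chi0).
split; first by move=> u; apply: (weight_span0 lamP pP etaP c0S c0al chi0).
split.
  exists (@ind_in _ _ _ _ P0lam); split.
  - exact: ind_in_inj.
  - move=> u; split=> [[v ->]|[z <-]]; last by exists (ind_in z); rewrite ind_in_e.
    by have [z zP] := ind_in_surj v; exists z.
  - exact: ind_inZ.
split.
  move=> u; exists u; rewrite (wt_sum_e_al c0S c0al chi0) //.
  exact: V_wt_sum c0al chi0 u.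
split.
  move=> t d; rewrite chi_tabE.
  exact: wt_tD (wt_vtab lamP p etaV c0S c0al chi0 t).
move=> t i j j' k vs; split=> [jj'|jj'|jj'].
- exact: tW_vtab_lt.
- exact: (tW_vtab_eq lamP pP etaP jj').
- exact: (tW_vtab_gt lamP p etaV c0S c0al chi0 jj').
Qed.
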